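(* Let $\{(\boldsymbol u_h^m,\boldsymbol\xi_h^m,\boldsymbol\chi_h^m)\}_{m=1}^N$ be the velocity and position solution of the fully discrete scheme described in the context, with Lagrange multipliers $\boldsymbol\lambda_h^m$. Assume that the Velocity Assumption, the Extension Assumption and the Mesh Assumption of the context hold, that $\gamma_s$ is sufficiently large and that $\Delta t$ is sufficiently small. Then there are constants $c_a,c_b,c_c>0$ independent of $h$, $\Delta t$ and $m$ such that for $m=1,\dots,N$ $$\|\boldsymbol u_h^m\|_{\Omega_h^m}^2+\|\boldsymbol\xi_h^m\|_2^2+\|\boldsymbol\chi_h^m\|_2^2+\Delta t\sum_{n=1}^m\Big[c_a\|\nabla\boldsymbol u_h^n\|_{\mathcal O^n_{\delta_h,\mathcal T}}^2+\gamma_\lambda j_h^n(\boldsymbol\lambda_h^n,\boldsymbol\lambda_h^n)\Big]$$ $$\le\exp\Big(t^m\frac{c_b}{1-\Delta t\,c_b}\Big)\Big[\|\boldsymbol u_h^0\|_{\Omega_h^0}^2+\|\boldsymbol\xi_h^0\|_2^2+\frac{c_{\mathrm{gp}}\Delta t}{2}|||\boldsymbol u_h^0|||_{\ast,0}^2+t^m\frac{c_c}{|\Gamma|}\|\boldsymbol g\|_2^2\Big],$$ where $c_{\mathrm{gp}}>0$ is the ($h$-, $\Delta t$- and cut-independent) constant of the ghost-penalty norm equivalence stated in the context.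
   Context: Notation. Bold spaces are spaces of $\mathbb R^d$-valued functions; $(\cdot,\cdot)_D,\|\cdot\|_D$ are the $L^2$ inner product and norm on $D$; $(\cdot,\cdot)_2,\|\cdot\|_2$ the Euclidean ones on $\mathbb R^d$. $a\lesssim b$ means $a\le cb$ with $c>0$ independent of $h$, $\Delta t$, $n$ and of how the interface cuts the mesh. Continuous problem. $\widetilde\Omega\subset\mathbb R^d$, $d\in\{2,3\}$, is open and bounded, $\widetilde\Omega=\Omega(t)\,\dot\cup\,\Gamma(t)\,\dot\cup\,\Sigma(t)$ for $t\in[0,t_{\mathrm{end}}]$, with $\Omega(t)=\{\phi(t,\cdot)<0\}$, $\Gamma(t)=\partial\Sigma(t)=\{\phi(t,\cdot)=0\}$ for a smooth level set function $\phi$; $\Gamma_{\mathrm{out}}=\partial\widetilde\Omega$; $\mathcal Q=\bigcup_{t\in(0,t_{\mathrm{end}})}\Omega(t)\times\{t\}$. The exact solution consists of $\boldsymbol u$ (bulk), $\boldsymbol\xi(t)\in\mathbb R^d$ (interface velocity) and $\boldsymbol\chi(t)\in\mathbb R^d$ (displacement of $\Sigma$ from its initial position, so $\Gamma(t)=\Gamma(0)+\boldsymbol\chi(t)$) with $\partial_t\boldsymbol u-\Delta\boldsymbol u=0$ in $\Omega(t)$, $\boldsymbol u=\boldsymbol\xi$ on $\Gamma(t)$, $\boldsymbol u=0$ on $\Gamma_{\mathrm{out}}$, $\boldsymbol u(0)=\boldsymbol u_0$; $\frac{d}{dt}\boldsymbol\xi=\boldsymbol g+\boldsymbol F$, $\frac{d}{dt}\boldsymbol\chi=\boldsymbol\xi$,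 $\boldsymbol\xi(0)=\boldsymbol\xi_0$, $\boldsymbol\chi(0)=0$, where $\boldsymbol g\in\mathbb R^d$ is constant, $\boldsymbol F=-\int_{\Gamma(t)}\partial_{\boldsymbol n}\boldsymbol u\,ds$ and $\boldsymbol n$ is the unit normal on $\Gamma(t)$ outward to $\Omega(t)$. $|\Gamma|$ is the $(d-1)$-dimensional measure of $\Gamma(t)$ (constant in time). Time grid and strips. $\Delta t=t_{\mathrm{end}}/N$, $t^n=n\Delta t$. $\mathcal O_\delta(D)=\{x\in\widetilde\Omega:\operatorname{dist}(x,D)\le\delta\}$, and $\mathcal O_\delta(\mathcal Q)$ is the corresponding space-time set. $w_\infty^{\boldsymbol n}=\max_{t\in[0,t_{\mathrm{end}}]}\|\boldsymbol\xi(t)\cdot\boldsymbol n\|_{L^\infty(\Gamma(t))}$. $\delta=c_\delta\Delta t\,w_\infty^{\boldsymbol n}$, $\delta_h=c_{\delta_h}w_\infty^{\boldsymbol n}\Delta t$ with $c_\delta,c_{\delta_h}>1$; it is assumed that $\Omega_h^{n+1}\subset\mathcal O_{\delta_h}(\Omega_h^n)$ and $\mathcal O_{\delta_h}(\Omega_h^n)\subset\mathcal O_\delta(\Omega(t^n))$. Extension Assumption. There is an extension operator $\mathcal E:\boldsymbol L^2(\Omega(t))\to\boldsymbol L^2(\mathcal O_\delta(\Omega(t)))$ such that, with constants uniform in $t$, for $\boldsymbol v\in\boldsymbol L^\infty(0,t_{\mathrm{end}};\boldsymbol H^{k+1}(\Omega(t)))\cap\boldsymbol W^{2,\infty}(\mathcal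 Q)$: $\|\mathcal E\boldsymbol v\|_{\boldsymbol H^k(\mathcal O_\delta(\Omega(t)))}\le c\|\boldsymbol v\|_{\boldsymbol H^k(\Omega(t))}$, $\|\nabla\mathcal E\boldsymbol v\|_{\mathcal O_\delta(\Omega(t))}\le c\|\nabla\boldsymbol v\|_{\Omega(t)}$, $\|\mathcal E\boldsymbol v\|_{\boldsymbol W^{2,\infty}(\mathcal O_\delta(\mathcal Q))}\le c\|\boldsymbol v\|_{\boldsymbol W^{2,\infty}(\mathcal Q)}$; and if $\boldsymbol v\in\boldsymbol L^\infty(0,t_{\mathrm{end}};\boldsymbol H^{k+1}(\Omega(t)))$ and $\boldsymbol v_t\in\boldsymbol L^\infty(0,t_{\mathrm{end}};\boldsymbol H^k(\Omega(t)))$, then $\|(\mathcal E\boldsymbol v)_t\|_{\boldsymbol H^k(\mathcal O_\delta(\Omega(t)))}\le c[\|\boldsymbol v\|_{\boldsymbol H^{k+1}(\Omega(t))}+\|\boldsymbol v_t\|_{\boldsymbol H^k(\Omega(t))}]$. Velocity Assumption. $\Delta t$ is so small that there is a constant $c_V>1$, with $c_\delta>c_V$, such that $\max_{i=1,\dots,N}\|\boldsymbol\xi^i\cdot\boldsymbol n\|_{L^\infty(\Gamma)}\le c_V w_\infty^{\boldsymbol n}$, where $\boldsymbol\xi^i$ are the interface velocities of the semi-discrete (in time only) implicit Euler scheme: find $\boldsymbol u^n\in\boldsymbol H^1(\Omega^n)$ vanishing on $\Gamma_{\mathrm{out}}$, $\boldsymbol\lambda^n\in\boldsymbol H^{-1/2}(\Gamma^n)$,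 $\boldsymbol\xi^n,\boldsymbol\chi^n\in\mathbb R^d$ with $\frac1{\Delta t}(\boldsymbol u^n-\mathcal E\boldsymbol u^{n-1},\boldsymbol v)_{\Omega^n}+(\nabla\boldsymbol u^n,\nabla\boldsymbol v)_{\Omega^n}+(\boldsymbol\lambda^n,\boldsymbol v)_{\Gamma^n}+(\boldsymbol\mu,\boldsymbol u^n-\boldsymbol\xi^n)_{\Gamma^n}=0$ for all test functions $\boldsymbol v,\boldsymbol\mu$ in the same spaces, $\boldsymbol\xi^n=\boldsymbol\xi^{n-1}+\Delta t(\boldsymbol g-\int_{\Gamma^n}\partial_{\boldsymbol n}\boldsymbol u^n\,ds)$, $\boldsymbol\chi^n=\boldsymbol\chi^{n-1}+\Delta t\,\boldsymbol\xi^n$, where $\Gamma^n=\Gamma(0)+\boldsymbol\chi^n$ and $\Omega^n$ is the corresponding bulk domain. Mesh sets. $\widetilde{\mathcal T}_h$ is a simplicial, shape-regular, quasi-uniform mesh of $\widetilde\Omega$ of mesh size $h$. $\Omega_h^n,\Gamma_h^n$ are the bulk domain and interface obtained by translating the initial $\Sigma$ by the discrete displacement $\boldsymbol\chi_h^n$. $\mathcal T^n_{h,\delta_h}=\{T\in\widetilde{\mathcal T}_h:\exists x\in T,\ \operatorname{dist}(x,\Omega_h^n)\le\delta_h\}$ with union $\mathcal O^n_{\delta_h,\mathcal T}$; $\mathcal T_h^n$ is the same set with $\delta_h$ replaced by $0$; $\mathcal T^n_{h,\Gamma_h^n}=\{T:\operatorname{meas}_{d-1}(T\cap\Gamma_h^n)>0\}$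 with union $\mathcal O^n_{\Gamma_h^n}$; $\mathcal T^n_{h,\mathcal S^\pm}=\{T\in\mathcal T^n_{h,\delta_h}:\exists x\in T,\ \operatorname{dist}(x,\Gamma_h^n)\le\delta_h\}$; $\mathcal T^n_{h,\mathcal S^+}=\{T\in\mathcal T^n_{h,\delta_h}:\exists x\in T\cap(\widetilde\Omega\setminus\Omega_h^n),\ \operatorname{dist}(x,\Gamma_h^n)\le\delta_h\}$; $\mathcal F^n_{h,\delta_h}$ is the set of facets $F=\overline T_1\cap\overline T_2$ with $T_1\in\mathcal T^n_{h,\delta_h}$, $T_2\in\mathcal T^n_{h,\mathcal S^\pm}$, $T_1\ne T_2$, $\operatorname{meas}_{d-1}(F)>0$. Mesh Assumption. (a) For every cut element $T$, $\Gamma_h^n$ intersects $\partial T$ exactly twice and each (open) edge exactly once. (b) For each cut element $T$ there are a plane $S_T$ and a piecewise smooth parametrisation $S_T\cap T\to\Gamma_h^n\cap T$. (c) Every $T\in\mathcal T^n_{h,\mathcal S^+}$ can be connected to an uncut element $T'\in\mathcal T_h^n\setminus\mathcal T^n_{h,\mathcal S^+}$ by a path crossing at most $K\lesssim 1+\delta_h/h$ facets of $\mathcal F^n_{h,\delta_h}$, and each such $T'$ is the end of at most $M$ such paths, $M$ bounded independently of $\Delta t$ and $h$. Discrete scheme. For $k\ge2$, $\boldsymbol V_h^n$ is the space of continuous $\mathbb R^d$-valued functions on $\mathcal O^n_{\delta_h,\mathcal T}$, piecewise polynomial of degree $k$ on $\mathcal T^n_{h,\delta_h}$ and vanishing on $\Gamma_{\mathrm{out}}$;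 $\boldsymbol N_h^n$ is the space of continuous $\mathbb R^d$-valued functions on $\mathcal O^n_{\Gamma_h^n}$, piecewise polynomial of degree $k-1$ on $\mathcal T^n_{h,\Gamma_h^n}$. Forms: $a_h^n(\boldsymbol u,\boldsymbol v)=\int_{\Omega_h^n}\nabla\boldsymbol u:\nabla\boldsymbol v\,dx$, $b_h^n(\boldsymbol\lambda,\boldsymbol v)=\int_{\Gamma_h^n}\boldsymbol\lambda\cdot\boldsymbol v\,ds$, $j_h^n(\boldsymbol\lambda,\boldsymbol\mu)=h^2\int_{\mathcal O^n_{\Gamma_h^n}}(\boldsymbol n\cdot\nabla\boldsymbol\lambda)\cdot(\boldsymbol n\cdot\nabla\boldsymbol\mu)\,dx$ with $\boldsymbol n=-\nabla\phi/\|\nabla\phi\|_2$ extending the unit normal field (up to sign), and $i_h^n(\boldsymbol u,\boldsymbol v)=h^{-2}\sum_{F\in\mathcal F^n_{h,\delta_h}}\int_{\omega_F}[\![\boldsymbol u]\!]\cdot[\![\boldsymbol v]\!]\,dx$, where $\omega_F=T_1\cup T_2$ for $F=\overline T_1\cap\overline T_2$ and $[\![\boldsymbol u]\!]=\boldsymbol u_1-\boldsymbol u_2$ with $\boldsymbol u_i$ the canonical polynomial extension of $\boldsymbol u|_{T_i}$ to $\mathbb R^d$. Parameters: $\gamma_{gp}=\gamma_sK$ with $\gamma_s>0$ independent of $h,\Delta t$; $\gamma_\lambda>0$. Given compatible initial data $\Omega_h^0$, $\boldsymbol u_h^0\in\boldsymbol V_h^0$, $\boldsymbol\xi_h^0\in\mathbb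 R^d$, and $\boldsymbol\chi_h^0=0$, the scheme is: for $n=1,\dots,N$ find $(\boldsymbol u_h^n,\boldsymbol\lambda_h^n,\boldsymbol\xi_h^n,\boldsymbol\chi_h^n)\in\boldsymbol V_h^n\times\boldsymbol N_h^n\times\mathbb R^d\times\mathbb R^d$ such that for all $(\boldsymbol v_h,\boldsymbol\mu_h,\boldsymbol\zeta_1,\boldsymbol\zeta_2)$ in the same space $$\tfrac1{\Delta t}(\boldsymbol u_h^n-\boldsymbol u_h^{n-1},\boldsymbol v_h)_{\Omega_h^n}+a_h^n(\boldsymbol u_h^n,\boldsymbol v_h)+b_h^n(\boldsymbol\lambda_h^n,\boldsymbol v_h)+b_h^n(\boldsymbol\mu_h,\boldsymbol u_h^n-\boldsymbol\xi_h^n)+\gamma_{gp}i_h^n(\boldsymbol u_h^n,\boldsymbol v_h)-\gamma_\lambda j_h^n(\boldsymbol\lambda_h^n,\boldsymbol\mu_h)$$ $$+\tfrac1{\Delta t}(\boldsymbol\xi_h^n-\boldsymbol\xi_h^{n-1},\boldsymbol\zeta_1)_2+\tfrac1{\Delta t}(\boldsymbol\chi_h^n-\boldsymbol\chi_h^{n-1},\boldsymbol\zeta_2)_2=(\boldsymbol F_h^n+\boldsymbol g,\boldsymbol\zeta_1)_2+(\boldsymbol\xi_h^n,\boldsymbol\zeta_2)_2,\qquad \boldsymbol F_h^n=\int_{\Gamma_h^n}\boldsymbol\lambda_h^n\,ds.$$ Norm. $|||\boldsymbol v|||_{\ast,n}^2=\|\nabla\boldsymbol v\|_{\mathcal O^n_{\delta_h,\mathcal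 T}}^2+\|h^{-1/2}\boldsymbol v\|_{\Gamma_h^n}^2$. Ghost-penalty norm equivalence (known). For all $\boldsymbol v_h\in\boldsymbol V_h^n$, $\|\nabla\boldsymbol v_h\|_{\mathcal O^n_{\delta_h,\mathcal T}}^2\simeq\|\nabla\boldsymbol v_h\|_{\Omega_h^n}^2+K\,i_h^n(\boldsymbol v_h,\boldsymbol v_h)$, i.e. each side is bounded by a constant times the other, with constants independent of $h$, $\Delta t$, $n$ and the cut position. *)

(* Defs.v *)
From HB Require Import structures.
From mathcomp Require Import all_boot all_order all_algebra.
From mathcomp Require Import all_classical all_reals all_analysis.

Set Implicit Arguments.
Unset Strict Implicit.
Unset Printing Implicit Defensive.

Import Order.TTheory GRing.Theory Num.Theory.
Import numFieldNormedType.Exports.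

Local Open Scope classical_set_scope.
Local Open Scope ring_scope.

(* The library norm on ['rV[R]_n] is the sup norm; it induces the same topology
   and the same bounded sets, but lengths and distances below are Euclidean. *)
Section Euclidean.
Context {R : realType}.

Definition dotv {n} (x y : 'rV[R]_n) : R := \sum_i x 0 i * y 0 i.
Definition enorm {n} (x : 'rV[R]_n) : R := Num.sqrt (dotv x x).
Definition frob {m n} (A B : 'M[R]_(m, n)) : R := \sum_i \sum_j A i j * B i j.

Definition dist {n} (x : 'rV[R]_n) (A : set 'rV[R]_n) : \bar R :=
  ereal_inf [set (enorm (x - y))%:E | y in A].

Definition diam {n} (A : set 'rV[R]_n) : \bar R :=
  ereal_sup [set (enorm (x - y))%:E | x in A & y in A].

Definition boundary {n} (A : set 'rV[R]_n) : set 'rV[R]_n :=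
  closure A `\` interior A.

Definition translate {n} (c : 'rV[R]_n) (A : set 'rV[R]_n) : set 'rV[R]_n :=
  [set x + c | x in A].

End Euclidean.

Section OuterMeasures.
Context {R : realType}.
Local Open Scope ereal_scope.

(* [mu_ext] with every set admitted in the countable covers. *)
Definition cover_outer {T : pointedType} (g : set T -> \bar R) (X : set T) :
    \bar R :=
  mu_ext (T := g_sigma_algebraType [set: set T]) g X.

Definition box_gauge {n} (A : set 'rV[R]_n) : \bar R :=
  if `[< A = set0 >] then 0 else
  ereal_inf [set (\prod_i (ab.2 0 i - ab.1 0 i)%R)%:E |
    ab in [set ab : 'rV[R]_n * 'rV[R]_n |
      (forall i, (ab.1 0 i <= ab.2 0 i)%R) /\
      A `<=` [set x | forall i, (ab.1 0 i <= x 0 i <= ab.2 0 i)%R]]].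

Lemma box_gauge0 n : box_gauge (set0 : set 'rV[R]_n) = 0.
Proof. by rewrite /box_gauge; case: asboolP. Qed.

Lemma box_gauge_ge0 n (A : set 'rV[R]_n) : 0 <= box_gauge A.
Proof.
rewrite /box_gauge; case: asboolP => // _.
apply: le_ereal_inf_tmp => _ [[a b] [ab _] <-].
by rewrite lee_fin; apply: prodr_ge0 => i _; rewrite subr_ge0.
Qed.

Section CoverOuter.
Context {T : pointedType} {g : set T -> \bar R}.
Hypotheses (g0 : g set0 = 0) (g_ge0 : forall A, 0 <= g A).

Lemma cover_outer0 : cover_outer g set0 = 0.
Proof. exact: (@mu_ext0 _ (g_sigma_algebraType [set: set T])). Qed.

Lemma cover_outer_ge0 A : 0 <= cover_outer g A.
Proof. exact: (@mu_ext_ge0 _ (g_sigma_algebraType [set: set T])). Qed.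

Lemma le_cover_outer : {homo cover_outer g : A B / A `<=` B >-> A <= B}.
Proof. exact: (@le_mu_ext _ (g_sigma_algebraType [set: set T])). Qed.

Lemma cover_outer_sigma_subadditive : sigma_subadditive (cover_outer g).
Proof.
exact: (@mu_ext_sigma_subadditive _ (g_sigma_algebraType [set: set T])).
Qed.

End CoverOuter.

Definition leb_outer n : set 'rV[R]_n -> \bar R := cover_outer box_gauge.

HB.instance Definition _ n := isOuterMeasure.Build R 'rV[R]_n (@leb_outer n)
  (cover_outer0 (@box_gauge0 n) (@box_gauge_ge0 n))
  (cover_outer_ge0 (@box_gauge_ge0 n))
  (@le_cover_outer _ box_gauge)
  (cover_outer_sigma_subadditive (@box_gauge_ge0 n)).

(* Volume of the [m]-dimensional Euclidean ball of diameter 1: with this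
   constant the [m]-dimensional Hausdorff measure is the surface measure. *)
Definition hcst (m : nat) : \bar R :=
  leb_outer [set x : 'rV[R]_m | (enorm x <= 2^-1)%R].

Definition haus_gauge (m : nat) {n} (r : R) (A : set 'rV[R]_n) : \bar R :=
  if `[< A = set0 >] then 0 else
  if diam A <= r%:E then hcst m * diam A ^+ m else +oo.

Lemma haus_gauge0 m n r : haus_gauge m r (set0 : set 'rV[R]_n) = 0.
Proof. by rewrite /haus_gauge; case: asboolP. Qed.

Lemma haus_gauge_ge0 m n r (A : set 'rV[R]_n) : 0 <= haus_gauge m r A.
Proof.
rewrite /haus_gauge; case: asboolP => // /eqP/set0P[x Ax]; case: ifP => // _.
apply: mule_ge0; first exact: (outer_measure_ge0 (@leb_outer m)).
apply: expe_ge0; apply: ereal_sup_ubound; exists x => //; exists x => //.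
by rewrite subrr /enorm /dotv big1 ?sqrtr0 // => i _; rewrite mxE mul0r.
Qed.

Definition haus_outer (m n : nat) (A : set 'rV[R]_n) : \bar R :=
  ereal_sup [set cover_outer (haus_gauge m r) A | r in [set r : R | (0 < r)%R]].

Lemma haus_outer_ub m n (r : R) (A : set 'rV[R]_n) : (0 < r)%R ->
  cover_outer (haus_gauge m r) A <= haus_outer m A.
Proof. by move=> r0; apply: ereal_sup_ubound; exists r. Qed.

Lemma haus_outer0 m n : haus_outer m (set0 : set 'rV[R]_n) = 0.
Proof.
have E r : cover_outer (haus_gauge m r) (set0 : set 'rV[R]_n) = 0.
  exact: (cover_outer0 (@haus_gauge0 m n r) (@haus_gauge_ge0 m n r)).
apply/eqP; rewrite eq_le; apply/andP; split.
  by apply: ge_ereal_sup => _ [r _ <-]; rewrite E.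
by rewrite -(E 1%R); exact: haus_outer_ub.
Qed.

Lemma haus_outer_ge0 m n (A : set 'rV[R]_n) : 0 <= haus_outer m A.
Proof.
apply: le_trans (haus_outer_ub m A (ltr01 : (0 < 1 :> R)%R)).
exact: (cover_outer_ge0 (@haus_gauge_ge0 m n 1%R)).
Qed.

Lemma le_haus_outer m n :
  {homo (@haus_outer m n) : A B / A `<=` B >-> A <= B}.
Proof.
move=> A B AB; apply: ge_ereal_sup => _ [r r0 <-].
apply: le_trans (haus_outer_ub m B r0).
exact: le_cover_outer.
Qed.

Lemma haus_outer_sigma_subadditive m n : sigma_subadditive (@haus_outer m n).
Proof.
move=> F; apply: ge_ereal_sup => _ [r r0 <-].
apply: le_trans
  (cover_outer_sigma_subadditive (@haus_gauge_ge0 m n r) F) _.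
apply: lee_nneseries => [i _ _|i _].
  exact: (cover_outer_ge0 (@haus_gauge_ge0 m n r)).
exact: haus_outer_ub.
Qed.

HB.instance Definition _ m n := isOuterMeasure.Build R 'rV[R]_n
  (@haus_outer m n) (@haus_outer0 m n) (@haus_outer_ge0 m n)
  (@le_haus_outer m n) (@haus_outer_sigma_subadditive m n).

Definition leb_om (n : nat) : {outer_measure set 'rV[R]_n -> \bar R} :=
  @leb_outer n.

Definition haus_om (m n : nat) : {outer_measure set 'rV[R]_n -> \bar R} :=
  @haus_outer m n.

Definition leb (n : nat) :
    {measure set (caratheodory_type (leb_om n)) -> \bar R} :=
  leb_om n : set (caratheodory_type (leb_om n)) -> \bar R.

Definition haus (m n : nat) :
    {measure set (caratheodory_type (haus_om m n)) -> \bar R} :=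
  haus_om m n : set (caratheodory_type (haus_om m n)) -> \bar R.

(* Surface measure on hypersurfaces of R^n. *)
Definition surf (n : nat) := haus n.-1 n.

Definition vint {n} (D : set 'rV[R]_n) (f : 'rV[R]_n -> R) : R :=
  Rintegral (leb n) D f.

Definition sint {n} (G : set 'rV[R]_n) (f : 'rV[R]_n -> R) : R :=
  Rintegral (surf n) G f.

End OuterMeasures.

Section Sobolev.
Context {R : realType}.

Definition partial {n} (i : 'I_n) (f : 'rV[R]_n -> R) : 'rV[R]_n -> R :=
  fun x => 'D_(delta_mx 0 i) f x.

Fixpoint Ck {n} (k : nat) (f : 'rV[R]_n -> R) : Prop :=
  match k with
  | 0%N => continuous f
  | k'.+1 => continuous f /\ forall i,
      (forall x, derivable f x (delta_mx 0 i)) /\ Ck k' (partial i f)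
  end.

Definition smooth {n} (f : 'rV[R]_n -> R) : Prop := forall k, Ck k f.

Definition component {T : Type} {m} (u : T -> 'rV[R]_m) (i : 'I_m) : T -> R :=
  fun x => u x 0 i.

Definition smoothv {n m} (u : 'rV[R]_n -> 'rV[R]_m) : Prop :=
  forall i, smooth (component u i).

(* Pointwise gradient, [grad u x i j] being the [j]-th partial derivative of
   [u_i]. *)
Definition grad {n m} (u : 'rV[R]_n -> 'rV[R]_m) (x : 'rV[R]_n) :
    'M[R]_(m, n) :=
  \matrix_(i, j) partial j (component u i) x.

Definition grads {n} (f : 'rV[R]_n -> R) (x : 'rV[R]_n) : 'rV[R]_n :=
  \row_j partial j f x.

Definition dmulti {n} (a : 'I_n -> nat) (f : 'rV[R]_n -> R) : 'rV[R]_n -> R :=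
  foldr (fun i g => iter (a i) (partial i) g) f (enum 'I_n).

Definition order_of {n} (a : 'I_n -> nat) : nat := \sum_i a i.

Definition mdeg {n k} (a : {ffun 'I_n -> 'I_k.+1}) : 'I_n -> nat :=
  fun i => a i.

Definition dir {n} (j : 'I_n) : 'I_n -> nat := fun l => (l == j)%N.

Definition leb_measurable {n} (D : set 'rV[R]_n) (f : 'rV[R]_n -> R) : Prop :=
  measurable_fun (D : set (caratheodory_type (leb_om n)))
    (f : caratheodory_type (leb_om n) -> R).

Section Lebesgue_spaces.
Context {disp : measure_display} {T : measurableType disp}
  (mu : {measure set T -> \bar R}).

Definition in_L2 (D : set T) (f : T -> R) : Prop :=
  measurable_fun D f /\ mu.-integrable D (fun x => ((f x) ^+ 2)%:E).

Definition in_L2v {m} (D : set T) (u : T -> 'rV[R]_m) : Prop :=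
  forall i, in_L2 D (component u i).

Definition L2norm (D : set T) (f : T -> R) : \bar R :=
  Lnorm mu 2%:E ((EFin \o f) \_ D).

Definition L2normv {m} (D : set T) (u : T -> 'rV[R]_m) : \bar R :=
  ((\sum_(i < m) L2norm D (component u i) ^+ 2) `^ 2^-1)%E.

Definition Linfnorm (D : set T) (f : T -> R) : \bar R :=
  Lnorm mu +oo%E ((EFin \o f) \_ D).

End Lebesgue_spaces.

Definition loc_integrable {n} (D : set 'rV[R]_n) (f : 'rV[R]_n -> R) : Prop :=
  forall K : set 'rV[R]_n, compact K -> K `<=` interior D ->
    (leb n).-integrable K (EFin \o f).

Definition test_fun {n} (D : set 'rV[R]_n) (psi : 'rV[R]_n -> R) : Prop :=
  smooth psi /\ exists K : set 'rV[R]_n,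
    [/\ compact K, K `<=` interior D & forall x, ~ K x -> psi x = 0].

(* [D] need not be open (strips around a domain are not): test functions are
   supported in its interior. *)
Definition weak_deriv {n} (D : set 'rV[R]_n) (a : 'I_n -> nat)
    (f g : 'rV[R]_n -> R) : Prop :=
  [/\ loc_integrable D f, loc_integrable D g &
    forall psi, test_fun D psi ->
      vint D (fun x => f x * dmulti a psi x) =
      (-1) ^+ order_of a * vint D (fun x => g x * psi x)].

(* A representative of the weak derivative; meaningful only when one exists. *)
Definition wder {n} (D : set 'rV[R]_n) (a : 'I_n -> nat) (f : 'rV[R]_n -> R) :
    'rV[R]_n -> R :=
  xget (fun=> 0) [set g | weak_deriv D a f g].

Definition in_H {n m} (k : nat) (D : set 'rV[R]_n) (u : 'rV[R]_n -> 'rV[R]_m) :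
    Prop :=
  forall (i : 'I_m) (a : 'I_n -> nat), (order_of a <= k)%N ->
    (exists g, weak_deriv D a (component u i) g) /\
    in_L2 (leb n) D (wder D a (component u i)).

Definition Hnorm {n m} (k : nat) (D : set 'rV[R]_n) (u : 'rV[R]_n -> 'rV[R]_m) :
    \bar R :=
  ((\sum_(i < m) \sum_(a : {ffun 'I_n -> 'I_k.+1} | (order_of (mdeg a) <= k)%N)
      L2norm (leb n) D (wder D (mdeg a) (component u i)) ^+ 2) `^ 2^-1)%E.

Definition in_W2inf {n m} (D : set 'rV[R]_n) (u : 'rV[R]_n -> 'rV[R]_m) :
    Prop :=
  forall (i : 'I_m) (a : 'I_n -> nat), (order_of a <= 2)%N ->
    [/\ exists g, weak_deriv D a (component u i) g,
        leb_measurable D (wder D a (component u i)) &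
        (Linfnorm (leb n) D (wder D a (component u i)) < +oo)%E].

Definition W2infnorm {n m} (D : set 'rV[R]_n) (u : 'rV[R]_n -> 'rV[R]_m) :
    \bar R :=
  \big[maxe/0%E]_(i < m)
    \big[maxe/0%E]_(a : {ffun 'I_n -> 'I_3} | (order_of (mdeg a) <= 2)%N)
      Linfnorm (leb n) D (wder D (mdeg a) (component u i)).

Definition wgrad {n m} (D : set 'rV[R]_n) (u : 'rV[R]_n -> 'rV[R]_m)
    (x : 'rV[R]_n) : 'M[R]_(m, n) :=
  \matrix_(i, j) wder D (dir j) (component u i) x.

Definition wgradnorm {n m} (D : set 'rV[R]_n) (u : 'rV[R]_n -> 'rV[R]_m) :
    \bar R :=
  ((\sum_(i < m) \sum_(j < n)
      L2norm (leb n) D (wder D (dir j) (component u i)) ^+ 2) `^ 2^-1)%E.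

End Sobolev.

Section Traces.
Context {R : realType} {n : nat}.
Implicit Types (D S : set 'rV[R]_n) (u v w : 'rV[R]_n -> 'rV[R]_n).

(* [w] is the trace on [S] of [v] in H^1(D): the trace operator is the
   continuous extension of the restriction of smooth functions. *)
Definition is_trace D S v w : Prop :=
  [/\ in_H 1 D v, in_L2v (surf n) S w &
    exists vs : nat -> 'rV[R]_n -> 'rV[R]_n,
      [/\ forall j, smoothv (vs j),
          (fun j => Hnorm 1 D (fun x => vs j x - v x)) @ \oo --> 0%E &
          (fun j => L2normv (surf n) S (fun x => vs j x - w x)) @ \oo --> 0%E]].

(* H^{1/2}(S) is the range of the trace operator with the quotient norm, and
   H^{-1/2}(S) its dual. *)
Definition in_Hmhalf D S (lam : ('rV[R]_n -> 'rV[R]_n) -> R) : Prop :=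
  (forall (a : R) w1 w2, (exists v, is_trace D S v w1) ->
    (exists v, is_trace D S v w2) ->
    lam (fun x => a *: w1 x + w2 x) = a * lam w1 + lam w2) /\
  exists C : R, forall v w, is_trace D S v w ->
    (`|lam w|%:E <= C%:E * Hnorm 1 D v)%E.

(* The normal derivative on [S] of [u] in H^1(D), as an element of
   H^{-1/2}(S): <d_n u, v> = (grad u, grad v) + (Delta u, v) for all [v] in
   H^1(D) with zero trace on the remaining part [G] of the boundary; it requires
   [Delta u = f] in L^2(D). *)
Definition is_normal_deriv D S G u (nu : ('rV[R]_n -> 'rV[R]_n) -> R) : Prop :=
  in_Hmhalf D S nu /\ exists f : 'rV[R]_n -> 'rV[R]_n,
    [/\ in_L2v (leb n) D f,
        forall psi : 'rV[R]_n -> 'rV[R]_n,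
          (forall i, test_fun D (component psi i)) ->
          vint D (fun x => frob (wgrad D u x) (grad psi x)) =
          - vint D (fun x => dotv (f x) (psi x)) &
        forall v w, is_trace D G v (fun=> 0) -> is_trace D S v w ->
          nu w = vint D (fun x => frob (wgrad D u x) (wgrad D v x)) +
                 vint D (fun x => dotv (f x) (v x))].

End Traces.

Record problem (R : realType) (d : nat) := Problem {
  Otilde : set 'rV[R]_d;
  tend : R;
  phi : R -> 'rV[R]_d -> R;
  grav : 'rV[R]_d;
  ini_u : 'rV[R]_d -> 'rV[R]_d;
  ini_xi : 'rV[R]_d;
  sol_u : R -> 'rV[R]_d -> 'rV[R]_d;
  sol_xi : R -> 'rV[R]_d;
  sol_chi : R -> 'rV[R]_d }.

Section Continuous.
Context {R : realType} {d : nat} (P : problem R d).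
Local Notation V := 'rV[R]_d.

(* Points of space-time are vectors of length [1 + d], time first. *)
Definition stset (I : set R) (A : R -> set V) : set 'rV[R]_(1 + d) :=
  [set z | I (lsubmx z 0 0) /\ A (lsubmx z 0 0) (rsubmx z)].

Definition stfun {X : Type} (f : R -> V -> X) : 'rV[R]_(1 + d) -> X :=
  fun z => f (lsubmx z 0 0) (rsubmx z).

Definition timedir : 'I_(1 + d) -> nat := dir (lshift d ord0).

Definition Om (t : R) : set V := [set x | Otilde P x /\ phi P t x < 0].
Definition Gam (t : R) : set V := [set x | Otilde P x /\ phi P t x = 0].
Definition Sig (t : R) : set V := [set x | Otilde P x /\ 0 < phi P t x].
Definition Gout : set V := boundary (Otilde P).

Definition Iopen : set R := [set t | 0 < t < tend P].
Definition Iclosed : set R := [set t | 0 <= t <= tend P].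
Definition Q : set 'rV[R]_(1 + d) := stset Iopen Om.

(* Unit normal on [Gam t], outward to [Om t] where [phi < 0]. *)
Definition nrm (t : R) (x : V) : V :=
  (enorm (grads (phi P t) x))^-1 *: grads (phi P t) x.

Definition flux_quot (t : R) (i : 'I_d) (x : V) (s : R) : R :=
  s^-1 * (sol_u P t x 0 i - sol_u P t (x - s *: nrm t x) 0 i).

Definition dn_u (t : R) (i : 'I_d) (x : V) : R :=
  lim (flux_quot t i x s @[s --> 0^'+]).

Definition force (t : R) : V := \row_i (- sint (Gam t) (dn_u t i)).

Definition moving_domain : Prop :=
  [/\ open (Otilde P) /\ bounded_set (Otilde P),
      0 < tend P,
      smooth (stfun (phi P)) &
      forall t, Iclosed t ->
      [/\ Sig t !=set0, boundary (Sig t) = Gam t,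
          forall x, Gam t x -> grads (phi P t) x != 0,
          Gam t = translate (sol_chi P t) (Gam 0) &
          Sig t = translate (sol_chi P t) (Sig 0)]].

Definition bulk_equation : Prop :=
  [/\ {within stset Iclosed (fun t => closure (Om t)), continuous
        (stfun (sol_u P))},
      forall t x i, Iopen t -> Om t x ->
      [/\ derivable (fun s => sol_u P s x 0 i) t 1,
          forall j, derivable (component (sol_u P t) i) x (delta_mx 0 j) /\
            derivable (partial j (component (sol_u P t) i)) x (delta_mx 0 j) &
          derive1 (fun s => sol_u P s x 0 i) t -
            \sum_j partial j (partial j (component (sol_u P t) i)) x = 0],
      forall t x, Iclosed t -> Gam t x -> sol_u P t x = sol_xi P t,
      forall t x, Iclosed t -> Gout x -> sol_u P t x = 0 &
      forall x, Om 0 x -> sol_u P 0 x = ini_u P x].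

Definition solid_equation : Prop :=
  [/\ forall t x i, Iopen t -> Gam t x -> cvg (flux_quot t i x s @[s --> 0^'+]),
      forall t i, Iopen t -> (surf d).-integrable (Gam t) (EFin \o dn_u t i),
      {within Iclosed, continuous (sol_xi P)} /\
      {within Iclosed, continuous (sol_chi P)},
      forall t, Iopen t ->
        is_derive t (1 : R) (sol_xi P) (grav P + force t) /\
        is_derive t (1 : R) (sol_chi P) (sol_xi P t) &
      sol_xi P 0 = ini_xi P /\ sol_chi P 0 = 0].

Definition continuous_problem : Prop :=
  [/\ moving_domain, bulk_equation & solid_equation].

Definition area : R := fine (surf d (Gam 0)).

Definition winf : R :=
  fine (ereal_sup [set Linfnorm (surf d) (Gam t)
    (fun x => dotv (sol_xi P t) (nrm t x)) | t in Iclosed]).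

Definition strip (r : R) (D : set V) : set V :=
  [set x | Otilde P x /\ (dist x D <= r%:E)%E].

(* The geometry obtained by translating the initial solid by [c]. *)
Definition SigD (c : V) : set V := translate c (Sig 0).
Definition GamD (c : V) : set V := translate c (Gam 0).
Definition OmD (c : V) : set V := Otilde P `\` (SigD c `|` GamD c).
Definition nrmD (c : V) (x : V) : V := nrm 0 (x - c).
Definition admissible (c : V) : Prop := SigD c `|` GamD c `<=` Otilde P.

(* Operators on L^2 classes: compatible with equality almost everywhere. *)
Definition extension_op (r : R) (D : set V) (E : (V -> V) -> V -> V) : Prop :=
  (forall v, in_L2v (leb d) D v ->
    in_L2v (leb d) (strip r D) (E v) /\
    (\forall x \ae leb d, D x -> E v x = v x)) /\
  (forall v w, in_L2v (leb d) D v -> in_L2v (leb d) D w ->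
    (\forall x \ae leb d, D x -> v x = w x) ->
    \forall x \ae leb d, strip r D x -> E v x = E w x).

Definition in_LinfH (k : nat) (v : R -> V -> V) : Prop :=
  (forall i, leb_measurable Q (component (stfun v) i)) /\
  exists C : R, \forall t \ae @lebesgue_measure R, Iopen t ->
    in_H k (Om t) (v t) /\ (Hnorm k (Om t) (v t) <= C%:E)%E.

Definition weak_time_deriv (D : set 'rV[R]_(1 + d)) (v vt : R -> V -> V) :
    Prop :=
  forall i, weak_deriv D timedir
    (component (stfun v) i) (component (stfun vt) i).

Definition extension_assumption (k : nat) (r c : R)
    (E : set V -> (V -> V) -> V -> V) : Prop :=
  let Ev (v : R -> V -> V) := fun t => E (Om t) (v t) in
  let Qr := stset Iopen (fun t => strip r (Om t)) in
  [/\ forall t, Iclosed t -> extension_op r (Om t) (E (Om t)),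
      forall v, in_LinfH k.+1 v -> in_W2inf Q (stfun v) ->
        [/\ \forall t \ae @lebesgue_measure R, Iopen t ->
              [/\ in_H k (strip r (Om t)) (Ev v t),
                  (Hnorm k (strip r (Om t)) (Ev v t) <=
                     c%:E * Hnorm k (Om t) (v t))%E &
                  (wgradnorm (strip r (Om t)) (Ev v t) <=
                     c%:E * wgradnorm (Om t) (v t))%E],
            in_W2inf Qr (stfun (Ev v)) &
            (W2infnorm Qr (stfun (Ev v)) <= c%:E * W2infnorm Q (stfun v))%E] &
      forall v vt, in_LinfH k.+1 v -> weak_time_deriv Q v vt -> in_LinfH k vt ->
        exists2 Evt, weak_time_deriv Qr (Ev v) Evt &
          \forall t \ae @lebesgue_measure R, Iopen t ->
            in_H k (strip r (Om t)) (Evt t) /\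
            (Hnorm k (strip r (Om t)) (Evt t) <=
               c%:E * (Hnorm k.+1 (Om t) (v t) + Hnorm k (Om t) (vt t)))%E].

Definition semidiscrete_solution (N : nat) (r : R)
    (E : set V -> (V -> V) -> V -> V)
    (u : nat -> V -> V) (lam : nat -> (V -> V) -> R) (xi chi : nat -> V) :
    Prop :=
  let dt := tend P / N%:R in
  [/\ u 0%N = ini_u P, xi 0%N = ini_xi P, chi 0%N = 0 &
    forall n, (n < N)%N ->
    let D := OmD (chi n.+1) in let G := GamD (chi n.+1) in
    [/\ admissible (chi n.+1) /\ extension_op r (OmD (chi n)) (E (OmD (chi n))),
        in_H 1 D (u n.+1) /\ is_trace D Gout (u n.+1) (fun=> 0),
        in_Hmhalf D G (lam n.+1),
        exists2 wu, is_trace D G (u n.+1) wu &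
          forall v w mu, in_H 1 D v -> is_trace D Gout v (fun=> 0) ->
            is_trace D G v w -> in_Hmhalf D G mu ->
            dt^-1 * vint D (fun x =>
                dotv (u n.+1 x - E (OmD (chi n)) (u n) x) (v x)) +
            vint D (fun x => frob (wgrad D (u n.+1) x) (wgrad D v x)) +
            lam n.+1 w + mu (fun x => wu x - xi n.+1) = 0 &
        (exists2 nu, is_normal_deriv D G Gout (u n.+1) nu &
          xi n.+1 = xi n +
            dt *: (grav P - \row_i nu (fun=> delta_mx 0 i))) /\
        chi n.+1 = chi n + dt *: xi n.+1]].

Definition velocity_assumption (N : nat) (r cV : R)
    (E : set V -> (V -> V) -> V -> V) : Prop :=
  exists u lam xi chi, semidiscrete_solution N r E u lam xi chi /\
    forall i, (1 <= i <= N)%N ->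
      (Linfnorm (surf d) (GamD (chi i)) (fun x => dotv (xi i) (nrmD (chi i) x))
        <= (cV * winf)%:E)%E.

End Continuous.

Record mesh (R : realType) (d : nat) := Mesh {
  nel : nat;
  vtx : 'I_nel -> 'I_d.+1 -> 'rV[R]_d }.

Section Meshes.
Context {R : realType} {d : nat} (T : mesh R d).
Local Notation V := 'rV[R]_d.

Definition face (e : 'I_(nel T)) (A : {set 'I_d.+1}) : set V :=
  [set x | exists l : 'I_d.+1 -> R,
    [/\ forall i, 0 <= l i, forall i, i \notin A -> l i = 0,
        \sum_i l i = 1 & x = \sum_i l i *: vtx e i]].

Definition open_face (e : 'I_(nel T)) (A : {set 'I_d.+1}) : set V :=
  [set x | exists l : 'I_d.+1 -> R,
    [/\ forall i, i \in A -> 0 < l i, forall i, i \notin A -> l i = 0,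
        \sum_i l i = 1 & x = \sum_i l i *: vtx e i]].

Definition elem (e : 'I_(nel T)) : set V := face e [set: 'I_d.+1]%SET.

Definition simplicial_mesh (D : set V) : Prop :=
  [/\ forall (e : 'I_(nel T)) (l : 'I_d.+1 -> R), \sum_i l i = 0 ->
        \sum_i l i *: vtx e i = 0 -> forall i, l i = 0,
      forall e1 e2 : 'I_(nel T), e1 != e2 -> exists i, forall j, vtx e1 i != vtx e2 j,
      forall e1 e2, elem e1 `&` elem e2 =
        face e1 [set i | [exists j, vtx e1 i == vtx e2 j]]%SET &
      \bigcup_(e in [set: 'I_(nel T)]) elem e = closure D].

Definition mesh_size (h : R) : Prop :=
  (forall e, (diam (elem e) <= h%:E)%E) /\ (exists e, diam (elem e) = h%:E).

Definition shape_regular (s : R) : Prop :=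
  forall e, exists x r, [/\ 0 < r, [set y | enorm (y - x) <= r] `<=` elem e &
    (diam (elem e) <= (s * (2 * r))%:E)%E].

Definition quasi_uniform (q h : R) : Prop :=
  forall e, (h%:E <= q%:E * diam (elem e))%E.

Definition is_poly (k : nat) (p : V -> R) : Prop :=
  exists c : {ffun 'I_d -> 'I_k.+1} -> R, forall x,
    p x = \sum_(a | (order_of (mdeg a) <= k)%N) c a * \prod_i x 0 i ^+ a i.

Definition is_polyv (k : nat) (p : V -> V) : Prop :=
  forall i, is_poly k (component p i).

Definition patch_of (A : set 'I_(nel T)) : set V := \bigcup_(e in A) elem e.

(* Continuous piecewise polynomials on the union of the elements of [A]. *)
Definition fe_space (k : nat) (A : set 'I_(nel T)) (v : V -> V) : Prop :=
  {within patch_of A, continuous v} /\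
  forall e, A e -> exists2 p, is_polyv k p & forall x, elem e x -> v x = p x.

Definition poly_ext (k : nat) (e : 'I_(nel T)) (v : V -> V) : V -> V :=
  xget (fun=> 0) [set p | is_polyv k p /\ forall x, elem e x -> p x = v x].

End Meshes.

Section Discrete.
Context {R : realType} {d : nat} (P : problem R d) (T : mesh R d).
Local Notation V := 'rV[R]_d.
Implicit Types (c : V) (e : 'I_(nel T)) (r h : R).

(* [c] is the displacement of the solid and [r] the strip width. *)
Definition act r c : set 'I_(nel T) :=
  [set e | exists2 x, elem e x & (dist x (OmD P c) <= r%:E)%E].

Definition cut_elem c : set 'I_(nel T) :=
  [set e | (0 < surf d (elem e `&` GamD P c))%E].

Definition Spm r c : set 'I_(nel T) :=
  [set e | act r c e /\ exists2 x, elem e x & (dist x (GamD P c) <= r%:E)%E].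

Definition Splus r c : set 'I_(nel T) :=
  [set e | act r c e /\ exists x,
    [/\ elem e x, (Otilde P `\` OmD P c) x & (dist x (GamD P c) <= r%:E)%E]].

(* The two elements share a facet of F_{h,delta_h} (a symmetric relation). *)
Definition gp_facet r c e1 e2 : Prop :=
  [/\ e1 <> e2, (act r c e1 /\ Spm r c e2) \/ (Spm r c e1 /\ act r c e2) &
      (0 < surf d (elem e1 `&` elem e2))%E].

Definition Oact r c : set V := patch_of (act r c).
Definition Ocut c : set V := patch_of (cut_elem c).

Definition Vh (k : nat) r c (v : V -> V) : Prop :=
  fe_space k (act r c) v /\ forall x, Oact r c x -> Gout P x -> v x = 0.

Definition Nh (k : nat) c (mu : V -> V) : Prop := fe_space k.-1 (cut_elem c) mu.

Definition sqnorm (D : set V) (v : V -> V) : R :=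
  vint D (fun x => dotv (v x) (v x)).

Definition sqgrad (D : set V) (v : V -> V) : R :=
  vint D (fun x => frob (grad v x) (grad v x)).

Definition ah c (u v : V -> V) : R :=
  vint (OmD P c) (fun x => frob (grad u x) (grad v x)).

Definition bh c (lam v : V -> V) : R :=
  sint (GamD P c) (fun x => dotv (lam x) (v x)).

(* The level set function of the displaced geometry is [phi P 0 (x - c)]. *)
Definition nh c (x : V) : V :=
  - (enorm (grads (phi P 0) (x - c)))^-1 *: grads (phi P 0) (x - c).

Definition dirgrad (w : V) (v : V -> V) (x : V) : V :=
  \row_i \sum_j w 0 j * grad v x i j.

Definition jh h c (lam mu : V -> V) : R :=
  h ^+ 2 * vint (Ocut c) (fun x =>
    dotv (dirgrad (nh c x) lam x) (dirgrad (nh c x) mu x)).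

Definition jump (k : nat) e1 e2 (u : V -> V) (x : V) : V :=
  poly_ext k e1 u x - poly_ext k e2 u x.

(* Each facet is listed once, through the ordered pair of its two elements. *)
Definition ih (k : nat) h r c (u v : V -> V) : R :=
  h ^- 2 * \sum_(e1 < nel T) \sum_(e2 < nel T |
      (e1 < e2)%N && `[< gp_facet r c e1 e2 >])
    vint (elem e1 `|` elem e2) (fun x =>
      dotv (jump k e1 e2 u x) (jump k e1 e2 v x)).

Definition tnorm_sq h r c (v : V -> V) : R :=
  sqgrad (Oact r c) v +
  sint (GamD P c) (fun x =>
    dotv ((Num.sqrt h)^-1 *: v x) ((Num.sqrt h)^-1 *: v x)).

(* "The interface meets the boundary exactly twice and each open edge [that it
   meets] exactly once", for the cut triangles: the element itself if [d = 2],
   the faces of a cut tetrahedron if [d = 3]. *)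
Definition cut_pattern c : Prop :=
  forall e, cut_elem c e -> forall A : {set 'I_d.+1}, #|A| = 3%N ->
    (0 < haus 1 d (face e A `&` GamD P c))%E ->
    (exists p q, p <> q /\
      \bigcup_(B in [set B : {set 'I_d.+1} | B \subset A /\ #|B| = 2%N])
        face e B `&` GamD P c = [set p; q]) /\
    (forall B : {set 'I_d.+1}, B \subset A -> #|B| = 2%N ->
      is_subset1 (open_face e B `&` GamD P c)).

Definition piecewise_smooth (D : set V) (f : V -> V) : Prop :=
  {within D, continuous f} /\
  exists (m : nat) (C : 'I_m -> set V) (g : 'I_m -> V -> V),
    [/\ forall j, closed (C j), D `<=` \bigcup_j C j, forall j, smoothv (g j) &
        forall j x, D x -> C j x -> f x = g j x].

Definition plane_param c : Prop :=
  forall e, cut_elem c e -> exists (a : V) (b : R) (f : V -> V), a != 0 /\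
    let D := [set x | dotv a x = b] `&` elem e in
    piecewise_smooth D f /\ set_bij D (elem e `&` GamD P c) f.

Definition uncut_paths (K M : nat) r c : Prop :=
  exists p : 'I_(nel T) -> seq 'I_(nel T),
    (forall e, Splus r c e ->
      [/\ path (fun e1 e2 => `[< gp_facet r c e1 e2 >]) e (p e),
          (size (p e) <= K)%N &
          [/\ act 0 c (last e (p e)), ~ Splus r c (last e (p e)) &
              ~ cut_elem c (last e (p e))]]) /\
    (forall e',
      (#|[pred e | `[< Splus r c e >] && (last e (p e) == e')]| <= M)%N).

Definition mesh_assumption (K M : nat) r c : Prop :=
  [/\ cut_pattern c, plane_param c & uncut_paths K M r c].

Definition ghost_equivalence (k : nat) (K : nat) (cgp : R) h r c : Prop :=
  forall v, Vh k r c v ->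
    sqgrad (Oact r c) v <=
      cgp * (sqgrad (OmD P c) v + K%:R * ih k h r c v v) /\
    sqgrad (OmD P c) v + K%:R * ih k h r c v v <= cgp * sqgrad (Oact r c) v.

Definition discrete_solution (k N : nat) h r (ggp gl : R)
    (u lam : nat -> V -> V) (xi chi : nat -> V) : Prop :=
  let dt := tend P / N%:R in
  [/\ chi 0%N = 0, Vh k r (chi 0%N) (u 0%N),
      forall n, (n <= N)%N -> admissible P (chi n) &
    forall n, (n < N)%N ->
    let c := chi n.+1 in
    [/\ Vh k r c (u n.+1), Nh k c (lam n.+1) &
      forall (v mu : V -> V) (z1 z2 : V), Vh k r c v -> Nh k c mu ->
        dt^-1 * vint (OmD P c) (fun x => dotv (u n.+1 x - u n x) (v x)) +
        ah c (u n.+1) v + bh c (lam n.+1) v +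
        bh c mu (fun x => u n.+1 x - xi n.+1) +
        ggp * ih k h r c (u n.+1) v - gl * jh h c (lam n.+1) mu +
        dt^-1 * dotv (xi n.+1 - xi n) z1 + dt^-1 * dotv (chi n.+1 - chi n) z2 =
        dotv (\row_i sint (GamD P c) (component (lam n.+1) i) + grav P) z1 +
        dotv (xi n.+1) z2]].

End Discrete.

(* Main.v *)
(* Testing with (u, lambda, xi, chi) and with (u, 0, xi, chi) and subtracting
   gives b(lambda, u - xi) = gamma_lambda j(lambda, lambda), so the interface
   force cancels and the step is a discrete heat energy balance, except that
   u^(n-1) is measured on Omega^n, hence on the delta_h-strip around
   Omega^(n-1).  The strip part is at most C dt |u|^2 + eta dt |grad u|^2: near
   the initial interface some partial derivative of the level set function is
   bounded away from 0, so the strip splits into finitely many pieces that are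
   crossed, along a coordinate direction, in length O(delta_h) and from which a
   segment of fixed length lies in the bulk or beyond it in the strip.  Bounding
   |u|^2 by its mean along that segment and integrating (Tonelli, translation
   invariance) gives the factor delta_h.  Discrete Gronwall concludes; the
   constant c_c is the area, which is positive since the interface projects
   onto a cube, and finite since it is locally a Lipschitz graph. *)
Require Import Defs.
From HB Require Import structures.
From mathcomp Require Import all_boot all_order all_algebra.
From mathcomp Require Import all_classical all_reals all_analysis.
From mathcomp Require Import measurable_realfun.
From mathcomp Require Import lra ring.

Set Implicit Arguments.
Unset Strict Implicit.
Unset Printing Implicit Defensive.

Import Order.TTheory GRing.Theory Num.Theory.
Import numFieldNormedType.Exports.

Local Open Scope classical_set_scope.
Local Open Scope ring_scope.

(** Every discrete geometry is a translate of the initial solid, so the constants of the strip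
    estimate come once and for all from [phi P 0] on a compact set; hence they do not depend on the
    step, the mesh or the cut. The interface is given by its level set only: mean value steps along
    coordinate axes replace the implicit function theorem, both for crossing the strip and for the
    area. The strip estimate leaves a gradient term at the old time level, of weight eta dt. The
    energy fed into Gronwall therefore carries dt eta |grad u^n|^2, reserved from the dissipation of
    the step that produced u^n. So eta is at most 1/cgp, to be covered by that dissipation, and at
    most cgp/2, so that its initial value fits into the triple-norm term on the right. The other
    obstacle is measure theory. The measures are bare outer measures and [Rintegral] is additive
    only on integrable functions, while gradients of finite element functions are controlled only
    off the faces and multipliers only on cut elements. This explains the work on Caratheodory
    measurability, null faces and finite area, and the passage to Borel sets for Tonelli. *)

Section Covers.
Context {R : realType} {T : pointedType} (g : set T -> \bar R).
Hypotheses (g0 : g set0 = 0%E) (g_ge0 : forall A, (0 <= g A)%E).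
Local Open Scope ereal_scope.

Lemma cover_outer_ge (x : \bar R) (X : set T) :
  (forall F : (set T)^nat, X `<=` \bigcup_k F k -> x <= \sum_(k <oo) g (F k)) ->
  x <= cover_outer g X.
Proof.
move=> h; apply: le_ereal_inf_tmp => _ [F [_ XF] <-]; exact: h.
Qed.

Lemma cover_outer_cover (X : set T) (F : (set T)^nat) :
  X `<=` \bigcup_k F k -> cover_outer g X <= \sum_(k <oo) g (F k).
Proof.
move=> XF; apply: ereal_inf_lbound; exists F => //; split => // k.
exact: sub_sigma_algebra.
Qed.

Lemma cover_outer_le_gauge (A : set T) : cover_outer g A <= g A.
Proof.
pose F (k : nat) := if k is 0 then A else set0.
apply: le_trans (@cover_outer_cover A F _) _.
  by move=> x Ax; exists 0%N.
rewrite (nneseries_split 0%N 1%N)//= big_nat1 eseries0 ?adde0// => i.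
by case: i.
Qed.

(** Intersecting each set of a cover with [P] and with [Q] covers both parts, so superadditivity
    passes from the gauge to the outer measure. It is used with complementary half-spaces for volume
    and with separated ones for Hausdorff measure. *)
Lemma cover_outer_split (P Q : set T) :
  (forall A, g (A `&` P) + g (A `&` Q) <= g A) ->
  forall X, cover_outer g (X `&` P) + cover_outer g (X `&` Q) <= cover_outer g X.
Proof.
move=> h X; apply: cover_outer_ge => F XF.
apply: (@le_trans _ _ (\sum_(k <oo) (g (F k `&` P) + g (F k `&` Q)))).
  rewrite nneseriesD //; apply: leeD; apply: cover_outer_cover => x [/XF[k _ Fx] Px];
    by exists k.
by apply: lee_nneseries => // i _; rewrite adde_ge0.
Qed.

End Covers.

(** * Half-spaces are measurable for the Lebesgue outer measure *)

Section BoxGauge.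
Context {R : realType} {n : nat}.
Local Notation V := 'rV[R]_n.

Lemma box_gauge_le (A : set V) (a b : V) : (forall i, a 0 i <= b 0 i) ->
  (forall x, A x -> forall i, a 0 i <= x 0 i <= b 0 i) ->
  (box_gauge A <= (\prod_i (b 0 i - a 0 i))%:E)%E.
Proof.
move=> ab Aab; rewrite /box_gauge; case: asboolP => _.
  by rewrite lee_fin; apply: prodr_ge0 => i _; rewrite subr_ge0.
by apply: ereal_inf_lbound; exists (a, b).
Qed.

Definition setcoord (x : V) (i : 'I_n) (t : R) : V :=
  \row_j (if j == i then t else x 0 j).

Lemma setcoord_id x i t : setcoord x i t 0 i = t.
Proof. by rewrite mxE eqxx. Qed.

Lemma setcoord_neq x i t j : j != i -> setcoord x i t 0 j = x 0 j.
Proof. by rewrite mxE => /negbTE ->. Qed.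

Lemma box_gauge_split (i : 'I_n) (t : R) (A : set V) :
  (box_gauge (A `&` [set x : V | (x 0 i <= t)%R]) +
   box_gauge (A `&` ~` [set x : V | (x 0 i <= t)%R]) <= box_gauge A)%E.
Proof.
have [->|A0] := eqVneq A set0; first by rewrite !set0I box_gauge0 adde0.
rewrite [leRHS]/box_gauge; case: asboolP => [/eqP|_]; first by rewrite (negbTE A0).
apply: le_ereal_inf_tmp => _ [[a b] [/= ab Aab] <-].
(* [s] is [t] clamped to the side of the box, so both halves stay boxes even if the plane misses it,
   and their volumes add up exactly. *)
pose s := Num.max (a 0 i) (Num.min (b 0 i) t).
have as_ : a 0 i <= s by rewrite le_max lexx.
have sb : s <= b 0 i by rewrite ge_max ab ge_min lexx.
pose b' := setcoord b i s; pose a' := setcoord a i s.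
apply: (@le_trans _ _ ((\prod_j (b' 0 j - a 0 j))%:E + (\prod_j (b 0 j - a' 0 j))%:E)%E).
  apply: leeD; apply: box_gauge_le.
  - by move=> j; rewrite mxE; case: eqP => [->|].
  - move=> x [/Aab Ax /= xt] j; rewrite mxE; case: eqP => [->|_]; last exact: Ax.
    by have /andP[-> xb] := Ax i; rewrite /s le_max le_min xb xt orbT.
  - by move=> j; rewrite mxE; case: eqP => [->|].
  - move=> x [/Aab Ax /= /negP]; rewrite -ltNge => xt j; rewrite mxE.
    case: eqP => [->|_]; last exact: Ax.
    have /andP[ax ->] := Ax i; rewrite /s ge_max ax ge_min (ltW xt) orbT //.
rewrite -EFinD lee_fin (bigD1 i)//= [X in _ + X](bigD1 i)//= [leRHS](bigD1 i)//=.
rewrite !setcoord_id.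
rewrite (eq_bigr (fun j => b 0 j - a 0 j)); last by move=> j ji; rewrite setcoord_neq.
rewrite [X in _ + _ * X](eq_bigr (fun j => b 0 j - a 0 j)); last first.
  by move=> j ji; rewrite setcoord_neq.
by rewrite -mulrDl addrC addrA subrK.
Qed.

Lemma leb_halfspace (i : 'I_n) (t : R) :
  (leb_om n).-caratheodory [set x : V | x 0 i <= t].
Proof.
apply: le_caratheodory_measurable => X.
apply: cover_outer_split; [exact: box_gauge_ge0 | exact: box_gauge_split].
Qed.

End BoxGauge.

Section EuclideanNorm.
Context {R : realType} {n : nat}.
Implicit Types x y : 'rV[R]_n.

Lemma dotv_ge0 x : 0 <= dotv x x.
Proof. by apply: sumr_ge0 => i _; rewrite -expr2 sqr_ge0. Qed.

Lemma enorm_ge0 x : 0 <= enorm x.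
Proof. exact: sqrtr_ge0. Qed.

Lemma enorm_sqr x : enorm x ^+ 2 = dotv x x.
Proof. by rewrite sqr_sqrtr // dotv_ge0. Qed.

Lemma coord_le_enorm x i : `|x 0 i| <= enorm x.
Proof.
rewrite -sqrtr_sqr ler_wsqrtr // /dotv (bigD1 i)//= expr2 lerDl.
by apply: sumr_ge0 => j _; rewrite -expr2 sqr_ge0.
Qed.

Lemma coord_le_norm x i : `|x 0 i| <= `|x|.
Proof.
rewrite [leRHS]/Num.norm /= mx_normrE.
by apply: (@le_bigmax _ _ _ 0 (fun ij : 'I_1 * 'I_n => `|x ij.1 ij.2|) (0, i)).
Qed.

Lemma norm_le_coord x (e : R) : 0 <= e -> (forall i, `|x 0 i| <= e) -> `|x| <= e.
Proof.
move=> e0 h; rewrite [leLHS]/Num.norm /= mx_normrE.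
by apply/bigmax_leP; split => // -[i j] _ /=; rewrite ord1.
Qed.

Lemma norm_le_enorm x : `|x| <= enorm x.
Proof. by apply: norm_le_coord => [|i]; [exact: enorm_ge0|exact: coord_le_enorm]. Qed.

Lemma dotv_le_norm x : dotv x x <= n%:R * `|x| ^+ 2.
Proof.
rewrite /dotv (@le_trans _ _ (\sum_(i < n) `|x| ^+ 2)) //.
  apply: ler_sum => i _; rewrite -expr2 -real_normK ?num_real//.
  by rewrite lerXn2r ?nnegrE ?normr_ge0 // coord_le_norm.
by rewrite sumr_const card_ord mulr_natl.
Qed.

Lemma enorm_le_norm x : enorm x <= n%:R * `|x|.
Proof.
rewrite -(@ger0_norm _ (n%:R * `|x|)) ?mulr_ge0// -sqrtr_sqr ler_wsqrtr //.
apply: le_trans (dotv_le_norm x) _; rewrite exprMn ler_wpM2r ?sqr_ge0//.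
by case: n => [|m]; rewrite ?expr0n// -natrX ler_nat leq_pmulr.
Qed.

Lemma enormZ (a : R) x : enorm (a *: x) = `|a| * enorm x.
Proof.
rewrite /enorm -sqrtr_sqr -sqrtrM ?sqr_ge0//; congr Num.sqrt.
rewrite /dotv mulr_sumr; apply: eq_bigr => i _; rewrite !mxE; ring.
Qed.

Lemma enormN x : enorm (- x) = enorm x.
Proof. by rewrite -scaleN1r enormZ normrN1 mul1r. Qed.

End EuclideanNorm.

(** [haus_outer] is a supremum over scales, and the two summands may use different scales.
    Nonnegativity excludes the undetermined sums. *)
Lemma ereal_supD_le {R : realType} (S1 S2 : set (\bar R)) (z : \bar R) :
  (forall x, S1 x -> (0 <= x)%E) -> (forall y, S2 y -> (0 <= y)%E) ->
  S1 !=set0 -> S2 !=set0 ->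
  (forall x y, S1 x -> S2 y -> (x + y <= z)%E) ->
  (ereal_sup S1 + ereal_sup S2 <= z)%E.
Proof.
move=> S1ge0 S2ge0 [x0 S1x0] [y0 S2y0] h.
have sup_ge0 : (0 <= ereal_sup S1)%E.
  by apply: le_trans (S1ge0 _ S1x0) _; exact: ereal_sup_ubound.
case: z h => [z| |] h; [|by rewrite leey|]; last first.
  have := h _ _ S1x0 S2y0; rewrite leeNy_eq => /eqP E.
  by have := adde_ge0 (S1ge0 _ S1x0) (S2ge0 _ S2y0); rewrite E.
have fin2 y : S2 y -> y \is a fin_num.
  move=> S2y; rewrite ge0_fin_numE ?S2ge0//.
  apply: le_lt_trans (ltry z); apply: le_trans (h _ _ S1x0 S2y).
  by rewrite leeDr // S1ge0.
have h1 y : S2 y -> (ereal_sup S1 <= z%:E - y)%E.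
  by move=> S2y; apply: ge_ereal_sup => x S1x; rewrite leeBrDr ?fin2 // h.
have fin1 : ereal_sup S1 \is a fin_num.
  rewrite ge0_fin_numE//; apply: le_lt_trans (ltry z).
  by have := h1 _ S2y0; rewrite leeBrDr ?fin2 //; apply: le_trans; rewrite leeDl ?S2ge0.
rewrite addeC -leeBrDr//; apply: ge_ereal_sup => y S2y.
by rewrite leeBrDr // addeC -leeBrDr ?fin2 // h1.
Qed.

(** * Half-spaces are measurable for Hausdorff measure (metric outer measure argument) *)

Section HausdorffMeasurable.
Context {R : realType} {m n : nat}.
Local Notation V := 'rV[R]_n.
Local Notation mu := (haus_om m n).
Local Open Scope ereal_scope.

Lemma diam_ge (A : set V) x y : A x -> A y -> (enorm (x - y)%R)%:E <= diam A.
Proof. by move=> Ax Ay; apply: ereal_sup_ubound; exists x => //; exists y. Qed.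

Lemma diam_ge0 (A : set V) : A !=set0 -> 0 <= diam A.
Proof.
by move=> [x Ax]; apply: le_trans (diam_ge Ax Ax); rewrite lee_fin enorm_ge0.
Qed.

Lemma le_diam (A B : set V) : A `<=` B -> diam A <= diam B.
Proof. by move=> AB; apply: ereal_sup_le => _ [x /AB Bx [y /AB By <-]]; exists x => //; exists y. Qed.

Lemma hcst_ge0 : 0 <= @hcst R m.
Proof. exact: (outer_measure_ge0 (@leb_outer R m)). Qed.

Lemma le_haus_gauge r (A B : set V) : A `<=` B ->
  haus_gauge m r A <= haus_gauge m r B.
Proof.
move=> AB; rewrite {1}/haus_gauge; case: asboolP => [_|A0]; first exact: haus_gauge_ge0.
have /eqP/set0P An0 := A0.
rewrite /haus_gauge; case: asboolP => [B0|B0].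
  by exfalso; apply: A0; rewrite -subset0 -B0.
have dAB := le_diam AB.
case: (ifP (diam B <= _)) => dB; last by rewrite leey.
rewrite (le_trans dAB dB); apply: lee_wpmul2l; first exact: hcst_ge0.
have dA0 := diam_ge0 An0.
elim: m => [|k ih]; first by rewrite !expe0.
by rewrite !expeS; apply: lee_pmul => //; exact: expe_ge0.
Qed.

Lemma haus_gauge_anti r s (A : set V) : (r <= s)%R ->
  haus_gauge m s A <= haus_gauge m r A.
Proof.
move=> rs; rewrite /haus_gauge; case: asboolP => // _.
case: (ifP (diam A <= r%:E)) => dr; last by rewrite leey.
by rewrite (le_trans dr)// lee_fin.
Qed.

Lemma cover_haus_anti r s (A : set V) : (r <= s)%R ->
  cover_outer (haus_gauge m s) A <= cover_outer (haus_gauge m r) A.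
Proof.
move=> rs; apply: cover_outer_ge => F AF.
apply: le_trans (cover_outer_cover _ AF) _; apply: lee_nneseries => k *.
  exact: haus_gauge_ge0.
exact: haus_gauge_anti.
Qed.

(** At a scale below the gap, a set meeting both parts has gauge +oo, so the gauge is superadditive
    and [cover_outer_split] applies. *)
Lemma haus_outer_separated (i : 'I_n) (s t : R) (X : set V) : (s < t)%R ->
  mu (X `&` [set x | (x 0 i <= s)%R]) + mu (X `&` [set x | (t <= x 0 i)%R]) <= mu X.
Proof.
move=> st; apply: ereal_supD_le.
- by move=> _ [r _ <-]; exact: (cover_outer_ge0 (@haus_gauge_ge0 _ m n r)).
- by move=> _ [r _ <-]; exact: (cover_outer_ge0 (@haus_gauge_ge0 _ m n r)).
- by eexists; exists 1%R => //=; exact: ltr01.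
- by eexists; exists 1%R => //=; exact: ltr01.
move=> _ _ [r1 /= r10 <-] [r2 /= r20 <-].
(* Half the gap makes it strictly wider than any set of finite gauge; refining [r1] and [r2] only
   increases the outer measures. *)
pose r := Num.min (Num.min r1 r2) ((t - s) / 2)%R.
have r0 : (0 < r)%R by rewrite !lt_min r10 r20 divr_gt0// subr_gt0.
apply: (@le_trans _ _ (cover_outer (haus_gauge m r) X)); last exact: haus_outer_ub.
apply: (@le_trans _ _ (cover_outer (haus_gauge m r) (X `&` [set x | (x 0 i <= s)%R])
   + cover_outer (haus_gauge m r) (X `&` [set x | (t <= x 0 i)%R]))).
  by apply: leeD; apply: cover_haus_anti; rewrite /r !ge_min lexx ?orbT.
apply: cover_outer_split => [|A]; first exact: haus_gauge_ge0.
have [AP|] := pselect (A `&` [set x | (x 0 i <= s)%R] !=set0); last first.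
  move=> /set0P/negP; rewrite negbK => /eqP ->; rewrite haus_gauge0 add0e.
  exact: le_haus_gauge.
have [AQ|] := pselect (A `&` [set x | (t <= x 0 i)%R] !=set0); last first.
  move=> /set0P/negP; rewrite negbK => /eqP ->; rewrite haus_gauge0 adde0.
  exact: le_haus_gauge.
have [x [Ax /= xs]] := AP; have [y [Ay /= ty]] := AQ.
rewrite [leRHS]/haus_gauge; case: asboolP => [A0|_]; first by move: Ax; rewrite A0.
case: ifPn => [dA|_]; last by rewrite leey.
have : (enorm (y - x)%R)%:E <= r%:E by exact: le_trans (diam_ge Ay Ax) dA.
rewrite lee_fin => yxr; have := le_trans (coord_le_enorm (y - x) i) yxr.
rewrite !mxE leNgt => /negP; case; rewrite /r !gt_min.
apply/orP; right; rewrite ger0_norm; lra.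
Qed.

Definition layer_bound (t : R) (k : nat) : R := (t + k.+1%:R^-1)%R.

Lemma layer_bound_lt (t : R) j k : (j < k)%N -> (layer_bound t k < layer_bound t j)%R.
Proof. by move=> jk; rewrite ltrD2l ltf_pV2 ?posrE// ltr_nat. Qed.

Definition layer (i : 'I_n) (t : R) (k : nat) : set V :=
  [set x | (layer_bound t k.+1 <= x 0 i < layer_bound t k)%R].

(** Two layers whose indices have the same parity are separated by a layer of the other parity, so
    [haus_outer_separated] adds them up one at a time. *)
Lemma haus_layers_alternate (i : 'I_n) (t : R) (X : set V) (b : bool) N :
  \sum_(j < N) mu (X `&` layer i t (j.*2 + b)) <= mu X.
Proof.
have S : forall N, \sum_(j < N) mu (X `&` layer i t (j.*2 + b)) <=
    mu (X `&` [set x | (layer_bound t (N.*2 + b).-1 <= x 0 i)%R]).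
  elim=> [|K ih]; first by rewrite big_ord0 outer_measure_ge0.
  rewrite big_ord_recr /=.
  case: K ih => [_|K ih].
    rewrite big_ord0 add0e; apply: le_outer_measure => x [Xx /= /andP[h1 h2]].
    split => //=.
  have lt1 : (layer_bound t (K.+1.*2 + b) < layer_bound t (K.+1.*2 + b).-1)%R.
    exact: layer_bound_lt.
  apply: le_trans (haus_outer_separated i
    (X `&` [set x | (layer_bound t (K.+2.*2 + b).-1 <= x 0 i)%R]) lt1).
  rewrite addeC; apply: leeD.
    apply: le_outer_measure => x [Xx /= /andP[h1 h2]].
    by split => /=; [split => //=; move: h1; rewrite doubleS | exact: ltW].
  apply: (le_trans ih); apply: le_outer_measure => x [Xx /= h1].
  split => //=; split => //=.
  apply: le_trans h1; apply/ltW/layer_bound_lt.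
  by rewrite !doubleS.
apply: le_trans (S N) _; apply: le_outer_measure; exact: subIsetl.
Qed.

Lemma haus_layers_sum (i : 'I_n) (t : R) (X : set V) :
  \sum_(k <oo) mu (X `&` layer i t k) <= mu X + mu X.
Proof.
apply: lime_le.
  by apply: is_cvg_nneseries => k _ _; exact: outer_measure_ge0.
apply: nearW => N; rewrite big_mkord.
apply: (@le_trans _ _ (\sum_(k < N.*2) mu (X `&` layer i t k))).
  rewrite -!(big_mkord xpredT (fun k => mu (X `&` layer i t k))).
  apply: lee_sum_nneg_natr => [k _ _|]; first exact: outer_measure_ge0.
  by rewrite -addnn leq_addr.
have E M : \sum_(k < M.*2) mu (X `&` layer i t k) =
   \sum_(j < M) mu (X `&` layer i t (j.*2 + false)) +
   \sum_(j < M) mu (X `&` layer i t (j.*2 + true)).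
  elim: M => [|K ih]; first by rewrite !big_ord0 adde0.
  rewrite doubleS !big_ord_recr /= ih addn0 addn1.
  by rewrite -!addeA; congr (_ + _); rewrite addeCA.
by rewrite E; apply: leeD; exact: haus_layers_alternate.
Qed.

(** The open side x_i > t touches the plane, so separation does not apply directly. The part at
    height at least t + 1/(N+1) is separated from the plane; the rest lies in the layers from N on,
    whose total measure is the tail of a convergent series. *)
Lemma haus_halfspace (i : 'I_n) (t : R) :
  mu.-caratheodory [set x : V | (x 0 i <= t)%R].
Proof.
apply: le_caratheodory_measurable => X.
have [->|Xfin] := eqVneq (mu X) +oo; first by rewrite leey.
have Xoo : mu X < +oo by rewrite ltey.
pose P := [set x : V | (x 0 i <= t)%R].
pose U k := [set x : V | (layer_bound t k <= x 0 i)%R].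
pose tail N := \sum_(N <= k <oo) mu (X `&` layer i t k).
have bnd N : mu (X `&` P) + mu (X `&` ~` P) <= mu X + tail N.
  have sub : X `&` ~` P `<=` (X `&` U N) `|` \bigcup_(k in ~` `I_N) (X `&` layer i t k).
    move=> x [Xx /= /negP]; rewrite -ltNge => tx.
    have [Ux|Ux] := leP (layer_bound t N) (x ord0 i); first by left.
    right.
    have ex : exists k, (layer_bound t k.+1 <= x 0 i)%R.
      have [k] := @ltr_add_invr R t (x ord0 i) tx; move=> /ltW kx; exists k.
      by apply: le_trans kx; apply/ltW/layer_bound_lt.
    (* The least k with x_i above the lower bound of layer k is the layer containing x; minimality
       gives the upper bound. *)
    case: (ex_minnP ex) => k hk kmin.
    have kN : (N <= k)%N.
      rewrite leqNgt; apply/negP => kN.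
      have : (layer_bound t N <= layer_bound t k.+1)%R.
        by move: kN; rewrite leq_eqVlt => /orP[/eqP ->//|/(layer_bound_lt t)/ltW].
      by rewrite leNgt => /negP; apply; exact: le_lt_trans hk Ux.
    exists k; first by rewrite /= ltnNge kN.
    split => //; rewrite /layer /= hk /=.
    case: k hk kmin kN => [|k] hk kmin kN.
      apply: lt_le_trans Ux _; rewrite leqn0 in kN.
      by rewrite (eqP kN).
    by rewrite ltNge; apply/negP => /kmin; rewrite ltnn.
  have h1 : mu (X `&` ~` P) <= mu (X `&` U N) + tail N.
    apply: le_trans (le_outer_measure mu _ _ sub) _.
    apply: le_trans (outer_measureU2 _ _ _) _; apply: leeD => //.
    exact: outer_measure_sigma_subadditive_tail.
  apply: le_trans (leeD (lexx _) h1) _; rewrite addeA; apply: leeD => //.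
  by apply: haus_outer_separated; rewrite ltrDl invr_gt0.
have tail0 : tail N @[N --> \oo] --> 0.
  apply: (@nneseries_tail_cvg _ _ xpredT) => [|k _]; last exact: outer_measure_ge0.
  apply: le_lt_trans (haus_layers_sum i t X) _.
  by apply: lte_add_pinfty.
have cv : mu X + tail N @[N --> \oo] --> mu X + 0.
  apply: cvgeD => //; last exact: cvg_cst.
  by rewrite fin_num_adde_defl.
rewrite adde0 in cv; rewrite -(cvg_lim _ cv)//.
apply: lime_ge; first by apply/cvg_ex; exists (mu X).
exact: nearW.
Qed.

End HausdorffMeasurable.

(** * Borel sets, and their measurability for the two outer measures *)

Definition borel (R : realType) (n : nat) :=
  g_sigma_algebraType (@open 'rV[R]_n).

Section BorelMaps.
Context {R : realType} {n : nat}.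
Local Notation V := 'rV[R]_n.

Lemma ratr_box_approx (x : V) (e : R) : 0 < e ->
  exists q : 'rV[rat]_n, forall i, `|x 0 i - ratr (q 0 i)| < e.
Proof.
move=> e0.
have h i : exists q : rat, `|x 0 i - ratr q| < e.
  have [q] := @rat_in_itvoo R (x ord0 i - e) (x ord0 i + e) ltac:(lra).
  rewrite in_itv /= => /andP[h1 h2]; exists q.
  by rewrite ltr_norml; apply/andP; split; lra.
exists (\row_i sval (cid (h i))) => i; rewrite mxE.
exact: (svalP (cid (h i))).
Qed.

(** Countability is the point: boxes with rational centres and radii 1/(k+1) reduce Borel
    measurability of a map to that of its coordinates. *)
Lemma open_bigcup_boxes (U : set V) : open U ->
  U = \bigcup_(p : 'rV[rat]_n * nat)
    (if `[< forall x : V, (forall i, `|x 0 i - ratr (p.1 0 i)| < p.2.+1%:R^-1) -> U x >]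
     then [set x : V | forall i, `|x 0 i - ratr (p.1 0 i)| < p.2.+1%:R^-1] else set0).
Proof.
move=> oU; apply/seteqP; split => [x Ux|x [p _]]; last first.
  by case: asboolP => // h; exact: h.
have /nbhs_ballP[e /= e0 eU] : nbhs x U by exact: open_nbhs_nbhs.
have e20 : 0 < e / 2 by rewrite divr_gt0.
have [k] := ltr_add_invr e20; rewrite add0r => ke.
have k0 : 0 < k.+1%:R^-1 :> R by rewrite invr_gt0.
have [q xq] := ratr_box_approx x k0.
exists (q, k) => //=; case: asboolP => //; case => y yq.
apply: eU; rewrite mx_norm_ball /ball_ /=.
apply: (@le_lt_trans _ _ (2 * k.+1%:R^-1)); last first.
  by rewrite mulrC -ltr_pdivlMr.
apply: norm_le_coord => [|i]; first by rewrite mulr_ge0 // invr_ge0.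
rewrite !mxE.
apply: le_trans (ler_distD (ratr (q 0 i)) _ _) _.
by rewrite [`|_ - y 0 i|]distrC mulr_natl mulr2n; apply: lerD; exact: ltW.
Qed.

Lemma coord_measurable_borel disp (T : measurableType disp) (f : T -> V) :
  (forall i, measurable_fun [set: T] (fun t => f t 0 i)) ->
  measurable_fun [set: T] (f : T -> borel R n).
Proof.
move=> mf; apply: (measurability _ (erefl : @measurable _ (borel R n) = <<s (@open V)>>)).
move=> _ [U oU <-]; rewrite setTI (open_bigcup_boxes oU) preimage_bigcup.
apply: countable_bigcupT_measurable => [|[q k]] /=; first exact: countableP.
case: asboolP => _; last by rewrite preimage_set0.
rewrite [X in measurable X](_ : _ = \bigcap_(i in [set: 'I_n])
   [set t | `|f t 0 i - ratr (q 0 i)| < k.+1%:R^-1]); last first.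
  by apply/seteqP; split => [t h i _|t h i]; exact: h.
apply: fin_bigcap_measurable => // i _.
have -> : [set t | `|f t 0 i - ratr (q 0 i)| < k.+1%:R^-1] =
    (fun t => f t 0 i) @^-1` `](ratr (q 0 i) - k.+1%:R^-1), (ratr (q 0 i) + k.+1%:R^-1)[%classic.
  apply/seteqP; split => t /=; rewrite in_itv /= ltr_distl //.
by rewrite -[X in measurable X]setTI; apply: mf.
Qed.

Lemma continuous_measurable_borel (D : set V) (f : V -> R) :
  measurable (D : set (borel R n)) -> {within D, continuous f} ->
  measurable_fun (D : set (borel R n)) (f : borel R n -> R).
Proof.
move=> mD /continuousP cf; apply: (measurability _ (RGenOInfty.measurableE R)).
move=> _ [_ [a ->] <-].
have /open_subspaceP[W oW WD] := cf _ (@rray_open _ _ a).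
rewrite setIC -WD; apply: measurableI => //; exact: sub_sigma_algebra.
Qed.

End BorelMaps.

Section CaratheodoryBorel.
Context {R : realType} {n : nat} (mu : {outer_measure set 'rV[R]_n -> \bar R}).
Hypothesis mu_half : forall i t, mu.-caratheodory [set x : 'rV[R]_n | x 0 i <= t].

Lemma caratheodory_coord_measurable (i : 'I_n) :
  measurable_fun [set: caratheodory_type mu]
    ((fun x : 'rV[R]_n => x 0 i) : caratheodory_type mu -> R).
Proof.
apply: (measurability _ (RGenOInfty.measurableE R)) => _ [_ [t ->] <-].
rewrite setTI (_ : _ @^-1` _ = ~` [set x : 'rV[R]_n | x 0 i <= t]).
  by apply: measurableC; exact: mu_half.
by apply/seteqP; split => x /=; rewrite in_itv /= andbT ltNge => /negP.
Qed.

Lemma caratheodory_id_borel :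
  measurable_fun [set: caratheodory_type mu] (id : caratheodory_type mu -> borel R n).
Proof. by apply: coord_measurable_borel => i; exact: caratheodory_coord_measurable. Qed.

Lemma caratheodory_borel (A : set 'rV[R]_n) :
  measurable (A : set (borel R n)) -> measurable (A : set (caratheodory_type mu)).
Proof.
by move=> mA; have := caratheodory_id_borel measurableT mA; rewrite setTI.
Qed.

Lemma caratheodory_fun_borel (D : set 'rV[R]_n) disp (T : measurableType disp)
    (f : 'rV[R]_n -> T) :
  measurable (D : set (borel R n)) ->
  measurable_fun (D : set (borel R n)) f ->
  measurable_fun (D : set (caratheodory_type mu)) f.
Proof.
by move=> mD mf _ Y mY; apply: caratheodory_borel; exact: mf.
Qed.

End CaratheodoryBorel.

Section BorelSets.
Context {R : realType} {n : nat}.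
Implicit Types A : set 'rV[R]_n.

Lemma open_borel A : open A -> measurable (A : set (borel R n)).
Proof. exact: sub_sigma_algebra. Qed.

Lemma closed_borel A : closed A -> measurable (A : set (borel R n)).
Proof. by move=> /closed_openC/open_borel/measurableC; rewrite setCK. Qed.

Lemma leb_borel A : measurable (A : set (borel R n)) ->
  measurable (A : set (caratheodory_type (leb_om (R:=R) n))).
Proof. exact: (caratheodory_borel (@leb_halfspace R n)). Qed.

Lemma haus_borel m A : measurable (A : set (borel R n)) ->
  measurable (A : set (caratheodory_type (haus_om (R:=R) m n))).
Proof. exact: (caratheodory_borel (@haus_halfspace R m n)). Qed.

End BorelSets.

(** * Translation invariance *)

Section Translations.
Context {R : realType} {n : nat}.
Local Notation V := 'rV[R]_n.
Local Open Scope ereal_scope.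

Lemma cover_outer_image (g : set V -> \bar R) (f : V -> V) (A : set V) :
  (forall B, 0 <= g B) -> (forall B, g (f @` B) <= g B) ->
  cover_outer g (f @` A) <= cover_outer g A.
Proof.
move=> g0 gf; apply: cover_outer_ge => F AF.
apply: (@le_trans _ _ (\sum_(k <oo) g (f @` F k))).
  by apply: cover_outer_cover => _ [x /AF[k _ Fx] <-]; exists k => //; exists x.
exact: lee_nneseries.
Qed.

Lemma translateK (c : V) (A : set V) : translate (- c)%R (translate c A) = A.
Proof.
apply/seteqP; split => [_ [_ [x Ax <-] <-]|x Ax]; first by rewrite addrK.
by exists (x + c)%R; [exists x | rewrite addrK].
Qed.

Lemma translate_preimage (c : V) (A : set V) :
  translate c A = (fun x => x - c)%R @^-1` A.
Proof.
apply/seteqP; split => [_ [x Ax <-]|x Ax] /=; first by rewrite addrK.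
by exists (x - c)%R => //; rewrite subrK.
Qed.

Lemma box_gauge_translate (c : V) (A : set V) :
  box_gauge (translate c A) <= box_gauge A.
Proof.
have [->|A0] := eqVneq A set0; first by rewrite /translate image_set0 box_gauge0.
rewrite [leRHS]/box_gauge; case: asboolP => [/eqP|_]; first by rewrite (negbTE A0).
apply: le_ereal_inf_tmp => _ [[a b] [/= ab Aab] <-].
apply: (@le_trans _ _ (\prod_i ((b + c)%R 0%R i - (a + c)%R 0%R i))%:E).
  apply: box_gauge_le => [i|_ [x /Aab Ax <-] i]; rewrite !mxE lerD2r //.
  by rewrite lerD2r; exact: Ax.
rewrite lee_fin le_eqVlt; apply/orP; left; apply/eqP; apply: eq_bigr => i _.
by rewrite !mxE opprD addrACA subrr addr0.
Qed.

Lemma leb_outer_translate (c : V) (A : set V) :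
  leb_outer (translate c A) = leb_outer A.
Proof.
have le_ (c' : V) (B : set V) : leb_outer (translate c' B) <= leb_outer B.
  exact: (@cover_outer_image _ (fun x => x + c')%R B (@box_gauge_ge0 _ _) (box_gauge_translate c')).
by apply/eqP; rewrite eq_le le_ /= -{1}(translateK c A) le_.
Qed.

Lemma diam_translate (c : V) (A : set V) : diam (translate c A) <= diam A.
Proof.
apply: ge_ereal_sup => _ [_ [x Ax <-] [_ [y Ay <-] <-]].
by rewrite opprD addrACA subrr addr0; exact: diam_ge.
Qed.

Lemma haus_gauge_translate m r (c : V) (A : set V) :
  haus_gauge m r (translate c A) <= haus_gauge m r A.
Proof.
have [->|/set0P A0] := eqVneq A set0; first by rewrite /translate image_set0.
have [x Ax] := A0.
have tA0 : translate c A !=set0 by exists (x + c)%R, x.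
rewrite /haus_gauge; case: asboolP => [E|_]; first by case: tA0; rewrite E.
case: asboolP => [E|_]; first by case: A0; rewrite E.
have dd := diam_translate c A.
case: (ifP (diam A <= r%:E)) => dA; last by rewrite leey.
rewrite (le_trans dd dA); apply: lee_wpmul2l; first exact: hcst_ge0.
have d0 := diam_ge0 tA0.
elim: m => [|k ih]; first by rewrite !expe0.
by rewrite !expeS; apply: lee_pmul => //; exact: expe_ge0.
Qed.

Lemma haus_outer_translate m (c : V) (A : set V) :
  haus_outer m (translate c A) = haus_outer m A.
Proof.
have le_ (c' : V) (B : set V) : haus_outer m (translate c' B) <= haus_outer m B.
  apply: ge_ereal_sup => _ [r r0 <-].
  apply: le_trans (haus_outer_ub m B r0).
  exact: (@cover_outer_image _ (fun x => x + c')%R B (@haus_gauge_ge0 _ m n r) (haus_gauge_translate m r c')).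
by apply/eqP; rewrite eq_le le_ /= -{1}(translateK c A) le_.
Qed.

Lemma leb_bounded_lty (A : set V) (M : R) : (0 <= M)%R ->
  (forall x, A x -> (`|x| <= M)%R) -> leb_outer A < +oo.
Proof.
move=> M0 AM; apply: le_lt_trans (cover_outer_le_gauge _ _ _) _.
- exact: box_gauge0.
- exact: box_gauge_ge0.
apply: (@le_lt_trans _ _ (\prod_(i < n) ((const_mx M : V) 0%R i - (const_mx (- M)%R : V) 0%R i))%:E).
  apply: box_gauge_le => [i|x /AM xM i]; rewrite !mxE.
    by rewrite (le_trans _ M0)// oppr_le0.
  by rewrite -ler_norml; apply: le_trans xM; exact: coord_le_norm.
by rewrite ltry.
Qed.

End Translations.

(** * Lebesgue measure on Borel sets and Tonelli along lines *)

Section BorelLebesgue.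
Context {R : realType} {n : nat}.
Local Notation V := 'rV[R]_n.
Local Open Scope ereal_scope.

(** The same set function on the Borel sigma-algebra, for which (x, s) |-> x + s e is measurable on
    the product, as Tonelli requires. *)
Definition lebb : set (borel R n) -> \bar R := @leb_outer R n.

Let lebb0 : lebb set0 = 0. Proof. exact: (measure0 (leb n)). Qed.

Let lebb_ge0 A : 0 <= lebb A. Proof. exact: (measure_ge0 (leb n)). Qed.

Let lebb_sigma_additive : semi_sigma_additive lebb.
Proof.
move=> F mF tF mUF.
apply: (@measure_semi_sigma_additive _ _ _ (leb n) F) => //.
  by move=> i; exact: leb_borel.
exact: leb_borel.
Qed.

HB.instance Definition _ := isMeasure.Build _ (borel R n) R lebb
  lebb0 lebb_ge0 lebb_sigma_additive.

Lemma continuous_norm_borel :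
  measurable_fun [set: borel R n] ((fun x : V => `|x|%R) : borel R n -> R).
Proof.
apply: continuous_measurable_borel => //.
by apply: continuous_subspaceT => x; exact: norm_continuous.
Qed.

Lemma norm_ball_borel (M : R) : measurable ([set x : V | (`|x| <= M)%R] : set (borel R n)).
Proof.
have := continuous_norm_borel measurableT (measurable_itv `]-oo, M]).
rewrite setTI (_ : _ @^-1` _ = [set x : V | (`|x| <= M)%R]) //.
Qed.

Let lebb_sigma_finite : sigma_finite setT lebb.
Proof.
exists (fun k => [set x : V | (`|x| <= k%:R)%R]).
  apply/seteqP; split => // x _; exists (Num.truncn `|x|%R).+1 => //=.
  by apply/ltW; apply: truncnS_gt.
move=> k; split; first exact: norm_ball_borel.
by apply: (@leb_bounded_lty _ _ _ k%:R).
Qed.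

HB.instance Definition _ := Measure_isSigmaFinite.Build _ _ _ lebb
  lebb_sigma_finite.

Lemma integral_lebb (D : set V) (f : V -> \bar R) :
  measurable (D : set (borel R n)) ->
  measurable_fun (D : set (borel R n)) (f : borel R n -> \bar R) ->
  (forall x, D x -> 0 <= f x) ->
  \int[leb n]_(x in D) f x = \int[lebb]_(x in D) f x.
Proof.
move=> mD mf f0.
have mid := caratheodory_id_borel (@leb_halfspace R n).
have := @ge0_integral_pushforward _ _ (caratheodory_type (@leb_om R n)) (borel R n)
  R id mid (leb n) D f mD mf.
move=> <-; last by move=> x; rewrite inE; exact: f0.
exact: eq_measure_integral.
Qed.

Lemma shift_measurable (c : V) :
  measurable_fun [set: borel R n] ((fun x : V => x + c)%R : borel R n -> borel R n).
Proof.
apply: coord_measurable_borel => i.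
apply: (continuous_measurable_borel (f := fun x : V => (x + c)%R 0%R i)) => //.
apply: continuous_subspaceT.
rewrite (_ : (fun x : V => _) = (fun x : V => x 0%R i + c 0%R i)%R); last first.
  by apply/funext => x; rewrite mxE.
by move=> x; apply: continuousD; [exact: coord_continuous | exact: cst_continuous].
Qed.

Lemma integral_lebb_shift (c : V) (f : V -> \bar R) :
  measurable_fun [set: borel R n] (f : borel R n -> \bar R) -> (forall x, 0 <= f x) ->
  \int[lebb]_x f (x + c)%R = \int[lebb]_x f x.
Proof.
move=> mf f0.
have := @ge0_integral_pushforward _ _ (borel R n) (borel R n)
  R _ (shift_measurable c) lebb setT f measurableT mf.
move=> E; transitivity (\int[pushforward lebb
    ((fun x : V => x + c)%R : borel R n -> borel R n)]_x f x).
  by rewrite E // => x _.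
apply: eq_measure_integral; first exact: shift_measurable.
move=> ? A mA _; rewrite /pushforward /=.
transitivity (@leb_outer R n (translate (- c)%R A)).
  by rewrite translate_preimage opprK.
exact: leb_outer_translate.
Qed.

(** Exchanging the integrals and shifting by s e turns the left side into the integral over y of
    H(y) times the length of {s : y - s e in A}. That set has diameter at most [l], hence lies in an
    interval of length 2 [l]. This is where the factor [delta_h] of the strip estimate arises. *)
Lemma line_integral_le (A : set V) (H : V -> R) (e : V) (rho l : R) :
  measurable (A : set (borel R n)) -> measurable_fun [set: borel R n] (H : borel R n -> R) ->
  (forall x, (0 <= H x)%R) -> (0 <= l)%R ->
  (forall y s s', (0 <= s <= rho)%R -> (0 <= s' <= rho)%R ->
     A (y - s *: e)%R -> A (y - s' *: e)%R -> (`|s - s'| <= l)%R) ->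
  \int[lebb]_(x in A) \int[lebesgue_measure]_(s in `[0%R, rho])
     (H (x + s *: e)%R)%:E <=
  (2 * l)%:E * \int[lebb]_x (H x)%:E.
Proof.
move=> mA mH H0 l0 hA.
pose I : set R := `[0%R, rho]%classic.
have mI : measurable I by exact: measurable_itv.
pose f (p : borel R n * measurableTypeR R) : \bar R :=
  (\1_A p.1 * \1_I p.2 * H (p.1 + p.2 *: e))%:E.
pose g (p : borel R n * measurableTypeR R) : \bar R :=
  (\1_A (p.1 - p.2 *: e) * \1_I p.2 * H p.1)%:E.
have mline (a : R) : measurable_fun [set: borel R n * measurableTypeR R]
    ((fun p => p.1 + (a * p.2) *: e)%R : _ -> borel R n).
  apply: coord_measurable_borel => i.
  rewrite (_ : (fun t => _) = (fun t : borel R n * measurableTypeR R =>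
     (t.1 : V) 0%R i + (a * t.2) * e 0%R i)%R); last first.
    by apply/funext => t; rewrite !mxE.
  apply: measurable_funD.
    apply: (measurableT_comp (f := (fun x : V => x 0%R i) : borel R n -> R)) => //.
    apply: continuous_measurable_borel => //.
    by apply: continuous_subspaceT => x; exact: coord_continuous.
  by apply: measurable_funM => //; apply: measurable_funM.
have m1A : measurable_fun [set: borel R n] (\1_A : borel R n -> R).
  exact: measurable_indic.
have m1I : measurable_fun [set: measurableTypeR R] (\1_I : R -> R).
  exact: measurable_indic.
have mf : measurable_fun setT f.
  apply/measurable_EFinP; apply: measurable_funM.
    apply: measurable_funM; first exact: (measurableT_comp m1A).
    exact: (measurableT_comp m1I).
  apply: (measurableT_comp mH); have := mline 1%R.
  by under eq_fun do rewrite mul1r.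
have mg : measurable_fun setT g.
  apply/measurable_EFinP; apply: measurable_funM; last exact: measurableT_comp.
  apply: measurable_funM; last exact: (measurableT_comp m1I).
  apply: (measurableT_comp m1A); have := mline (-1)%R.
  by under eq_fun do rewrite mulN1r scaleNr.
have f0 p : 0 <= f p by rewrite lee_fin !mulr_ge0.
have g0 p : 0 <= g p by rewrite lee_fin !mulr_ge0.
have -> : \int[lebb]_(x in A) \int[lebesgue_measure]_(s in I) (H (x + s *: e)%R)%:E =
    \int[lebb]_x \int[lebesgue_measure]_s f (x, s).
  rewrite integral_mkcond; apply: eq_integral => x _; rewrite patchE.
  case: ifPn => xA.
    rewrite integral_mkcond; apply: eq_integral => s _; rewrite patchE /f /=.
    rewrite !indicE xA mul1r; case: ifPn => sI; by rewrite ?mul1r ?mul0r.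
  apply/esym/integral0_eq => s _.
  by rewrite /f /= !indicE (negbTE xA) !mul0r.
have TF := @fubini_tonelli _ _ (borel R n) (measurableTypeR R) R lebb lebesgue_measure f mf f0.
have TG := @fubini_tonelli _ _ (borel R n) (measurableTypeR R) R lebb lebesgue_measure g mg g0.
rewrite /fubini_F /fubini_G in TF TG.
rewrite TF.
have -> : \int[lebesgue_measure]_s \int[lebb]_x f (x, s) =
    \int[lebesgue_measure]_s \int[lebb]_x g (x, s).
  apply: eq_integral => s _.
  rewrite -[RHS](@integral_lebb_shift (s *: e)%R (fun x => g (x, s))); last first.
  - by move=> x; exact: g0.
  - exact: (measurableT_comp mg).
  by apply: eq_integral => x _; rewrite /f /g /= addrK.
rewrite -TG.
have mHE : measurable_fun [set: borel R n] (EFin \o H) by exact/measurable_EFinP.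
rewrite -ge0_integralZl_EFin ?mulr_ge0//; last by move=> x _; rewrite lee_fin.
apply: ge0_le_integral => //.
- by move=> x _; apply: integral_ge0 => s _; exact: g0.
- apply: (@measurable_fun_fubini_tonelli_F _ _ (borel R n) (measurableTypeR R) R
    lebesgue_measure g mg g0).
- exact: measurable_funeM.
move=> y _.
pose S := [set s | I s /\ A (y - s *: e)%R].
have [[s0 [Is0 As0]]|/set0P/negP] := pselect (S !=set0); last first.
  rewrite negbK => /eqP S0; rewrite [leLHS](_ : _ = 0).
    by rewrite -EFinM lee_fin !mulr_ge0.
  apply: integral0_eq => s _.
  rewrite /g /= !indicE.
  have [sI|] := boolP (s \in I); last by rewrite mulr0 mul0r.
  have [sA|] := boolP ((y - s *: e)%R \in A); last by rewrite !mul0r.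
  have : S s by split; [exact: (set_mem sI) | exact: (set_mem sA)].
  by rewrite S0.
(* Any admissible parameter [s0] serves as the centre; the length 2 [l] instead of [l] spares the
   choice of an extremal one. *)
apply: (@le_trans _ _ (\int[lebesgue_measure]_(s in `[(s0 - l)%R, (s0 + l)%R]) (H y)%:E)).
  rewrite [leRHS]integral_mkcond; apply: ge0_le_integral => //.
  - exact: (measurableT_comp mg).
  - by apply/measurable_restrict => //; rewrite ?setTI //; exact: measurable_cst.
  move=> s _; rewrite /g /= !indicE patchE.
  have [sI|] := boolP (s \in I); last first.
    by rewrite mulr0 mul0r; case: ifPn; rewrite // lee_fin.
  have [sA|] := boolP ((y - s *: e)%R \in A); last first.
    by rewrite !mul0r; case: ifPn; rewrite // lee_fin.
  rewrite !mul1r ifT // inE /= in_itv /=.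
  move: Is0 sI; rewrite inE /I /= !in_itv /= => Is0 sI.
  have := hA y s s0 sI Is0 (set_mem sA) As0.
  by rewrite ler_distl.
rewrite integral_cst//= lebesgue_measure_itv /= lte_fin.
case: ifPn => _; last by rewrite mule0 -EFinM lee_fin !mulr_ge0.
rewrite -EFinB -!EFinM lee_fin mulrC ler_wpM2r //; lra.
Qed.

End BorelLebesgue.

(** * Fundamental theorem of calculus along a line through several elements *)

Section PiecewiseFTC.
Context {R : realType}.
Local Notation mu := (@lebesgue_measure R).

Lemma ftc_le (q q' g : R -> R) (a b : R) : a <= b ->
  (forall t, is_derive t (1 : R) q (q' t)) -> continuous q' -> continuous g ->
  (forall t, `|q' t| <= g t) ->
  (`|q b - q a|%:E <= \int[mu]_(t in `[a, b]) (g t)%:E)%E.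
Proof.
move=> ab dq cq' cg qg.
have g0 t : 0 <= g t by exact: le_trans (normr_ge0 _) (qg t).
move: ab; rewrite le_eqVlt => /orP[/eqP <-|ab].
  by rewrite subrr normr0; apply: integral_ge0 => t _; rewrite lee_fin.
have cq : continuous q.
  move=> t; apply/differentiable_continuous/derivable1_diffP.
  by have := dq t => -[].
have E := @continuous_FTC2 R q' q a b ab.
have {}E : (\int[mu]_(t in `[a, b]) (q' t)%:E = (q b)%:E - (q a)%:E)%E.
  apply: E.
  - exact: continuous_subspaceT.
  - split.
    + by move=> t _; have := dq t => -[].
    + by apply: cvg_at_right_filter; exact: cq.
    + by apply: cvg_at_left_filter; exact: cq.
  - by move=> t _; rewrite derive1E; have := dq t => -[].
have mq' : measurable_fun `[a, b] q'.
  by apply: measurable_funTS; exact: continuous_measurable_fun.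
have mg : measurable_fun `[a, b] g.
  by apply: measurable_funTS; exact: continuous_measurable_fun.
rewrite -abse_EFin EFinB -E.
apply: le_trans (le_abse_integral _ _ _) _ => //.
  exact/measurable_EFinP.
apply: ge0_le_integral => //.
- by apply/measurable_EFinP; apply: measurableT_comp.
- exact/measurable_EFinP.
- by move=> t _; rewrite lee_fin.
Qed.

(** Induction on the number of pieces: follow a piece that contains the left end to its last point
    [b]. As it is an interval, the fundamental theorem applies on [a, b]; beyond [b] it never
    returns, so the other pieces cover the remainder. Overlaps only enlarge the right side. *)
Lemma piecewise_ftc_le (I : choiceType) (L : seq I) (C : I -> set R)
    (q q' g : I -> R -> R) (f : R -> R) (a s : R) :
  a <= s ->
  (forall e, e \in L -> closed (C e)) ->
  (forall e, e \in L -> is_interval (C e)) ->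
  (forall t, a <= t <= s -> exists2 e, e \in L & C e t) ->
  (forall e t, e \in L -> a <= t <= s -> C e t -> f t = q e t) ->
  (forall e t, e \in L -> is_derive t (1 : R) (q e) (q' e t)) ->
  (forall e, e \in L -> continuous (q' e)) ->
  (forall e, e \in L -> continuous (g e)) ->
  (forall e t, e \in L -> `|q' e t| <= g e t) ->
  (`|f s - f a|%:E <=
    \sum_(e <- L) \int[mu]_(t in `[a, s] `&` C e) (g e t)%:E)%E.
Proof.
have [n] := ubnP (size L); elim: n L a => // n ih L a sL as_ clC itC cov fq dq cq' cg qg.
have g0 e t : e \in L -> 0 <= g e t.
  by move=> eL; exact: le_trans (normr_ge0 _) (qg e t eL).
have mC e b : e \in L -> measurable (`[b, s]%classic `&` C e).
  by move=> eL; apply: measurableI => //; apply: closed_measurable; exact: clC.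
have mg e (D : set R) : e \in L -> measurable_fun D (fun t => (g e t)%:E).
  move=> eL; apply/measurable_EFinP; apply: measurable_funTS.
  by apply: continuous_measurable_fun; exact: cg.
have aa : a <= a <= s by rewrite lexx as_.
have [e eL Cea] := cov a aa.
pose B := `[a, s]%classic `&` C e.
have Ba : B a by split => //=; rewrite in_itv /= lexx.
have Bub : has_sup B.
  split; first by exists a.
  by exists s => t [] /=; rewrite in_itv /= => /andP[].
have clB : closed B by apply: closedI; [exact: interval_closed|exact: clC].
pose b := sup B.
have [Bb1 Ceb] : B b.
  have := closure_sup (proj1 Bub) (proj2 Bub).
  by rewrite -/b; move/closure_id : clB => <-.
have /andP[ab bs] : a <= b <= s by move: Bb1; rewrite /= in_itv.
have subab : `[a, b]%classic `<=` `[a, s]%classic `&` C e.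
  move=> t /=; rewrite !in_itv /= => /andP[at_ tb]; split.
    by rewrite at_ (le_trans tb bs).
  by apply: (itC e eL a b) => //; rewrite at_.
have step1 : (`|f b - f a|%:E <= \int[mu]_(t in `[a, s] `&` C e) (g e t)%:E)%E.
  rewrite (fq e b) ?ab // (fq e a) ?lexx //.
  apply: le_trans (ftc_le ab _ (cq' e eL) (cg e eL) _) _.
  - by move=> t; exact: dq.
  - by move=> t; exact: qg.
  apply: ge0_subset_integral => //; first exact: mC.
    exact: mg.
  by move=> t _; rewrite lee_fin g0.
have [bs'|sb] := ltP b s; last first.
  have sbE : s = b by apply/eqP; rewrite eq_le sb bs.
  rewrite (big_rem e)//= {1}sbE; apply: le_trans step1 _.
  apply: leeDl; rewrite big_seq; apply: sume_ge0 => e' e'L.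
  by apply: integral_ge0 => t _; rewrite lee_fin g0 // (mem_rem e'L).
have covr t : b < t -> t <= s -> exists2 e', e' \in rem e L & C e' t.
  move=> bt ts.
  have ats : a <= t <= s by rewrite ts (le_trans ab (ltW bt)).
  have [e' e'L Ce't] := cov t ats.
  exists e' => //.
  have nC : ~ C e t.
    move=> Cet; have : t <= b.
      by apply: sup_upper_bound => //; split => //=; rewrite in_itv /= ts (le_trans ab (ltW bt)).
    by rewrite leNgt bt.
  have e'e : e' != e by apply/eqP => E; apply: nC; rewrite -E.
  by move: e'L; rewrite (perm_mem (perm_to_rem eL)) inE (negbTE e'e).
(* The point [b] itself must lie in another piece: the remaining pieces have a closed union that
   contains points arbitrarily close to [b] on its right. *)
have covb : exists2 e', e' \in rem e L & C e' b.
  apply: contrapT => noC.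
  have clU : closed (\bigcup_(e' in [set` rem e L]) C e').
    rewrite bigcup_seq big_seq; elim/big_ind: _ => //.
    - exact: closed0.
    - by move=> A A'; exact: closedU.
    - by move=> e' e'L; apply: clC; exact: mem_rem e'L.
  have nUb : (~` \bigcup_(e' in [set` rem e L]) C e') b.
    by move=> [e' e'L Ce'b]; apply: noC; exists e'.
  have /nbhs_ballP[r /= r0 rU] := open_nbhs_nbhs (conj (closed_openC clU) nUb).
  pose t := Num.min s (b + r / 2).
  have bt : b < t by rewrite lt_min bs' /= ltrDl divr_gt0.
  have ts : t <= s by rewrite ge_min lexx.
  have [e' e'L Ce't] := covr t bt ts.
  have : ball b r t.
    rewrite /ball /= distrC ger0_norm ?subr_ge0 ?(ltW bt)// ltrBlDl.
    by apply: (@le_lt_trans _ _ (b + r / 2)); [rewrite ge_min lexx orbT|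
       rewrite ltrD2l ltr_pdivrMr // ltr_pMr // ltr1n].
  by move=> /rU; apply; exists e'.
have memL e' : e' \in rem e L -> e' \in L by exact: mem_rem.
have step2 : (`|f s - f b|%:E <=
    \sum_(e' <- rem e L) \int[mu]_(t in `[b, s] `&` C e') (g e' t)%:E)%E.
  apply: ih => //.
  - have L0 : (0 < size L)%N by move: eL; case: (L).
    by rewrite size_rem // -ltnS prednK.
  - by move=> e' /memL; exact: clC.
  - by move=> e' /memL; exact: itC.
  - move=> t /andP[]; rewrite le_eqVlt => /orP[/eqP <-//|bt ts]; exact: covr.
  - move=> e' t /memL e'L /andP[bt ts]; apply: fq => //.
    by rewrite ts (le_trans ab bt).
  - by move=> e' t /memL; exact: dq.
  - by move=> e' /memL; exact: cq'.
  - by move=> e' /memL; exact: cg.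
  - by move=> e' t /memL; exact: qg.
rewrite (big_rem e)//=.
apply: (@le_trans _ _ (`|f b - f a|%:E + `|f s - f b|%:E)%E).
  rewrite -EFinD lee_fin [leRHS]addrC.
  exact: ler_distD.
apply: leeD => //; apply: le_trans step2 _.
rewrite big_seq [leRHS]big_seq; apply: lee_sum => e' /memL e'L.
apply: ge0_subset_integral => //; [exact: mC|exact: mC|exact: mg| |].
  by move=> t _; rewrite lee_fin g0.
apply: setSI => t /=; rewrite !in_itv /= => /andP[bt ->].
by rewrite (le_trans ab bt).
Qed.

End PiecewiseFTC.

(** * Polynomials and their derivatives along lines *)

Section PolynomialFunctions.
Context {R : realType} {d : nat}.
Local Notation V := 'rV[R]_d.

(** Polynomials without degree or normal form, so that continuity and closure under partial
    derivatives follow by structural induction. *)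
Inductive polyfun : (V -> R) -> Prop :=
| polyfun_cst (c : R) : polyfun (fun=> c)
| polyfun_coord (i : 'I_d) : polyfun (fun x => x 0 i)
| polyfun_add f g : polyfun f -> polyfun g -> polyfun (fun x => f x + g x)
| polyfun_mul f g : polyfun f -> polyfun g -> polyfun (fun x => f x * g x).

Lemma polyfun_sum (I : Type) (r : seq I) (Q : pred I) (f : I -> V -> R) :
  (forall i, polyfun (f i)) -> polyfun (fun x => \sum_(i <- r | Q i) f i x).
Proof.
move=> pf; elim: r => [|i r ih].
  by under eq_fun do rewrite big_nil; exact: polyfun_cst.
under eq_fun do rewrite big_cons.
by case: (Q i) => //; exact: polyfun_add.
Qed.

Lemma polyfun_prod (I : Type) (r : seq I) (Q : pred I) (f : I -> V -> R) :
  (forall i, polyfun (f i)) -> polyfun (fun x => \prod_(i <- r | Q i) f i x).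
Proof.
move=> pf; elim: r => [|i r ih].
  by under eq_fun do rewrite big_nil; exact: polyfun_cst.
under eq_fun do rewrite big_cons.
by case: (Q i) => //; exact: polyfun_mul.
Qed.

Lemma polyfun_exp f n : polyfun f -> polyfun (fun x => f x ^+ n).
Proof.
move=> pf; elim: n => [|n ih].
  by under eq_fun do rewrite expr0; exact: polyfun_cst.
by under eq_fun do rewrite exprS; exact: polyfun_mul.
Qed.

Lemma is_poly_polyfun k (p : V -> R) : is_poly k p -> polyfun p.
Proof.
move=> [c pE]; have -> : p = fun x =>
    \sum_(a | (order_of (mdeg a) <= k)%N) c a * \prod_i x 0 i ^+ a i.
  exact/funext.
apply: polyfun_sum => a; apply: polyfun_mul; first exact: polyfun_cst.
by apply: polyfun_prod => i; apply: polyfun_exp; exact: polyfun_coord.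
Qed.

Lemma polyfun_continuous f : polyfun f -> continuous f.
Proof.
elim=> {f} [c|i|f g _ cf _ cg|f g _ cf _ cg] x.
- exact: cst_continuous.
- exact: coord_continuous.
- exact: (continuousD (cf x) (cg x)).
- exact: (continuousM (cf x) (cg x)).
Qed.

Lemma is_derive_coord (x w : V) (i : 'I_d) :
  is_derive x w (fun y : V => y 0 i) (w 0 i).
Proof.
have E : (fun h : R => h^-1 *: (((h *: w + x) 0 i : R) - x 0 i)) @ 0^' --> w 0 i.
  apply: cvg_near_cst; near=> h.
  have h0 : h != 0 by near: h; exact: nbhs_dnbhs_neq.
  by rewrite !mxE addrK /GRing.scale /= mulKf.
by apply: DeriveDef; [apply/cvg_ex; exists (w 0 i) | exact: cvg_lim].
Unshelve. all: by end_near. Qed.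

Lemma polyfun_derive f : polyfun f ->
  exists df : 'I_d -> V -> R, (forall j, polyfun (df j)) /\
    forall x w : V, is_derive x w f (\sum_j w 0 j * df j x).
Proof.
elim=> {f} [c|i|f g _ [df [pdf Df]] _ [dg [pdg Dg]]
           |f g pf [df [pdf Df]] pg [dg [pdg Dg]]].
- exists (fun _ _ => 0); split => [j|x w]; first exact: polyfun_cst.
  rewrite big1 => [|j _]; last by rewrite mulr0.
  exact: (is_derive_cst c x w).
- exists (fun j _ => (j == i)%:R); split => [j|x w]; first exact: polyfun_cst.
  rewrite (bigD1 i)//= eqxx mulr1 big1 ?addr0; first exact: is_derive_coord.
  by move=> j /negbTE ->; rewrite mulr0.
- exists (fun j x => df j x + dg j x); split => [j|x w]; first exact: polyfun_add.
  rewrite (eq_bigr (fun j => w 0 j * df j x + w 0 j * dg j x)); last first.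
    by move=> j _; rewrite mulrDr.
  by rewrite big_split /=; exact: (is_deriveD (Df x w) (Dg x w)).
- exists (fun j x => f x * dg j x + g x * df j x); split => [j|x w].
    by apply: polyfun_add; exact: polyfun_mul.
  apply: is_derive_eq (is_deriveM (Df x w) (Dg x w)) _.
  rewrite /GRing.scale /= !mulr_sumr -big_split /=; apply: eq_bigr => j _.
  by ring.
Qed.

Lemma is_derive_line (f : V -> R) (x w : V) (t df : R) :
  is_derive (x + t *: w) w f df ->
  is_derive t (1 : R) (fun s => f (x + s *: w)) df.
Proof.
have E : (fun h : R => h^-1 *: (f (x + (h *: (1 : R) + t) *: w) - f (x + t *: w))) =
    (fun h : R => h^-1 *: (f (h *: w + (x + t *: w)) - f (x + t *: w))).
  apply/funext => h; congr (_ *: (f _ - _)).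
  by rewrite scalerDl /GRing.scale /= mulr1 addrCA.
move=> [D1 D2]; apply: DeriveDef.
  by move: D1; rewrite /derivable -E.
by move: D2; rewrite /derive -E.
Qed.

End PolynomialFunctions.

Section HyperplaneNull.
Context {R : realType} {n : nat}.
Local Notation V := 'rV[R]_n.

(** The translates of [B] by w/(k+1) lie in the distinct levels l = 1/(k+1), hence are disjoint;
    they have equal measure and stay in one bounded set, so that measure is 0. *)
Lemma lebb_level_null (l : V -> R) (w : V) (B : set V) (M : R) :
  measurable (B : set (borel R n)) -> 0 <= M -> (forall x, B x -> `|x| <= M) ->
  (forall x t, l (x + t *: w) = l x + t) -> (forall x, B x -> l x = 0) ->
  lebb (B : set (borel R n)) = 0%E.
Proof.
move=> mB M0 BM lw Bl.
pose c (k : nat) : V := k.+1%:R^-1 *: w.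
pose N k := translate (c k) B.
have mN k : measurable (N k : set (borel R n)).
  rewrite /N translate_preimage -[X in measurable X]setTI.
  exact: (shift_measurable (- c k)).
have lN k x : N k x -> l x = k.+1%:R^-1 by move=> [y By <-]; rewrite lw Bl // add0r.
have tN : trivIset setT N.
  apply/trivIsetP => i j _ _ ij; rewrite -subset0 => x [/lN h1 /lN h2].
  move/eqP: ij; apply; move: h2; rewrite h1 => /invr_inj/eqP.
  by rewrite eqr_nat eqSS => /eqP.
have eN k : lebb (N k : set (borel R n)) = lebb (B : set (borel R n)).
  exact: leb_outer_translate.
pose C := M + `|w|.
have C0 : 0 <= C by rewrite addr_ge0.
have Nsub k x : N k x -> `|x| <= C.
  move=> [y /BM yM <-]; apply: le_trans (ler_normD _ _) _; apply: lerD => //.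
  by rewrite normrZ ger0_norm ?invr_ge0// ler_piMl // invf_le1 // ler1n.
pose D : set V := [set x | `|x| <= C].
have Doo : (lebb (D : set (borel R n)) < +oo)%E by exact: (@leb_bounded_lty _ _ _ C).
have le_D K : (\sum_(k < K) lebb (B : set (borel R n)) <= lebb (D : set (borel R n)))%E.
  rewrite (eq_bigr (fun k : 'I_K => lebb (N k : set (borel R n)))); last by move=> k _; rewrite eN.
  rewrite -(@measure_bigsetU _ _ _ lebb (fun k => N k) mN); last exact: tN.
  apply: le_measure; rewrite ?inE; [|exact: norm_ball_borel|].
    by apply: bigsetU_measurable => k _; exact: mN.
  rewrite -bigcup_mkord => x [k _]; exact: Nsub.
have B0 : (0 <= lebb (B : set (borel R n)))%E by exact: measure_ge0.
have Dfin : lebb (D : set (borel R n)) \is a fin_num by rewrite ge0_fin_numE ?measure_ge0.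
have Bfin : lebb (B : set (borel R n)) \is a fin_num.
  by rewrite ge0_fin_numE //; apply: le_lt_trans Doo; have := le_D 1%N; rewrite big_ord1.
move: B0 le_D; rewrite -(fineK Bfin) -(fineK Dfin) lee_fin.
set m := fine _; set q := fine _ => m0 le_D; congr (_%:E); apply/eqP.
rewrite eq_le m0 andbT leNgt; apply/negP => mp.
have := le_D (Num.truncn (q / m)).+1; rewrite sumEFin lee_fin sumr_const card_ord leNgt => /negP; apply.
by rewrite -mulr_natl -ltr_pdivrMr //; exact: truncnS_gt.
Qed.

End HyperplaneNull.

(** * Barycentric coordinates; faces are null sets *)

Section Barycentric.
Context {R : realType} {d : nat} (T : mesh R d).
Local Notation V := 'rV[R]_d.

(** The rows are the homogeneous coordinates (1, v_i) of the vertices. Affine independence makes the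
    matrix invertible, and (1, x) times its inverse is the row of barycentric coordinates of x. *)
Definition vtx_mx (e : 'I_(nel T)) : 'M[R]_(d.+1, 1 + d) :=
  \matrix_(i < d.+1) row_mx (const_mx 1) (vtx e i).

Definition inv_vtx_mx (e : 'I_(nel T)) : 'M[R]_(1 + d, d.+1) :=
  invmx (vtx_mx e : 'M[R]_d.+1).

Definition bary (e : 'I_(nel T)) (i : 'I_d.+1) (x : V) : R :=
  (row_mx (const_mx 1) x *m inv_vtx_mx e) 0 i.

Definition core (e : 'I_(nel T)) : set V := [set x | forall i, 0 < bary e i x].

Lemma bary_polyfun e i : polyfun (bary e i).
Proof.
have -> : bary e i = fun x => inv_vtx_mx e (lshift d ord0) i +
    \sum_j x 0 j * inv_vtx_mx e (rshift 1 j) i.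
  apply/funext => x; rewrite /bary mxE.
  rewrite (@big_split_ord _ _ _ 1 d) /= big_ord1; congr (_ + _).
    by rewrite row_mxEl mxE mul1r.
  by apply: eq_bigr => j _; rewrite row_mxEr.
apply: polyfun_add; first exact: polyfun_cst.
by apply: polyfun_sum => j; apply: polyfun_mul; [exact: polyfun_coord|exact: polyfun_cst].
Qed.

Hypothesis indep : forall (e : 'I_(nel T)) (l : 'I_d.+1 -> R), \sum_i l i = 0 ->
  \sum_i l i *: vtx e i = 0 -> forall i, l i = 0.

Lemma mul_vtx_mx e (l : 'rV[R]_(d.+1)) :
  l *m vtx_mx e = row_mx (const_mx (\sum_i l 0 i)) (\sum_i l 0 i *: vtx e i).
Proof.
apply/rowP => j; rewrite mxE; case: (split_ordP j) => k ->.
  rewrite row_mxEl mxE; apply: eq_bigr => i _; by rewrite mxE row_mxEl mxE mulr1.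
by rewrite row_mxEr summxE; apply: eq_bigr => i _; rewrite [RHS]mxE [vtx_mx e _ _]mxE row_mxEr.
Qed.

Lemma vtx_mx_unit e : (vtx_mx e : 'M[R]_d.+1) \in unitmx.
Proof.
rewrite -row_free_unit; apply: inj_row_free => l.
rewrite mul_vtx_mx => E.
have E1 : const_mx (\sum_i l 0 i) = 0 :> 'rV[R]_1.
  by rewrite -(row_mxKl (const_mx (\sum_i l 0 i) : 'rV_1) (\sum_i l 0 i *: vtx e i)) E linear0.
have E2 : \sum_i l 0 i *: vtx e i = 0.
  by rewrite -(row_mxKr (const_mx (\sum_i l 0 i) : 'rV_1) (\sum_i l 0 i *: vtx e i)) E linear0.
have {}E1 : \sum_i l 0 i = 0 by have := congr1 (fun M : 'rV_1 => M 0 0) E1; rewrite !mxE.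
by apply/rowP => i; rewrite (indep E1 E2) mxE.
Qed.

Lemma bary_uniq e (l : 'I_d.+1 -> R) x : \sum_i l i = 1 ->
  x = \sum_i l i *: vtx e i -> forall i, bary e i x = l i.
Proof.
move=> l1 xE i; rewrite /bary.
have -> : (row_mx (const_mx 1) x : 'rV[R]_(1 + d)) = (\row_i l i) *m vtx_mx e.
  rewrite mul_vtx_mx; congr (row_mx (const_mx _) _).
    by rewrite -l1; apply: eq_bigr => j _; rewrite mxE.
  by rewrite xE; apply: eq_bigr => j _; rewrite mxE.
have E : (\row_i l i) *m vtx_mx e *m inv_vtx_mx e = \row_i l i.
  exact: (mulmxK (vtx_mx_unit e)).
by rewrite E mxE.
Qed.

Lemma baryK e x : \sum_i bary e i x = 1 /\ x = \sum_i bary e i x *: vtx e i.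
Proof.
have := mul_vtx_mx e (row_mx (const_mx 1) x *m inv_vtx_mx e).
have -> : row_mx (const_mx 1) x *m inv_vtx_mx e *m vtx_mx e = row_mx (const_mx 1) x.
  exact: (mulmxKV (vtx_mx_unit e)).
move=> /eq_row_mx[E1 E2]; split => //.
by have := congr1 (fun M : 'rV_1 => M 0 0) E1; rewrite !mxE => ->.
Qed.

Lemma elemE (e : 'I_(nel T)) : elem e = [set x | forall i, 0 <= bary e i x].
Proof.
apply/seteqP; split => x.
  by move=> [l [l0 _ l1 xE]] i; rewrite (bary_uniq l1 xE).
move=> /= h; have [l1 xE] := baryK e x; exists (fun i => bary e i x).
by split => // i; rewrite inE.
Qed.

Lemma core_elem (e : 'I_(nel T)) : core e `<=` elem e.
Proof. by rewrite elemE => x h i; exact/ltW/h. Qed.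

Lemma core_open (e : 'I_(nel T)) : open (core e).
Proof.
rewrite openE => x h.
suff : \forall y \near x, forall i, 0 < bary e i y by [].
apply: (@filter_forall _ _ (fun i y => 0 < bary e i y) (nbhs x)) => i.
apply: (@open_nbhs_nbhs _ x [set y | 0 < bary e i y]); split; last exact: h.
apply: (@open_comp _ _ (bary e i) [set t | 0 < t]); last exact: open_gt.
by move=> y _; exact: (polyfun_continuous (bary_polyfun e i)).
Qed.

Lemma elem_closed (e : 'I_(nel T)) : closed (elem e).
Proof.
rewrite elemE.
have -> : [set x | forall i, 0 <= bary e i x] =
    \bigcap_(i in [set: 'I_d.+1]) [set x | 0 <= bary e i x].
  by apply/seteqP; split => [x h i _|x h i]; exact: h.
apply: closed_bigI => i _.
apply: (@closed_comp _ _ (bary e i) [set t | 0 <= t]); last exact: closed_ge.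
by move=> x _; exact: (polyfun_continuous (bary_polyfun e i)).
Qed.

Definition bary_slope (e : 'I_(nel T)) (i : 'I_d.+1) (w : V) : R :=
  (row_mx 0 w *m inv_vtx_mx e) 0 i.

Lemma bary_line e i x w t :
  bary e i (x + t *: w) = bary e i x + t * bary_slope e i w.
Proof.
rewrite /bary /bary_slope -[row_mx _ (x + _)](_ : row_mx (const_mx 1) x + t *: row_mx 0 w = _).
  by rewrite mulmxDl -scalemxAl mxE [X in _ + X = _]mxE.
by rewrite scale_row_mx add_row_mx scaler0 addr0.
Qed.

Lemma bary_edge_slope e i j : i != j -> bary_slope e i (vtx e i - vtx e j) = 1.
Proof.
move=> ij; have := bary_line e i (vtx e j) (vtx e i - vtx e j) 1.
rewrite scale1r addrC subrK mul1r => E.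
have vE k l : bary e k (vtx e l) = (k == l)%:R.
  apply: (@bary_uniq e (fun m => (m == l)%:R)).
    by rewrite (bigD1 l)//= eqxx big1 ?addr0 // => m /negbTE ->.
  rewrite (bigD1 l)//= eqxx scale1r big1 ?addr0 // => m /negbTE ->.
  by rewrite scale0r.
by move: E; rewrite !vE eqxx (negbTE ij) add0r => <-.
Qed.

Lemma elem_line_interval (e : 'I_(nel T)) x w : is_interval [set t : R | elem e (x + t *: w)].
Proof.
move=> a b /=; rewrite elemE /= => ha hb t /andP[at_ tb] i.
have := ha i; have := hb i; rewrite !bary_line.
set B := bary e i x; set S := bary_slope e i w => h1 h2.
have [S0|S0] := leP 0 S.
  by apply: (le_trans h2); rewrite lerD2l ler_wpM2r.
by apply: (le_trans h1); rewrite lerD2l ler_wnM2r // ltW.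
Qed.

Lemma elem_bounded (e : 'I_(nel T)) : exists2 M : R, 0 <= M & forall x, elem e x -> `|x| <= M.
Proof.
exists (\sum_i `|vtx e i|); first by apply: sumr_ge0.
move=> x [l [l0 _ l1 ->]]; apply: le_trans (ler_norm_sum _ _ _) _.
apply: ler_sum => i _; rewrite normrZ ger0_norm // ler_piMl //.
by rewrite -l1 (bigD1 i)//= lerDl; apply: sumr_ge0.
Qed.

Definition faces (e : 'I_(nel T)) : set V :=
  elem e `&` \bigcup_(i in [set: 'I_d.+1]) [set x | bary e i x = 0].

Lemma elem_core_faces (e : 'I_(nel T)) x : elem e x -> core e x \/ faces e x.
Proof.
move=> ex; have [h|/existsNP[i hi]] := pselect (core e x); first by left.
right; split => //; exists i => //=; apply/eqP; rewrite eq_le.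
have := ex; rewrite elemE => /(_ i) ->; rewrite andbT leNgt.
exact/negP.
Qed.

Lemma bary_continuous e i : continuous (bary e i).
Proof. exact: polyfun_continuous (bary_polyfun e i). Qed.

Lemma elem_borel (e : 'I_(nel T)) : measurable (elem e : set (borel R d)).
Proof. by apply: closed_borel; exact: elem_closed. Qed.

Lemma face_borel (e : 'I_(nel T)) i : measurable (elem e `&` [set x | bary e i x = 0] : set (borel R d)).
Proof.
apply: closed_borel; apply: closedI; first exact: elem_closed.
apply: (@closed_comp _ _ (bary e i) [set t | t = 0]); last exact: closed_eq.
by move=> x _; exact: bary_continuous.
Qed.

Lemma faces_null (e : 'I_(nel T)) : (0 < d)%N ->
  measurable (faces e : set (borel R d)) /\ lebb (faces e : set (borel R d)) = 0%E.
Proof.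
move=> d0.
have fE : faces e = \bigcup_(i in [set: 'I_d.+1]) (elem e `&` [set x | bary e i x = 0]).
  by rewrite /faces setI_bigcupr.
rewrite fE; split.
  by apply: fin_bigcup_measurable => // i _; exact: face_borel.
have [M M0 eM] := elem_bounded e.
apply/eqP; rewrite eq_le measure_ge0 andbT.
have -> : \bigcup_(i in [set: 'I_d.+1]) (elem e `&` [set x | bary e i x = 0]) =
    \big[setU/set0]_(i < d.+1) (elem e `&` [set x | bary e i x = 0]).
  rewrite -bigcup_seq; apply: eq_bigcupl; split => i //= _.
  exact: mem_index_enum.
rewrite big_seq; elim/big_ind: _ => [|A B hA hB|i _].
- by rewrite measure0.
- apply: le_trans (outer_measureU2 (leb_om d) A B) _.
  by rewrite -(adde0 0%E); apply: leeD.
(* A second vertex exists because d > 0; along the edge from vertex j to vertex i the i-th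
   coordinate has slope 1, as [lebb_level_null] asks. *)
have [j ij] : exists j : 'I_d.+1, i != j.
  have [->|i0] := eqVneq i ord0; last by exists ord0.
  by exists ord_max; rewrite -val_eqE /= neq_ltn d0.
rewrite (@lebb_level_null _ _ (bary e i) (vtx e i - vtx e j) _ M) //.
- exact: face_borel.
- by move=> x [/eM].
- by move=> x t; rewrite bary_line bary_edge_slope // mulr1.
- by move=> x [].
Qed.

End Barycentric.

(** * Integrals of elementwise defined functions over a patch *)

Section PatchIntegral.
Context {R : realType} {d : nat} (T : mesh R d) (D0 : set 'rV[R]_d).
Local Notation V := 'rV[R]_d.
Hypotheses (hT : simplicial_mesh T D0) (d0 : (0 < d)%N).

Lemma mesh_indep (e : 'I_(nel T)) (l : 'I_d.+1 -> R) : \sum_i l i = 0 ->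
  \sum_i l i *: vtx e i = 0 -> forall i, l i = 0.
Proof. by case: hT => h _ _ _; exact: h. Qed.

(** Some vertex of [e1] is not one of [e2]. Points common to both lie in the face of shared
    vertices, where its coordinate vanishes, whereas in the core it is positive. *)
Lemma core_elem_eq (e1 e2 : 'I_(nel T)) x : core e1 x -> elem e2 x -> e1 = e2.
Proof.
move=> c1 x2; apply/eqP/negPn/negP => e12.
have [_ distinct inter _] := hT.
have [i hi] := distinct _ _ e12.
have : (elem e1 `&` elem e2) x by split => //; exact: (core_elem mesh_indep c1).
rewrite inter => -[l [_ lA l1 xE]].
have := c1 i; rewrite (bary_uniq mesh_indep l1 xE) lA ?ltxx //.
rewrite inE; apply/existsPn => j; exact: hi.
Qed.

Definition all_faces : set V := \bigcup_(e in [set: 'I_(nel T)]) faces e.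

Lemma all_faces_borel : measurable (all_faces : set (borel R d)).
Proof.
apply: fin_bigcup_measurable => // e _.
by case: (faces_null mesh_indep e d0).
Qed.

Lemma all_faces_null : lebb (all_faces : set (borel R d)) = 0%E.
Proof.
apply/eqP; rewrite eq_le measure_ge0 andbT.
have -> : all_faces = \big[setU/set0]_(e < nel T) faces e.
  rewrite -bigcup_seq; apply: eq_bigcupl; split => i //= _.
  exact: mem_index_enum.
elim/big_ind: _ => [|A B hA hB|e _].
- by rewrite measure0.
- apply: le_trans (outer_measureU2 (leb_om d) A B) _.
  by rewrite -(adde0 0%E); apply: leeD.
- by case: (faces_null mesh_indep e d0) => _ ->.
Qed.

Lemma patch_closed (A : set 'I_(nel T)) : closed (patch_of A).
Proof.
apply: closed_bigcup => [|e _]; last exact: (elem_closed mesh_indep).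
exact: finite_finset.
Qed.

Lemma patch_bounded (A : set 'I_(nel T)) :
  exists2 M : R, 0 <= M & forall x, patch_of A x -> `|x| <= M.
Proof.
have h (e : 'I_(nel T)) : exists M : R, 0 <= M /\ forall x, elem e x -> `|x| <= M.
  by have [M M0 hM] := elem_bounded e; exists M.
exists (\sum_e sval (cid (h e))).
  by apply: sumr_ge0 => e _; case: (svalP (cid (h e))).
move=> x [e _ ex]; have [_ /(_ _ ex) hx] := svalP (cid (h e)).
apply: le_trans hx _; rewrite (bigD1 e)//= lerDl; apply: sumr_ge0 => e' _.
by case: (svalP (cid (h e'))).
Qed.

Lemma patch_compact (A : set 'I_(nel T)) : compact (patch_of A).
Proof.
apply: bounded_closed_compact; last exact: patch_closed.
have [M M0 hM] := patch_bounded A; exists M; split; first exact: num_real.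
by move=> t Mt x /hM xM; apply: le_trans xM (ltW Mt).
Qed.

Lemma patch_borel (A : set 'I_(nel T)) : measurable (patch_of A : set (borel R d)).
Proof. by apply: closed_borel; exact: patch_closed. Qed.

(** Points on shared faces are counted several times. This is harmless since faces are null, and the
    sum is Borel on the whole space. *)
Definition piecewise (A : set 'I_(nel T)) (phi : 'I_(nel T) -> V -> R) (x : V) : R :=
  \sum_(e | `[< A e >]) \1_(elem e) x * phi e x.

Lemma piecewise_ge0 A phi x : (forall e x, 0 <= phi e x) -> 0 <= piecewise A phi x.
Proof. by move=> h; apply: sumr_ge0 => e _; rewrite mulr_ge0. Qed.

Lemma piecewise_core A phi e x : A e -> core e x -> piecewise A phi x = phi e x.
Proof.
move=> Ae cx; rewrite /piecewise (bigD1 e) /=; last exact/asboolP.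
rewrite indicE mem_set ?mul1r; last exact: (core_elem mesh_indep cx).
rewrite big1 ?addr0 // => e' /andP[_ e'e].
rewrite indicE memNset ?mul0r // => /(core_elem_eq cx) E.
by rewrite E eqxx in e'e.
Qed.

Lemma piecewise_borel A (phi : 'I_(nel T) -> V -> R) :
  (forall e, measurable_fun [set: borel R d] (phi e : borel R d -> R)) ->
  measurable_fun [set: borel R d] (piecewise A phi : borel R d -> R).
Proof.
move=> mphi.
have -> : piecewise A phi = fun x => \sum_(e <- index_enum 'I_(nel T))
    (if `[< A e >] then \1_(elem e) x * phi e x else 0).
  by apply/funext => x; rewrite /piecewise big_mkcond.
apply: (@measurable_sum _ (borel R d) _ setT 'I_(nel T) (index_enum _)
  (fun e x => if `[< A e >] then \1_(elem e) x * phi e x else 0)).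
move=> e; case: (`[< A e >]); last exact: measurable_cst.
apply: measurable_funM => //.
by apply: measurable_indic; exact: (elem_borel mesh_indep).
Qed.

(** [Phi] is typically |grad v|^2, whose values on the faces are uncontrolled. It agrees with a
    Borel function off a null set, and completeness of the Caratheodory measure makes it
    measurable. *)
Lemma patch_integral (A : set 'I_(nel T)) (Phi : V -> R)
    (phi : 'I_(nel T) -> V -> R) :
  (forall e, measurable_fun [set: borel R d] (phi e : borel R d -> R)) ->
  (forall e x, 0 <= phi e x) -> (forall x, 0 <= Phi x) ->
  (forall e x, A e -> core e x -> Phi x = phi e x) ->
  (\int[leb d]_(x in patch_of A) (Phi x)%:E =
   \int[lebb]_x (piecewise A phi x)%:E)%E.
Proof.
move=> mphi phi0 Phi0 PhiE.
pose G := piecewise A phi.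
have mG := piecewise_borel A mphi.
have G0 x : 0 <= G x by exact: piecewise_ge0.
have mP := patch_borel A.
have mGP : measurable_fun (patch_of A : set (borel R d)) (G : borel R d -> R).
  exact: measurable_funS mG.
have mGL : measurable_fun (patch_of A : set (caratheodory_type (leb_om d)))
    ((EFin \o G) : caratheodory_type (leb_om d) -> \bar R).
  apply: (caratheodory_fun_borel (@leb_halfspace R d) mP).
  exact/measurable_EFinP.
have -> : (\int[lebb]_x (G x)%:E = \int[lebb]_(x in patch_of A) (G x)%:E)%E.
  rewrite [RHS]integral_mkcond; apply: eq_integral => x _; rewrite patchE.
  case: ifPn => // xP; congr (_%:E); rewrite /G /piecewise big1 // => e /asboolP Ae.
  rewrite indicE memNset ?mul0r // => ex.
  by move/negP: xP; apply; apply/mem_set; exists e.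
rewrite -integral_lebb //; last 2 first.
- exact/measurable_EFinP.
- by move=> x _; rewrite lee_fin.
have ae : ae_eq (leb d) (patch_of A) (EFin \o G) (EFin \o Phi).
  exists all_faces; split.
  - exact: leb_borel all_faces_borel.
  - exact: all_faces_null.
  move=> x /= /not_implyP[[e Ae ex] GP].
  have [cx|fx] := elem_core_faces mesh_indep ex; last by exists e.
  by exfalso; apply: GP; rewrite /G (piecewise_core _ Ae cx) (PhiE e).
have mPhi : measurable_fun (patch_of A : set (caratheodory_type (leb_om d)))
    ((EFin \o Phi) : caratheodory_type (leb_om d) -> \bar R).
  have cmp : measure_is_complete (leb (R:=R) d).
    exact: (@measure_is_complete_caratheodory R _ (leb_om d)).
  exact: (ae_measurable_fun cmp ae mGL).
apply/esym; apply: ge0_ae_eq_integral => //.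
- exact: leb_borel.
- by move=> x _; rewrite lee_fin.
- by move=> x _; rewrite lee_fin.
Qed.

Lemma grad_core (e : 'I_(nel T)) (v p : V -> V) (dp : 'I_d -> 'I_d -> V -> R) x :
  (forall y, elem e y -> v y = p y) ->
  (forall i (y w : V), is_derive y w (component p i) (\sum_j w 0 j * dp i j y)) ->
  core e x -> forall i j, grad v x i j = dp i j x.
Proof.
move=> vp Dp cx i j; rewrite mxE /partial.
rewrite (@near_eq_derive _ _ _ (component v i) (component p i)).
  have [_ ->] := Dp i x (delta_mx 0 j).
  rewrite (bigD1 j)//= mxE !eqxx mul1r big1 ?addr0 // => l /negbTE lj.
  by rewrite mxE lj andbF mul0r.
have := open_nbhs_nbhs (conj (@core_open _ _ _ e) cx).
by apply: filterS => y cy; rewrite /component vp //; exact: (core_elem mesh_indep cy).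
Qed.

End PatchIntegral.

(** * Uniform geometry of a compact superlevel set *)

Section CompactUniform.
Context {R : realType} {n : nat}.
Local Notation V := 'rV[R]_n.

(** One number serves both as the size of the neighbourhood and as the parameter of [P], so a local
    property that holds for all small parameters becomes uniform. *)
Lemma compact_uniform (K : set V) (P : R -> V -> Prop) : compact K ->
  (forall x, K x -> exists2 e : R, 0 < e &
     forall x' i, `|x - x'| < e -> 0 < i < e -> P i x') ->
  exists2 e : R, 0 < e & forall x, K x -> P e x.
Proof.
move=> /compact_near_coveringP cK hP.
have H : \forall i \near 0^'+, K `<=` P i.
  apply: (cK R (0^'+) P) => x Kx; have [e e0 he] := hP x Kx.
  exists (ball x e, [set i : R | 0 < i < e]).
    split; first exact: nbhsx_ballx.
    near=> i; apply/andP; split; near: i; [exact: nbhs_right_gt|exact: nbhs_right_lt].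
  move=> [x' i] [/= xx' ie]; apply: he => //.
  by move: xx'; rewrite mx_norm_ball.
have [e [e0 he]] := filter_ex (filterI (@nbhs_right_gt R 0) H).
by exists e.
Unshelve. all: by end_near. Qed.

Lemma line_continuous (x w : V) : continuous (fun t : R => x + t *: w).
Proof.
move=> t; apply: (@continuousD _ _ _ (fun=> x) (fun t : R => t *: w)).
  exact: cst_continuous.
exact: scalel_continuous.
Qed.

Lemma last_exit (C : set V) (x y : V) : closed C -> C x -> ~ C y ->
  exists th : R, [/\ 0 <= th < 1, C (x + th *: (y - x)) &
    forall t, th < t <= 1 -> ~ C (x + t *: (y - x))].
Proof.
move=> cC Cx nCy.
pose B := `[0 : R, 1]%classic `&` [set t | C (x + t *: (y - x))].
have B0 : B 0 by split => /=; [rewrite in_itv /= lexx ler01|rewrite scale0r addr0].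
have Bub : has_sup B.
  by split; [exists 0|exists 1 => t [] /=; rewrite in_itv /= => /andP[]].
have clB : closed B.
  apply: closedI; first exact: interval_closed.
  apply: (@closed_comp _ _ (fun t : R => x + t *: (y - x)) C) => // t _.
  exact: line_continuous.
have [B1 B2] : B (sup B).
  have := closure_sup (proj1 Bub) (proj2 Bub).
  by move/closure_id : clB => <-.
move: B1; rewrite /= in_itv /= => /andP[s0 s1].
exists (sup B); split => //.
  rewrite s0 lt_neqAle s1 andbT; apply/eqP => E.
  by apply: nCy; move: B2; rewrite /= E scale1r addrC subrK.
move=> t /andP[st t1] Ct; have : t <= sup B.
  apply: sup_upper_bound => //; split => //=.
  by rewrite in_itv /= t1 (le_trans s0 (ltW st)).
by rewrite leNgt st.
Qed.

End CompactUniform.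

Section PartialDerivatives.
Context {R : realType} {n : nat} (psi : 'rV[R]_n -> R) (dpsi : 'I_n -> 'rV[R]_n -> R).
Local Notation V := 'rV[R]_n.
Local Notation e_ j := (delta_mx 0 j : V).
Hypothesis Dpsi : forall j x, is_derive x (e_ j) psi (dpsi j x).

Lemma mvt_line x j (t : R) : exists2 th : R, 0 <= th <= 1 &
  psi (x + t *: e_ j) - psi x = t * dpsi j (x + (th * t) *: e_ j).
Proof.
pose g s := psi (x + s *: e_ j).
have Dg s : is_derive s (1 : R) g (dpsi j (x + s *: e_ j)) by exact: is_derive_line.
have cg : continuous g.
  move=> s; apply/differentiable_continuous/derivable1_diffP.
  by have := Dg s => -[].
have g0 : g 0 = psi x by rewrite /g scale0r addr0.
have [t0|t0] := leP 0 t.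
  have [c] := @MVT_segment R g _ 0 t t0 (fun s _ => Dg s) (continuous_subspaceT cg).
  rewrite in_itv /= subr0 g0 => /andP[c0 ct] E.
  have [tz|tnz] := eqVneq t 0.
    by exists 0; rewrite ?lexx ?ler01 // tz scale0r addr0 subrr mul0r.
  have tp : 0 < t by rewrite lt_neqAle eq_sym tnz.
  exists (c / t); first by rewrite divr_ge0 //= ler_pdivrMr // mul1r.
  by rewrite divfK // E mulrC.
have [c] := @MVT_segment R g _ t 0 (ltW t0) (fun s _ => Dg s) (continuous_subspaceT cg).
rewrite in_itv /= sub0r g0 => /andP[tc c0] E.
exists (c / t); first by rewrite ler_ndivlMr // mul0r c0 /= ler_ndivrMr // mul1r.
rewrite divfK ?lt_eqF // -[LHS]opprB -/(g t) E; ring.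
Qed.

(** From [a] to [b] one coordinate at a time: each move is a one-dimensional mean value step, so
    partial derivatives suffice. *)
Lemma partial_lipschitz (p : V) (r C : R) (a b : V) :
  (forall z, `|z - p| <= r -> forall j, `|dpsi j z| <= C) ->
  `|a - p| <= r -> `|b - p| <= r ->
  `|psi b - psi a| <= C * \sum_j `|b 0 j - a 0 j|.
Proof.
move=> hC ap bp.
have r0 : 0 <= r by exact: le_trans (normr_ge0 _) ap.
pose h k : V := \row_j (if (j < k)%N then b 0 j else a 0 j).
suff H : forall k, (k <= n)%N ->
    `|psi (h k) - psi a| <= C * \sum_(j < n | (j < k)%N) `|b 0 j - a 0 j|.
  have := H n (leqnn n); have -> : h n = b by apply/rowP => j; rewrite mxE ltn_ord.
  by congr (_ <= C * _); apply: eq_bigl => j; rewrite ltn_ord.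
elim=> [_|k ih kn].
  have -> : h 0%N = a by apply/rowP => j; rewrite mxE.
  by rewrite subrr normr0 big_pred0 // mulr0.
pose i := Ordinal kn.
have hS : h k.+1 = h k + (b 0 i - a 0 i) *: e_ i.
  apply/rowP => j; rewrite !mxE eqxx /= ltnS leq_eqVlt.
  have [->|ji] := eqVneq j i; first by rewrite eqxx ltnn mulr1 addrC subrK.
  by rewrite (_ : (j == k :> nat) = false) ?mulr0 ?addr0 //; exact/negbTE.
have [th /andP[th0 th1] E] := mvt_line (h k) i (b 0 i - a 0 i).
set z := h k + (th * _) *: _ in E.
(* Every coordinate of the intermediate point is a convex combination of those of [a] and [b]; hence
   it stays in the sup-norm ball. *)
have zr : `|z - p| <= r.
  apply: norm_le_coord => // j; rewrite !mxE eqxx /=.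
  have aj : `|a 0 j - p 0 j| <= r.
    by apply: le_trans ap; have := coord_le_norm (a - p) j; rewrite !mxE.
  have bj : `|b 0 j - p 0 j| <= r.
    by apply: le_trans bp; have := coord_le_norm (b - p) j; rewrite !mxE.
  have [ji|ji] := eqVneq j i; last by rewrite mulr0 addr0; case: ifP.
  rewrite ji in aj bj *; rewrite ltnn mulr1.
  rewrite (_ : _ - _ = (1 - th) * (a 0 i - p 0 i) + th * (b 0 i - p 0 i)); last by ring.
  apply: le_trans (ler_normD _ _) _; rewrite !normrM ger0_norm ?subr_ge0 //.
  rewrite (ger0_norm th0) [leRHS](_ : _ = (1 - th) * r + th * r); last by ring.
  by apply: lerD; rewrite ler_wpM2l // subr_ge0.
rewrite hS -[_ - psi a](subrKA (psi (h k))).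
apply: le_trans (ler_normD _ _) _.
rewrite E normrM (bigD1 i) /=; last exact: ltnSn.
rewrite mulrDr mulrC; apply: lerD; first by rewrite ler_wpM2r // hC.
apply: le_trans (ih (ltnW kn)) _; rewrite le_eqVlt; apply/orP; left; apply/eqP.
congr (_ * _); apply: eq_bigl => j; rewrite ltnS [(j <= k)%N]leq_eqVlt.
have [->|ji] := eqVneq j i; first by rewrite /= ltnn eqxx.
by rewrite (_ : (j == k :> nat) = false) ?andbT //; exact/negbTE.
Qed.

End PartialDerivatives.

Section SolidGeometry.
Context {R : realType} {n : nat} (psi : 'rV[R]_n -> R) (dpsi : 'I_n -> 'rV[R]_n -> R).
Local Notation V := 'rV[R]_n.
Local Notation e_ j := (delta_mx 0 j : V).
Variable (O : set V).
Hypotheses (Dpsi : forall j x, is_derive x (e_ j) psi (dpsi j x))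
  (cpsi : continuous psi) (cdpsi : forall j, continuous (dpsi j)) (oO : open O).
Let S : set V := [set x | O x /\ 0 <= psi x].
Let G : set V := [set x | O x /\ psi x = 0].
Hypotheses (cS : compact S) (gradG : forall x, G x -> exists j, dpsi j x != 0).

Lemma level_compact : compact G.
Proof.
have -> : G = S `&` [set x | psi x = 0].
  apply/seteqP; split => x /=; first by move=> [Ox p0]; rewrite /S /= p0 lexx.
  by move=> [[Ox _] p0].
apply: compact_closedI => //.
apply: (@closed_comp _ _ psi [set t | t = 0]); last exact: closed_eq.
by move=> x _; exact: cpsi.
Qed.

Lemma level_uniform : exists rho c C : R, [/\ 0 < rho, 0 < c, 0 < C &
  forall p, G p -> (exists j, 4 * c <= `|dpsi j p|) /\
    forall z, `|z - p| <= 4 * rho -> O z /\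
      forall j, `|dpsi j z - dpsi j p| <= c /\ `|dpsi j z| <= C].
Proof.
have cG := level_compact.
have cont j x (e : R) : 0 < e -> exists2 r : R, 0 < r &
    forall z, `|x - z| < r -> `|dpsi j x - dpsi j z| < e.
  move=> e0; have := @cdpsi j x => /cvgrPdist_lt/(_ e e0)/nbhs_ballP[r /= r0 rh].
  by exists r => // z xz; apply: rh; rewrite mx_norm_ball.
have [c4 c40 hc4] : exists2 e : R, 0 < e & forall p, G p -> exists j, e <= `|dpsi j p|.
  apply: compact_uniform => // x /gradG[j dj].
  have dj0 : 0 < `|dpsi j x| / 2 by rewrite divr_gt0 // normr_gt0.
  have [r r0 hr] := cont j x _ dj0.
  exists (Num.min r (`|dpsi j x| / 2)); first by rewrite lt_min r0.
  move=> x' i; rewrite !lt_min => /andP[xr _] /andP[i0 /andP[_ il]].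
  exists j; have := hr _ xr; have := ler_distD (dpsi j x') (dpsi j x) 0.
  rewrite !subr0; lra.
(* The bound is written as [e^-1] because [compact_uniform] yields a small parameter. *)
have [K K0 hK] : exists2 e : R, 0 < e & forall p, G p -> forall j, `|dpsi j p| <= e^-1.
  apply: compact_uniform => // x Gx.
  pose Cx := \sum_j `|dpsi j x| + 1.
  have Cx0 : 0 < Cx by rewrite ltr_pwDr // sumr_ge0.
  pose rr j := sval (cid2 (cont j x 1 ltr01)).
  pose r := \big[Num.min/Cx^-1]_j rr j.
  exists r.
    apply: lt_bigmin; first by rewrite invr_gt0.
    by move=> j _; rewrite /rr; case: cid2.
  move=> x' i xr /andP[i0 ir] j.
  have : `|x - x'| < rr j by apply: lt_le_trans xr _; exact: bigmin_le_cond.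
  move=> /(svalP (cid2 (cont j x 1 ltr01))).2 hx'.
  apply: (@le_trans _ _ Cx).
    have := ler_distD (dpsi j x) (dpsi j x') 0; rewrite !subr0 distrC.
    have : `|dpsi j x| <= \sum_j `|dpsi j x|.
      by rewrite (bigD1 j)//= lerDl sumr_ge0.
    by move: hx'; rewrite /Cx; lra.
  rewrite -[leLHS]invrK lef_pV2 ?posrE ?invr_gt0 //.
  by apply/ltW; apply: lt_le_trans ir _; exact: bigmin_le_id.
pose c := c4 / 4; have c0 : 0 < c by rewrite divr_gt0.
have [rho rho0 hrho] : exists2 e : R, 0 < e & forall p, G p -> forall z, `|z - p| <= 4 * e ->
    O z /\ forall j, `|dpsi j z - dpsi j p| <= c.
  apply: compact_uniform => // x [Ox _].
  have c20 : 0 < c / 2 by rewrite divr_gt0.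
  have /nbhs_ballP[r0 /= r00 hr0] := open_nbhs_nbhs (conj oO Ox).
  pose rr j := sval (cid2 (cont j x _ c20)).
  pose r := \big[Num.min/r0]_j rr j.
  have rp : 0 < r.
    by apply: lt_bigmin => // j _; rewrite /rr; case: cid2.
  (* A point within 4 r/5 of [x'], itself within r/5 of [x], is within r of [x]. *)
  exists (r / 5); first by rewrite divr_gt0.
  move=> x' i xr /andP[i0 ir] z zx'.
  have xz : `|x - z| < r.
    apply: le_lt_trans (ler_distD x' _ _) _; rewrite [`|x' - z|]distrC.
    by apply: (@lt_le_trans _ _ (r / 5 + 4 * (r / 5))); lra.
  have xx' : `|x - x'| < r by apply: lt_trans xr _; lra.
  split.
    apply: hr0; rewrite mx_norm_ball /ball_ /=; apply: lt_le_trans xz _.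
    exact: bigmin_le_id.
  move=> j; have rj : r <= rr j by exact: bigmin_le_cond.
  have h1 := (svalP (cid2 (cont j x _ c20))).2 _ (lt_le_trans xz rj).
  have h2 := (svalP (cid2 (cont j x _ c20))).2 _ (lt_le_trans xx' rj).
  have := ler_distD (dpsi j x) (dpsi j z) (dpsi j x').
  by rewrite [`|dpsi j z - dpsi j x|]distrC; lra.
exists rho, c, (K^-1 + c); split => //; first by rewrite addr_gt0 ?invr_gt0.
move=> p Gp; split.
  have [j hj] := hc4 p Gp; exists j; apply: le_trans hj.
  by rewrite /c; lra.
move=> z zp; have [Oz hz] := hrho p Gp z zp; split => // j; split; first exact: hz.
have := hK p Gp j; have := hz j; have := ler_distD (dpsi j p) (dpsi j z) 0.
rewrite !subr0; lra.
Qed.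

(** At the last point of the segment in the solid [psi] vanishes: were it positive, a little more of
    the segment would belong to the solid, [O] being open. *)
Lemma solid_crossing x y : S x -> ~ S y ->
  exists p, [/\ G p, `|x - p| <= `|x - y| & `|y - p| <= `|x - y|].
Proof.
move=> Sx nSy.
have clS : closed S by apply: compact_closed => //; exact: norm_hausdorff.
have [th [/andP[th0 th1] Sp hp]] := last_exit clS Sx nSy.
exists (x + th *: (y - x)); split; last 2 first.
- rewrite opprD addrA subrr sub0r normrN normrZ ger0_norm // [leRHS]distrC.
  by rewrite ler_piMl // ltW.
- have th1' : 0 <= 1 - th by rewrite subr_ge0 ltW.
  rewrite opprD addrA -{1}[y - x]scale1r -scalerBl normrZ (ger0_norm th1').
  by rewrite [leRHS]distrC ler_piMl // gerBl.
have [Op p0] := Sp; split => //; apply/eqP; rewrite eq_le p0 andbT leNgt; apply/negP => pp.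
set p := x + th *: (y - x) in Sp Op p0 pp.
have oU : open (O `&` [set z | 0 < psi z]).
  apply: openI => //; apply: (@open_comp _ _ psi [set t | 0 < t]); last exact: open_gt.
  by move=> z _; exact: cpsi.
have : nbhs th [set t : R | (O `&` [set z | 0 < psi z]) (x + t *: (y - x))].
  exact: (@line_continuous _ _ x (y - x) th _ (open_nbhs_nbhs (conj oU (conj Op pp)))).
move=> /nbhs_ballP[r /= r0 hr].
pose t := Num.min 1 (th + r / 2).
have tht : th < t by rewrite lt_min th1 ltrDl divr_gt0.
have t1 : t <= 1 by rewrite ge_min lexx.
apply: (hp t); first by rewrite tht.
have [|Ot pt] := hr t; last by split => //; exact: ltW.
rewrite /ball /= distrC ger0_norm ?subr_ge0 ?(ltW tht) // ltrBlDl.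
apply: (@le_lt_trans _ _ (th + r / 2)); first by rewrite ge_min lexx orbT.
by rewrite ltrD2l; lra.
Qed.

(** A solid point [x] near an outside point [y] is near an interface point, where some partial
    derivative has size 4c. Along the coordinate direction that lowers [psi], the slope stays below
    -c for a length rho. A path from [y] starts with [psi] negative and never enters the solid; one
    from [x], where [psi] is O(del), has left it after length L del. *)
Lemma solid_cone : exists rho L c : R, [/\ 0 < rho, 0 < L, 0 < c &
  forall x y del, S x -> ~ S y -> `|x - y| <= del -> del <= rho ->
  (exists j (b : bool), (-1) ^+ b * dpsi j x <= - c) /\
  (forall j (b : bool), (-1) ^+ b * dpsi j x <= - c ->
    (forall s, 0 <= s <= rho -> ~ S (y + (s * (-1) ^+ b) *: e_ j)) /\
    (forall s, L * del < s <= rho -> ~ S (x + (s * (-1) ^+ b) *: e_ j)))].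
Proof.
have [rho [c [C [rho0 c0 C0 unif]]]] := level_uniform.
have n0 : 0 <= n%:R :> R by [].
(* [psi x] is at most C n del and decreases at rate c, whence L; n + 1 instead of n keeps L
   positive. The 3c is the 4c at the interface point minus an oscillation c. *)
exists rho, (C * (n%:R + 1) / c), (3 * c); split => //.
- by rewrite divr_gt0 // mulr_gt0 // ltr_pwDr.
- by rewrite mulr_gt0.
move=> x y del Sx nSy xy delrho.
have [p [Gp xp yp]] := solid_crossing Sx nSy.
have {}xp := le_trans xp xy; have {}yp := le_trans yp xy.
have [[j0 hj0] near_p] := unif p Gp.
have [Ox hx] := near_p x (ltac:(lra)).
split.
  exists j0; have [hx1 _] := hx j0.
  have [d0|d0] := leP 0 (dpsi j0 p).
    exists true; rewrite expr1 mulN1r.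
    by move: hj0 hx1; rewrite ger0_norm // ler_norml => ? /andP[]; lra.
  exists false; rewrite expr0 mul1r.
  by move: hj0 hx1; rewrite ltr0_norm // ler_norml => ? /andP[]; lra.
move=> j b; set sg := (-1) ^+ b => hb.
have sg1 : `|sg| = 1 by rewrite /sg normrX normrN1 expr1n.
(* The slope at the mean value point is at most -3c + c + c: its value at [x], plus the oscillations
   from [x] to [p] and from [p] to that point. *)
have step z s : `|z - p| <= rho -> 0 <= s <= rho ->
    psi (z + (s * sg) *: e_ j) <= psi z - c * s /\ O (z + (s * sg) *: e_ j).
  move=> zp /andP[s0 srho].
  have line th : 0 <= th <= 1 -> `|z + (th * (s * sg)) *: e_ j - p| <= 4 * rho.
    move=> /andP[th0 th1]; rewrite addrAC; apply: le_trans (ler_normD _ _) _.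
    have -> : 4 * rho = rho + 3 * rho by ring.
    apply: lerD => //; rewrite normrZ !normrM sg1 mulr1 (ger0_norm th0) (ger0_norm s0).
    have e1 : `|e_ j| <= 1.
      apply: norm_le_coord => // i; rewrite mxE eqxx /=.
      by case: eqP; rewrite ?normr1 ?normr0.
    apply: (@le_trans _ _ (th * s)).
      by rewrite ler_piMr // mulr_ge0.
    by apply: (@le_trans _ _ s); [rewrite ler_piMl | lra].
  split; last first.
    have := line 1; rewrite mul1r ler01 lexx => /(_ isT) h1.
    by have [] := near_p _ h1.
  have [th th01 E] := mvt_line Dpsi z j (s * sg).
  have [_ /(_ j) [hz _]] := near_p _ (line th th01).
  have [hxj _] := hx j.
  set D := dpsi j (z + _) in E hz.
  have hD : sg * D <= - c.
    have h1 : sg * (D - dpsi j p) <= c.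
      by apply: le_trans hz; rewrite -[leRHS]mul1r -sg1 -normrM ler_norm.
    have h2 : sg * (dpsi j p - dpsi j x) <= c.
      by apply: le_trans hxj; rewrite distrC -[leRHS]mul1r -sg1 -normrM ler_norm.
    by move: h1 h2; rewrite !mulrBr; lra.
  rewrite -lerBlDl in E *.
  rewrite -(subrK (psi z) (psi (z + _))) E.
  have : s * (sg * D) <= s * (- c) by rewrite ler_wpM2l.
  by rewrite mulrA; lra.
have [Oy _] := near_p y (ltac:(lra)).
have psiy : psi y < 0 by rewrite ltNge; apply/negP => py; apply: nSy.
split => s sr.
  have [h1 _] := step y s (ltac:(lra)) sr.
  move=> [_]; rewrite leNgt => /negP; apply.
  apply: le_lt_trans h1 _; have /andP[s0 _] := sr.
  have : 0 <= c * s by rewrite mulr_ge0 // ltW.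
  lra.
move: sr => /andP[Ls srho].
have del0 : 0 <= del by exact: le_trans (normr_ge0 _) xy.
have s0 : 0 <= s.
  apply: le_trans (ltW Ls); apply: mulr_ge0 => //; apply: divr_ge0; last exact: ltW.
  by apply: mulr_ge0; [exact: ltW | exact: addr_ge0].
have [h1 _] := step x s (ltac:(lra)) (ltac:(by rewrite s0)).
move=> [_]; rewrite leNgt => /negP; apply; apply: le_lt_trans h1 _.
have hC : forall z, `|z - p| <= rho -> forall i, `|dpsi i z| <= C.
  by move=> z zp i; have [_ /(_ i)[]] := near_p z (ltac:(lra)).
have lip := partial_lipschitz Dpsi hC (ltac:(by rewrite subrr normr0 ltW) : `|p - p| <= rho)
  (ltac:(lra) : `|x - p| <= rho).
have sumle : \sum_i `|x 0 i - p 0 i| <= n%:R * del.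
  rewrite (_ : n%:R * del = \sum_(i < n) del); last first.
    by rewrite sumr_const card_ord mulr_natl.
  apply: ler_sum => i _; apply: le_trans xp.
  by have := coord_le_norm (x - p) i; rewrite !mxE.
have psix : psi x <= C * (n%:R * del).
  have [_ p0] := Gp; rewrite p0 subr0 in lip.
  apply: le_trans (ler_norm _) _; apply: le_trans lip _.
  by rewrite ler_wpM2l // ltW.
rewrite subr_lt0; apply: le_lt_trans psix _.
have : C * (n%:R + 1) * del < c * s.
  by move: Ls; rewrite mulrAC ltr_pdivrMr // [s * c]mulrC.
apply: le_lt_trans; rewrite -mulrA; apply: ler_wpM2l; first exact: ltW.
by rewrite mulrDl mul1r lerDl.
Qed.

End SolidGeometry.

Section EuclideanDistance.
Context {R : realType} {n : nat}.
Local Notation V := 'rV[R]_n.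

Lemma dotv_sub_scale (x y : V) (a b : R) :
  dotv (a *: x - b *: y) (a *: x - b *: y) =
  a ^+ 2 * dotv x x - 2 * (a * b) * dotv x y + b ^+ 2 * dotv y y.
Proof.
rewrite /dotv !mulr_sumr -sumrB -big_split /=; apply: eq_bigr => i _.
by rewrite !mxE; ring.
Qed.

Lemma enorm_eq0 (x : V) : enorm x = 0 -> x = 0.
Proof.
move=> x0; apply/rowP => i; rewrite mxE; apply/eqP.
by rewrite -normr_le0 -x0; exact: coord_le_enorm.
Qed.

Lemma dotv_le_enorm (x y : V) : dotv x y <= enorm x * enorm y.
Proof.
have [x0|x0] := eqVneq (enorm x) 0.
  rewrite x0 mul0r (enorm_eq0 x0) /dotv big1 // => i _.
  by rewrite mxE mul0r.
have [y0|y0] := eqVneq (enorm y) 0.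
  rewrite y0 mulr0 (enorm_eq0 y0) /dotv big1 // => i _.
  by rewrite mxE mulr0.
have p : 0 < enorm x * enorm y by rewrite mulr_gt0 // lt_neqAle eq_sym ?x0 ?y0 enorm_ge0.
have := dotv_ge0 (enorm y *: x - enorm x *: y).
rewrite dotv_sub_scale -!enorm_sqr => h.
rewrite -(ler_pM2l p); move: h.
set s := enorm x; set t := enorm y; set u := dotv x y; nra.
Qed.

Lemma enormD (x y : V) : enorm (x + y) <= enorm x + enorm y.
Proof.
rewrite -(@ger0_norm _ (enorm x + enorm y)) ?addr_ge0 ?enorm_ge0//.
rewrite -sqrtr_sqr; apply: ler_wsqrtr.
have -> : dotv (x + y) (x + y) = enorm x ^+ 2 + 2 * dotv x y + enorm y ^+ 2.
  rewrite !enorm_sqr /dotv mulr_sumr -!big_split /=; apply: eq_bigr => i _.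
  by rewrite !mxE; ring.
by have := dotv_le_enorm x y; lra.
Qed.

(** The bulk is open, so the infimum need not be attained; the distance bound is used through all s
    > r. *)
Lemma dist_leP (x : V) (A : set V) (r : R) :
  (dist x A <= r%:E)%E <->
  forall s, r < s -> exists2 y, A y & enorm (x - y) < s.
Proof.
split=> [h s rs|h].
  have : (dist x A < s%:E)%E by apply: le_lt_trans h _; rewrite lte_fin.
  by move=> /ereal_inf_lt[_ [y Ay <-]]; rewrite lte_fin => ys; exists y.
apply/lee_addgt0Pr => e e0.
have [y Ay ys] := h (r + e) (ltac:(by rewrite ltrDl)).
apply: (@le_trans _ _ (enorm (x - y))%:E); last by rewrite -EFinD lee_fin ltW.
by apply: ereal_inf_lbound; exists y.
Qed.

Lemma dist_le_closed (A : set V) (r : R) : closed [set x | (dist x A <= r%:E)%E].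
Proof.
move=> x /= hx; apply/dist_leP => s rs.
have e0 : 0 < (s - r) / 2 / (n%:R + 1) by rewrite !divr_gt0 ?subr_gt0 ?ltr_pwDr.
have [z [/dist_leP hz]] := hx _ (nbhsx_ballx x _ e0).
rewrite mx_norm_ball /ball_ /= => xz.
have [y Ay zy] := hz (r + (s - r) / 2) (ltac:(lra)).
exists y => //.
rewrite -(subrKA z); apply: le_lt_trans (enormD _ _) _.
have : enorm (x - z) <= (s - r) / 2.
  apply: le_trans (enorm_le_norm _) _.
  apply: (@le_trans _ _ ((n%:R + 1) * `|x - z|)).
    by rewrite ler_wpM2r // lerDl.
  by rewrite mulrC -ler_pdivlMr ?ltr_pwDr // ltW.
by move: zy; lra.
Qed.

End EuclideanDistance.

(** * The initial geometry of the problem *)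

Section ProblemFacts.
Context {R : realType} {d : nat} (P : problem R d).
Local Notation V := 'rV[R]_d.
Local Notation e_ j := (delta_mx 0 j : V).
Hypothesis hP : continuous_problem P.

Let md : moving_domain P. Proof. by case: hP. Qed.

Lemma tend_gt0 : 0 < tend P. Proof. by case: md. Qed.

Lemma Otilde_open : open (Otilde P). Proof. by case: md => -[]. Qed.

Lemma Iclosed0 : Iclosed P 0.
Proof. by rewrite /Iclosed /= lexx ltW // tend_gt0. Qed.

(** The slice at time 0, through which [phi P 0] inherits its regularity from the smoothness of
    [phi] in space-time. *)
Definition at0 (x : V) : 'rV[R]_(1 + d) := row_mx 0 x.

Lemma stfun_at0 (x : V) : stfun (phi P) (at0 x) = phi P 0 x.
Proof. by rewrite /stfun /at0 row_mxKl row_mxKr mxE. Qed.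

Lemma at0_continuous : continuous at0.
Proof.
move=> x A /nbhs_ballP[e /= e0 eA]; apply/nbhs_ballP; exists e => //= y.
rewrite mx_norm_ball /ball_ /= => xy; apply: eA; rewrite mx_norm_ball /ball_ /=.
apply: le_lt_trans xy; rewrite /at0 opp_row_mx add_row_mx subrr.
apply: norm_le_coord => // i; case: (split_ordP i) => k ->.
  by rewrite row_mxEl mxE normr0.
by rewrite row_mxEr coord_le_norm.
Qed.

Let sm1 : Ck 1 (stfun (phi P)). Proof. by case: md => _ _ h _; exact: h. Qed.

Lemma at0_growth j (x : V) :
  (fun h : R => h^-1 *: (phi P 0 (h *: e_ j + x) - phi P 0 x)) =
  (fun h : R => h^-1 *: (stfun (phi P) (h *: delta_mx 0 (rshift 1 j) + at0 x) -
     stfun (phi P) (at0 x))).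
Proof.
apply/funext => h; rewrite -!stfun_at0; congr (_ *: (stfun _ _ - _)).
have -> : delta_mx 0 (rshift 1 j) = at0 (e_ j).
  apply/rowP => i; rewrite mxE eqxx /=; case: (split_ordP i) => l ->.
    by rewrite eq_lrshift row_mxEl mxE.
  by rewrite eq_rshift row_mxEr mxE eqxx.
by rewrite /at0 scale_row_mx add_row_mx scaler0 addr0.
Qed.

Lemma phi0_derive j x : is_derive x (e_ j) (phi P 0) (partial j (phi P 0) x).
Proof.
have [_ /(_ (rshift 1 j))[D _]] := sm1.
apply: DeriveDef => //; rewrite /derivable at0_growth; exact: D.
Qed.

Lemma phi0_partial_continuous j : continuous (partial j (phi P 0)).
Proof.
have [_ /(_ (rshift 1 j))[_ /= C]] := sm1.
have -> : partial j (phi P 0) = partial (rshift 1 j) (stfun (phi P)) \o at0.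
  by apply/funext => x; rewrite /partial /derive /= at0_growth.
by move=> x; apply: continuous_comp; [exact: at0_continuous | exact: C].
Qed.

Lemma phi0_continuous : continuous (phi P 0).
Proof.
have [C _] := sm1.
have -> : phi P 0 = stfun (phi P) \o at0 by apply/funext => x; rewrite /= stfun_at0.
by move=> x; apply: continuous_comp; [exact: at0_continuous | exact: C].
Qed.

Definition solid : set V := [set x | Otilde P x /\ 0 <= phi P 0 x].

(** The conclusion of [solid_cone] for [phi P 0], isolated so that one triple of constants serves
    all displacements. *)
Definition exit_cone (rho L c1 : R) : Prop :=
  forall x y del, solid x -> ~ solid y -> `|x - y| <= del -> del <= rho ->
  (exists j (b : bool), (-1) ^+ b * partial j (phi P 0) x <= - c1) /\
  (forall j (b : bool), (-1) ^+ b * partial j (phi P 0) x <= - c1 ->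
    (forall s, 0 <= s <= rho -> ~ solid (y + (s * (-1) ^+ b) *: e_ j)) /\
    (forall s, L * del < s <= rho -> ~ solid (x + (s * (-1) ^+ b) *: e_ j))).

Lemma solidE : Sig P 0 `|` Gam P 0 = solid.
Proof.
apply/seteqP; split => x.
  by move=> [[Ox h]|[Ox h]]; split => //; [exact: ltW | rewrite h].
by move=> [Ox]; rewrite le_eqVlt => /orP[/eqP h|h]; [right|left].
Qed.

Lemma bounded_Otilde : exists2 M : R, 0 <= M & forall x, Otilde P x -> `|x| <= M.
Proof.
have [[_ [M [_ hM]]] _ _ _] := md.
exists (`|M| + 1) => [|x Ox]; first by rewrite addr_ge0.
by apply: hM => //; apply: le_lt_trans (ler_norm M) _; rewrite ltrDl.
Qed.

(** Since the boundary of [Sig P 0] is [Gam P 0], the solid is the closure of [Sig P 0]. So it is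
    closed in the whole space and stays off the outer boundary, although the level set condition is
    imposed only inside the open [Otilde]. *)
Lemma solid_compact : compact solid.
Proof.
apply: bounded_closed_compact.
  have [M M0 hM] := bounded_Otilde; exists M; split; first exact: num_real.
  by move=> t Mt x [/hM xM _]; apply: le_trans xM (ltW Mt).
have [_ _ _ /(_ 0 Iclosed0)[_ bS _ _ _]] := md.
have oS : open (Sig P 0).
  apply: openI; first exact: Otilde_open.
  apply: (@open_comp _ _ (phi P 0) [set t | 0 < t]); last exact: open_gt.
  by move=> x _; exact: phi0_continuous.
rewrite -solidE -bS /boundary.
have /interior_id -> := oS.
have -> : Sig P 0 `|` closure (Sig P 0) `\` Sig P 0 = closure (Sig P 0).
  apply/seteqP; split => x; first by move=> [/subset_closure|[]].
  by move=> cx; have [Sx|Sx] := pselect (Sig P 0 x); [left|right].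
exact: closed_closure.
Qed.

Lemma gradG0 x : (Otilde P x /\ phi P 0 x = 0) -> exists j, partial j (phi P 0) x != 0.
Proof.
move=> Gx; have [_ _ _ /(_ 0 Iclosed0)[_ _ /(_ x Gx) gx _ _]] := md.
apply: contrapT => /forallNP h; move/eqP: gx; apply; apply/rowP => j.
by rewrite !mxE; apply/eqP/negPn/negP; exact: h.
Qed.

Lemma Otilde_elem (T : mesh R d) : simplicial_mesh T (Otilde P) ->
  forall x, Otilde P x -> exists e : 'I_(nel T), elem e x.
Proof.
move=> [_ _ _ U] x /subset_closure; rewrite -U => -[e _ ex]; by exists e.
Qed.

Lemma SigGamD c : SigD P c `|` GamD P c = translate c solid.
Proof. by rewrite -solidE /SigD /GamD /translate image_setU. Qed.

Lemma OmDE c : OmD P c = Otilde P `\` translate c solid.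
Proof. by rewrite /OmD SigGamD. Qed.

Lemma subr_continuous (c : V) : continuous (fun x : V => x - c).
Proof.
move=> x; apply: (@continuousB _ _ _ (fun y : V => y) (fun=> c)).
  exact: cvg_id.
exact: cst_continuous.
Qed.

Lemma translate_solid_closed c : closed (translate c solid).
Proof.
rewrite translate_preimage.
apply: (@closed_comp _ _ (fun x : V => x - c) solid); last first.
  by apply: compact_closed; [exact: norm_hausdorff | exact: solid_compact].
by move=> x _; exact: subr_continuous.
Qed.

Lemma OmD_open c : open (OmD P c).
Proof.
rewrite OmDE setDE; apply: openI; first exact: Otilde_open.
exact/closed_openC/translate_solid_closed.
Qed.

End ProblemFacts.

(** * Geometry of the strip around a displaced bulk domain *)

Section StripGeometry.
Context {R : realType} {d : nat} (P : problem R d) (T : mesh R d).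
Local Notation V := 'rV[R]_d.
Local Notation e_ j := (delta_mx 0 j : V).
Variables (k : nat) (r : R) (c : V) (v : V -> V).
Hypotheses (hP : continuous_problem P) (hT : simplicial_mesh T (Otilde P))
  (r0 : 0 <= r) (hc : admissible P c) (hv : Vh P T k r c v).

Definition near_bulk : set V := [set x | (dist x (OmD P c) <= r%:E)%E].
Definition band : set V := translate c (solid P) `&` near_bulk.
(** Unlike [strip] it is not restricted to [Otilde] and is closed: a segment leaving [Otilde] can be
    followed up to its first outer point, where [v] vanishes. *)
Definition closed_strip : set V := Oact P T r c `&` near_bulk.

Lemma solid_sub_Otilde : translate c (solid P) `<=` Otilde P.
Proof. by rewrite -SigGamD. Qed.

Lemma OmD_near_bulk : OmD P c `<=` near_bulk.
Proof.
move=> x Ox; apply/dist_leP => s rs; exists x => //.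
by rewrite subrr /enorm /dotv big1 ?sqrtr0 ?(le_lt_trans r0) // => i _; rewrite mxE mul0r.
Qed.

Lemma strip_sub_Oact : strip P r (OmD P c) `<=` Oact P T r c.
Proof.
move=> x [Ox nx]; have [e ex] := Otilde_elem hT Ox.
by exists e => //; exists x.
Qed.

Lemma OmD_sub_Oact : OmD P c `<=` Oact P T r c.
Proof.
by move=> x Ox; apply: strip_sub_Oact; split; [case: Ox | exact: OmD_near_bulk].
Qed.

Lemma strip_split : strip P r (OmD P c) = OmD P c `|` band.
Proof.
apply/seteqP; split => x.
  move=> [Ox nx]; have [Sx|Sx] := pselect (translate c (solid P) x).
    by right.
  by left; rewrite OmDE.
move=> [Ox|[Sx nx]]; last by split => //; exact: solid_sub_Otilde.
by split; [case: Ox | exact: OmD_near_bulk].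
Qed.

Lemma OmD_band_disjoint x : OmD P c x -> band x -> False.
Proof. by rewrite OmDE => -[_ h] [/h]. Qed.

(** Elements lie in the closure of [Otilde], so such a point is on the outer boundary, where the
    space prescribes 0. *)
Lemma closed_strip_outer x : closed_strip x -> ~ Otilde P x -> v x = 0.
Proof.
move=> [Ax nx] nOx; have [_] := hv; apply => //.
split; last by move=> /interior_subset.
have [_ _ _ <-] := hT; have [e _ ex] := Ax; by exists e.
Qed.

Lemma closed_strip_closed : closed closed_strip.
Proof. by apply: closedI; [exact: (patch_closed hT) | exact: dist_le_closed]. Qed.

Lemma band_closed : closed band.
Proof. by apply: closedI; [exact: translate_solid_closed | exact: dist_le_closed]. Qed.

Section Cone.
Variables (rho L c1 : R).
Hypotheses (rho0 : 0 < rho) (L0 : 0 < L) (rrho : r < rho) (Lr : L * r < rho / 2).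
Hypothesis cone : exit_cone P rho L c1.

Definition band_piece (j : 'I_d) (b : bool) : set V :=
  band `&` [set x | (-1) ^+ b * partial j (phi P 0) (x - c) <= - c1].

Definition bdir (j : 'I_d) (b : bool) : V := (-1) ^+ b *: e_ j.

Lemma translate_solidP x : translate c (solid P) x <-> solid P (x - c).
Proof. by rewrite translate_preimage. Qed.

Lemma band_near x del : band x -> r < del ->
  exists y, [/\ OmD P c y, ~ solid P (y - c), enorm (x - y) < del &
    `|(x - c) - (y - c)| <= del].
Proof.
move=> [_ /dist_leP h] rd; have [y Oy xy] := h _ rd; exists y; split => //.
  by move: Oy; rewrite OmDE => -[_ h']; rewrite -translate_solidP.
rewrite opprB addrA subrK; apply: le_trans (norm_le_enorm _) _; exact: ltW.
Qed.

Lemma band_cover : band `<=` \bigcup_(p in [set: 'I_d * bool]) band_piece p.1 p.2.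
Proof.
move=> x bx; have [y [_ nSy _ xy]] := band_near bx rrho.
have Sx : solid P (x - c) by apply/translate_solidP; case: bx.
by have [[j [b hb]] _] := cone Sx nSy xy (lexx _); exists (j, b).
Qed.

Lemma band_piece_closed j b : closed (band_piece j b).
Proof.
apply: closedI; first exact: band_closed.
apply: (@closed_comp _ _ (fun x : V => (-1) ^+ b * partial j (phi P 0) (x - c)) [set t | t <= - c1]);
  last exact: closed_le.
move=> x _; apply: (@continuousM _ _ (fun _ : V => (-1) ^+ b)
  (fun x : V => partial j (phi P 0) (x - c))); first exact: cst_continuous.
apply: (@continuous_comp _ _ _ (fun x : V => x - c) (partial j (phi P 0))).
  exact: subr_continuous.
exact: phi0_partial_continuous.
Qed.

Lemma shiftE (x : V) j b s : x + s *: bdir j b - c = (x - c) + (s * (-1) ^+ b) *: e_ j.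
Proof. by rewrite /bdir scalerA addrAC. Qed.

Lemma band_piece_exit j b x s : band_piece j b x -> L * r < s <= rho ->
  ~ translate c (solid P) (x + s *: bdir j b).
Proof.
move=> [bx hx] /andP[Ls srho].
(* Strictly between [r] and s/L: a bulk point closer than [del] exists, and L del is still below
   s. *)
pose del := Num.min rho ((r + s / L) / 2).
have rs : r < s / L by rewrite ltr_pdivlMr // mulrC.
have rd : r < del by rewrite lt_min rrho /=; lra.
have [y [_ nSy _ xy]] := band_near bx rd.
have Sx : solid P (x - c) by apply/translate_solidP; case: bx.
have [|_ /(_ j b hx)[_ h2]] := cone Sx nSy xy; first by rewrite /del ge_min lexx.
rewrite translate_solidP shiftE; apply: h2.
rewrite srho andbT mulrC -ltr_pdivlMr // /del gt_min; apply/orP; right; lra.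
Qed.

(** Shift the nearby bulk point [y] along with [x]; by the cone it does not enter the solid, but it
    may leave [Otilde]. Hence the bulk point is taken just after the segment from the shifted [x] to
    the shifted [y] leaves the solid, which happens inside [Otilde]. *)
Lemma band_piece_near j b x s : band_piece j b x -> 0 <= s <= rho ->
  Otilde P (x + s *: bdir j b) -> near_bulk (x + s *: bdir j b).
Proof.
move=> [bx hx] srho Ox; set z : V := x + s *: bdir j b.
have [Sz|Sz] := pselect (translate c (solid P) z); last first.
  by apply: OmD_near_bulk; rewrite OmDE.
apply/dist_leP => del' rdel'.
pose del := Num.min rho ((r + del') / 2).
have rd : r < del by rewrite lt_min rrho /=; lra.
have deldel' : del < del' by rewrite gt_min; apply/orP; right; lra.
have [y [_ nSy xye xy]] := band_near bx rd.
have Sx : solid P (x - c) by apply/translate_solidP; case: bx.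
have [|_ /(_ j b hx)[h1 _]] := cone Sx nSy xy; first by rewrite /del ge_min lexx.
have nSy' : ~ translate c (solid P) (y + s *: bdir j b).
  by rewrite translate_solidP shiftE; exact: h1.
have clS : closed (translate c (solid P)) by exact: translate_solid_closed.
have [th [/andP[th0 th1] Sp hp]] := last_exit clS Sz nSy'.
pose w : V := y + s *: bdir j b - z.
have wE : w = y - x by rewrite /w /z opprD addrACA subrr addr0.
have Op := solid_sub_Otilde Sp.
have nbO := @line_continuous R d z w th _ (open_nbhs_nbhs (conj (Otilde_open hP) Op)).
have [q /= q0 hq] := iffLR (nbhs_ballP _ _) nbO.
pose t := Num.min 1 (th + q / 2).
have tht : th < t by rewrite lt_min th1 ltrDl divr_gt0.
have t1 : t <= 1 by rewrite ge_min lexx.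
exists (z + t *: w).
  rewrite OmDE; split; last by apply: hp; rewrite tht.
  apply: (hq t); rewrite /ball /= distrC ger0_norm ?subr_ge0 ?(ltW tht) // ltrBlDl.
  apply: (@le_lt_trans _ _ (th + q / 2)); first by rewrite ge_min lexx orbT.
  by rewrite ltrD2l; lra.
rewrite opprD addrA subrr sub0r enormN enormZ wE.
have t0 : 0 <= t by apply: le_trans th0 (ltW tht).
rewrite (ger0_norm t0); apply: le_lt_trans deldel'; apply/ltW.
apply: le_lt_trans xye; rewrite -[enorm (x - y)]enormN opprB.
by rewrite ler_piMl // enorm_ge0.
Qed.

(** If two parameters were further apart, the line starting at the first of the two points would
    have left the solid before reaching the second, by [band_piece_exit]. *)
Lemma band_piece_width j b y s s' : 0 <= s <= rho -> 0 <= s' <= rho ->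
  band_piece j b (y - s *: bdir j b) -> band_piece j b (y - s' *: bdir j b) ->
  `|s - s'| <= L * r.
Proof.
wlog ss' : s s' / s <= s'.
  move=> H hs hs' As As'; have [|/ltW] := leP s s'; first by move=> ?; exact: H.
  by move=> s's; rewrite distrC; exact: H.
move=> /andP[s0 sr] /andP[s'0 s'r] [[Ss _] _] As'.
rewrite distrC ger0_norm ?subr_ge0 // leNgt; apply/negP => lt.
apply: (band_piece_exit (s := s' - s) As'); first by rewrite lt /=; lra.
by rewrite scalerBl addrA subrK.
Qed.

End Cone.
End StripGeometry.

Section LineMeasurability.
Context {R : realType} {n : nat}.
Local Notation V := 'rV[R]_n.

Lemma line_measurable (x w : V) :
  measurable_fun [set: R] ((fun t : R => x + t *: w) : R -> borel R n).
Proof.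
apply: coord_measurable_borel => i.
apply: continuous_measurable_fun => t.
apply: (@continuous_comp _ _ _ (fun s : R => x + s *: w) (fun y : V => y 0 i)).
  exact: line_continuous.
exact: coord_continuous.
Qed.

Lemma indic_mul_borel (D : set V) (f : V -> R) :
  measurable (D : set (borel R n)) ->
  measurable_fun (D : set (borel R n)) (f : borel R n -> R) ->
  measurable_fun [set: borel R n] ((fun y => \1_D y * f y) : borel R n -> R).
Proof.
move=> mD mf.
have -> : (fun y => \1_D y * f y) = (f : borel R n -> R) \_ D.
  apply/funext => y; rewrite patchE indicE.
  by case: ifPn => h; rewrite ?mul1r ?mul0r.
exact: (iffLR (measurable_restrictT _ mD)) mf.
Qed.

Lemma dotv_continuous_within (A : set V) (u v : V -> V) :
  {within A, continuous u} -> {within A, continuous v} ->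
  {within A, continuous (fun y => dotv (u y) (v y))}.
Proof.
move=> cu cv x; rewrite /dotv.
have ci (w : V -> V) i : {within A, continuous w} -> {within A, continuous (fun y => w y 0 i)}.
  move=> cw y; apply: (@continuous_comp (subspace A) _ _ w (fun z : V => z 0 i)); first exact: cw.
  exact: coord_continuous.
have -> : (fun y => \sum_i u y 0 i * v y 0 i) = \sum_i ((fun y => u y 0 i) * (fun y => v y 0 i)).
  by apply/funext => y; rewrite fct_sumE.
elim/big_ind: _ => [|f g cf cg|i _].
- exact: cst_continuous.
- exact: continuousD.
- by apply: continuousM; exact: ci.
Qed.

End LineMeasurability.

(** * Variation of |v|^2 along a coordinate segment *)

Section LineEstimate.
Context {R : realType} {d : nat} (P : problem R d) (T : mesh R d).
Local Notation V := 'rV[R]_d.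
Local Notation e_ j := (delta_mx 0 j : V).
Variables (k : nat) (r : R) (c : V) (v : V -> V).

Definition fe_repr (p : 'I_(nel T) -> V -> V) (dp : 'I_(nel T) -> 'I_d -> 'I_d -> V -> R) :=
  forall e, [/\ forall i, polyfun (component (p e) i), forall i j, polyfun (dp e i j),
    forall i (y w : V), is_derive y w (component (p e) i) (\sum_j w 0 j * dp e i j y) &
    act P r c e -> forall x, elem e x -> v x = p e x].

Lemma fe_pieces : Vh P T k r c v ->
  exists (p : 'I_(nel T) -> V -> V) (dp : 'I_(nel T) -> 'I_d -> 'I_d -> V -> R),
  fe_repr p dp.
Proof.
move=> [[_ hv] _].
have h (e : 'I_(nel T)) : exists pd : (V -> V) * ('I_d -> 'I_d -> V -> R),
  [/\ forall i, polyfun (component pd.1 i), forall i j, polyfun (pd.2 i j),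
    forall i (y w : V), is_derive y w (component pd.1 i) (\sum_j w 0 j * pd.2 i j y) &
    act P r c e -> forall x, elem e x -> v x = pd.1 x].
  have [p pp hp] : exists2 p : V -> V, forall i, polyfun (component p i) &
      act P r c e -> forall x, elem e x -> v x = p x.
    have [ae|nae] := pselect (act P r c e); last first.
      exists (fun=> 0) => // i; rewrite /component.
      under eq_fun do rewrite mxE; exact: polyfun_cst.
    have [p pp hp] := hv e ae; exists p => // i.
    exact: is_poly_polyfun (pp i).
  have hd i := polyfun_derive (pp i).
  exists (p, fun i => sval (cid (hd i))); split => //= i.
    by case: (cid (hd i)) => /= q [].
  by case: (cid (hd i)) => /= q [].
have [F hF] := choice h.
by exists (fun e => (F e).1), (fun e => (F e).2).
Qed.

Variables (p : 'I_(nel T) -> V -> V) (dp : 'I_(nel T) -> 'I_d -> 'I_d -> V -> R).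
Hypotheses (hP : continuous_problem P) (hT : simplicial_mesh T (Otilde P))
  (r0 : 0 <= r) (hc : admissible P c) (hv : Vh P T k r c v).
Hypothesis pE : fe_repr p dp.
Variables (rho L c1 alpha : R).
Hypotheses (rho0 : 0 < rho) (L0 : 0 < L) (rrho : r < rho) (Lr : L * r < rho / 2)
  (alpha0 : 0 < alpha).
Hypothesis cone : exit_cone P rho L c1.

Definition sqgrad_piece e (y : V) : R := \sum_i \sum_l dp e i l y ^+ 2.

(** Dominates the derivative of |p|^2 along a signed coordinate direction; a large [alpha] shrinks
    the gradient part. *)
Definition young_piece e (y : V) : R :=
  alpha * dotv (p e y) (p e y) + alpha^-1 * sqgrad_piece e y.

Lemma dotv_piece_polyfun e : polyfun (fun y => dotv (p e y) (p e y)).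
Proof.
have [pp _ _ _] := pE e.
by apply: polyfun_sum => i; apply: polyfun_mul; exact: pp.
Qed.

Lemma sqgrad_piece_polyfun e : polyfun (sqgrad_piece e).
Proof.
have [_ pd _ _] := pE e.
by apply: polyfun_sum => i; apply: polyfun_sum => l; apply: polyfun_exp; exact: pd.
Qed.

Lemma sqgrad_piece_ge0 e y : 0 <= sqgrad_piece e y.
Proof. by apply: sumr_ge0 => i _; apply: sumr_ge0 => l _; exact: sqr_ge0. Qed.

Lemma young_piece_polyfun e : polyfun (young_piece e).
Proof.
apply: polyfun_add; apply: polyfun_mul; try exact: polyfun_cst.
  exact: dotv_piece_polyfun.
exact: sqgrad_piece_polyfun.
Qed.

Lemma young_piece_ge0 e y : 0 <= young_piece e y.
Proof.
by rewrite addr_ge0 // mulr_ge0 ?dotv_ge0 ?sqgrad_piece_ge0 // ?invr_ge0 ltW.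
Qed.

Lemma polyfun_borel (f : V -> R) : polyfun f ->
  measurable_fun [set: borel R d] (f : borel R d -> R).
Proof.
move=> pf; apply: continuous_measurable_borel => //.
by apply: continuous_subspaceT; exact: polyfun_continuous.
Qed.

Lemma polyfun_line_continuous (f : V -> R) (x w : V) : polyfun f ->
  continuous (fun t : R => f (x + t *: w)).
Proof.
move=> pf t; apply: (@continuous_comp _ _ _ (fun t : R => x + t *: w) f).
  exact: line_continuous.
exact: polyfun_continuous.
Qed.

Definition dsq_piece e (w : V) (y : V) : R :=
  \sum_i 2 * (p e y 0 i * \sum_l w 0 l * dp e i l y).

Lemma dsq_pieceP e (x w : V) (t : R) :
  is_derive t (1 : R) (fun t => dotv (p e (x + t *: w)) (p e (x + t *: w)))
    (dsq_piece e w (x + t *: w)).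
Proof.
have [_ _ Dp _] := pE e.
apply: (@is_derive_line _ _ (fun y => dotv (p e y) (p e y))).
set y := x + t *: w.
have -> : (fun y => dotv (p e y) (p e y)) =
    \sum_i (component (p e) i * component (p e) i).
  by apply/funext => z; rewrite fct_sumE.
apply: is_derive_sum => i; apply: is_derive_eq (is_deriveM (Dp i y w) (Dp i y w)) _.
by rewrite /GRing.scale /= mulr_natl mulr2n.
Qed.

Lemma dsq_piece_polyfun e w : polyfun (dsq_piece e w).
Proof.
have [pp pd _ _] := pE e.
apply: polyfun_sum => i; apply: polyfun_mul; first exact: polyfun_cst.
apply: polyfun_mul; first exact: pp.
by apply: polyfun_sum => l; apply: polyfun_mul; [exact: polyfun_cst | exact: pd].
Qed.

Lemma young_ineq (a b : R) : `|2 * (a * b)| <= alpha * (a * a) + alpha^-1 * b ^+ 2.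
Proof.
have h (u : R) : 2 * (u * b) <= alpha * (u * u) + alpha^-1 * b ^+ 2.
  rewrite -subr_ge0.
  have -> : alpha * (u * u) + alpha^-1 * b ^+ 2 - 2 * (u * b) =
      alpha^-1 * (alpha * u - b) ^+ 2 by field; rewrite gt_eqF.
  by rewrite mulr_ge0 ?sqr_ge0 // invr_ge0 ltW.
rewrite ler_norml h andbT; have := h (- a).
by rewrite mulrNN mulNr mulrN; lra.
Qed.

Lemma dsq_piece_le e j b y : `|dsq_piece e (bdir j b) y| <= young_piece e y.
Proof.
apply: le_trans (ler_norm_sum _ _ _) _.
rewrite /young_piece /dotv /sqgrad_piece !mulr_sumr -big_split /=.
apply: ler_sum => i _; apply: le_trans (young_ineq _ _) _.
rewrite lerD2l; apply: ler_wpM2l; first by rewrite invr_ge0 ltW.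
rewrite (bigD1 j) //= big1 ?addr0; last first.
  by move=> l /negbTE lj; rewrite !mxE lj andbF mulr0 mul0r.
rewrite !mxE !eqxx mulr1 exprMn -exprM mulnC exprM sqrrN !expr1n mul1r.
by rewrite (bigD1 j) //= lerDl; apply: sumr_ge0 => l _; exact: sqr_ge0.
Qed.

(** The cut-off to the closed strip matters: the term [alpha] |v|^2 can be absorbed in the strip
    norm, whereas the norm over all active elements is not controlled. *)
Definition strip_density (y : V) : R :=
  piecewise (act P r c) (fun e z => \1_(closed_strip P T r c) z * young_piece e z) y.

Lemma closed_strip_borel : measurable (closed_strip P T r c : set (borel R d)).
Proof. by apply: closed_borel; exact: closed_strip_closed. Qed.

Lemma strip_density_borel :
  measurable_fun [set: borel R d] (strip_density : borel R d -> R).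
Proof.
apply: (piecewise_borel hT) => e; apply: indic_mul_borel; first exact: closed_strip_borel.
apply: measurable_funTS; exact: polyfun_borel (young_piece_polyfun e).
Qed.

Lemma strip_density_ge0 y : 0 <= strip_density y.
Proof. by apply: piecewise_ge0 => e x; rewrite mulr_ge0 // young_piece_ge0. Qed.

Lemma segment_estimate j b x s : 0 <= s <= rho ->
  (forall t, 0 <= t <= s -> closed_strip P T r c (x + t *: bdir j b)) ->
  (`|dotv (v (x + s *: bdir j b)) (v (x + s *: bdir j b)) - dotv (v x) (v x)|%:E <=
   \int[lebesgue_measure]_(t in `[0%R, rho]) (strip_density (x + t *: bdir j b))%:E)%E.
Proof.
move=> /andP[s0 srho] inE_; set w := bdir j b.
pose Ls := [seq e <- index_enum 'I_(nel T) | `[< act P r c e >]].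
have LsP e : e \in Ls -> act P r c e by rewrite mem_filter => /andP[/asboolP].
pose C (e : 'I_(nel T)) : set R := [set t | elem e (x + t *: w)].
pose f t := dotv (v (x + t *: w)) (v (x + t *: w)).
have clC e : closed (C e).
  apply: (@closed_comp _ _ (fun t : R => x + t *: w) (elem e)).
    by move=> t _; exact: line_continuous.
  exact: elem_closed (mesh_indep hT) e.
have mC e : measurable (C e) by apply: closed_measurable.
have fE : forall e t, e \in Ls -> 0 <= t <= s -> C e t ->
    f t = dotv (p e (x + t *: w)) (p e (x + t *: w)).
  move=> e t /LsP ae _ Cet; have [_ _ _ /(_ ae _ Cet) vE] := pE e.
  by rewrite /f vE.
have H := @piecewise_ftc_le R _ Ls C
  (fun e t => dotv (p e (x + t *: w)) (p e (x + t *: w)))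
  (fun e t => dsq_piece e w (x + t *: w))
  (fun e t => young_piece e (x + t *: w)) f 0 s s0.
have {}H : (`|f s - f 0|%:E <= \sum_(e <- Ls)
    \int[lebesgue_measure]_(t in `[0%R, s] `&` C e) (young_piece e (x + t *: w))%:E)%E.
  apply: H => //.
  - by move=> e _ a b' ha hb t tab; exact: (elem_line_interval (mesh_indep hT) ha hb tab).
  - move=> t ts; have [[e ae ex] _] := inE_ t ts; exists e => //.
    by rewrite mem_filter mem_index_enum andbT; exact/asboolP.
  - by move=> e t _; exact: dsq_pieceP.
  - by move=> e _; exact: polyfun_line_continuous (dsq_piece_polyfun e w).
  - by move=> e _; exact: polyfun_line_continuous (young_piece_polyfun e).
  - by move=> e t _; exact: dsq_piece_le.
have f0E : f 0 = dotv (v x) (v x) by rewrite /f scale0r addr0.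
rewrite -f0E; apply: le_trans H _.
pose g (e : 'I_(nel T)) (y : V) := \1_(elem e) y * (\1_(closed_strip P T r c) y * young_piece e y).
have g0 e y : 0 <= g e y by rewrite !mulr_ge0 // young_piece_ge0.
have mg e : measurable_fun [set: R] (fun t : R => (g e (x + t *: w))%:E).
  apply/measurable_EFinP.
  apply: (measurableT_comp (f := (g e : borel R d -> R))); last exact: line_measurable.
  apply: indic_mul_borel; first exact: (elem_borel (mesh_indep hT)).
  apply: measurable_funTS; apply: indic_mul_borel; first exact: closed_strip_borel.
  by apply: measurable_funTS; exact: polyfun_borel (young_piece_polyfun e).
have -> : (\int[lebesgue_measure]_(t in `[0%R, rho]) (strip_density (x + t *: w))%:E =
    \sum_(e <- Ls) \int[lebesgue_measure]_(t in `[0%R, rho]) (g e (x + t *: w))%:E)%E.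
  rewrite -ge0_integral_sum //.
  - apply: eq_integral => t _; rewrite sumEFin; congr (_%:E).
    by rewrite /strip_density /piecewise -big_filter.
  - by move=> e; apply: measurable_funTS; exact: mg.
  - by move=> e t _; rewrite lee_fin.
rewrite big_seq [leRHS]big_seq; apply: lee_sum => e eL.
have sub : `[0%R, s]%classic `&` C e `<=` `[0%R, rho]%classic.
  move=> t [/=]; rewrite !in_itv /= => /andP[-> ts] _.
  exact: le_trans ts srho.
apply: (@le_trans _ _ (\int[lebesgue_measure]_(t in `[0%R, s] `&` C e) (g e (x + t *: w))%:E)%E).
  rewrite le_eqVlt; apply/orP; left; apply/eqP; apply: eq_integral => t.
  rewrite inE => -[/=]; rewrite in_itv /= => ts Cet; rewrite /g !indicE.
  by rewrite !mem_set ?mul1r //; exact: inE_.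
apply: ge0_subset_integral => //.
- by apply: measurableI => //; exact: mC.
- by apply: measurable_funTS; exact: mg.
- by move=> t _; rewrite lee_fin.
Qed.

End LineEstimate.

Lemma closed_halfopen {R : realType} (C : set R) (s : R) : closed C -> 0 < s ->
  (forall t, 0 <= t < s -> C t) -> C s.
Proof.
move=> cC s0 h; apply: contrapT => nCs.
have /nbhs_ballP[r /= r0 hr] := open_nbhs_nbhs (conj (closed_openC cC) nCs).
pose t := Num.max 0 (s - r / 2).
have ts : t < s by rewrite gt_max s0 /= ltrBlDr ltrDl divr_gt0.
have t0 : 0 <= t by rewrite le_max lexx.
apply: (hr t); last by apply: h; rewrite t0.
rewrite /ball /= ger0_norm ?subr_ge0 ?(ltW ts) // ltrBlDr -ltrBlDl.
by apply: (@lt_le_trans _ _ (s - r / 2)); [rewrite ltrD2l ltrN2; lra | rewrite le_max lexx orbT].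
Qed.

(** * Bounding |v|^2 in the band by an integral along a segment *)

Section BandIntegral.
Context {R : realType} {d : nat} (P : problem R d) (T : mesh R d).
Local Notation V := 'rV[R]_d.
Local Notation e_ j := (delta_mx 0 j : V).
Variables (k : nat) (r : R) (c : V) (v : V -> V).
Variables (p : 'I_(nel T) -> V -> V) (dp : 'I_(nel T) -> 'I_d -> 'I_d -> V -> R).
Hypotheses (hP : continuous_problem P) (hT : simplicial_mesh T (Otilde P)) (d0 : (0 < d)%N)
  (r0 : 0 <= r) (hc : admissible P c) (hv : Vh P T k r c v).
Hypothesis pE : fe_repr P r c v p dp.
Variables (rho L c1 alpha : R).
Hypotheses (rho0 : 0 < rho) (L0 : 0 < L) (rrho : r < rho) (Lr : L * r < rho / 2)
  (alpha0 : 0 < alpha).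
Hypothesis cone : exit_cone P rho L c1.

Let sq (y : V) : R := dotv (v y) (v y).

Let sq0 y : 0 <= sq y. Proof. exact: dotv_ge0. Qed.

Definition bulk_density (y : V) : R := \1_(OmD P c) y * sq y.

Let sdens := strip_density P r c p dp alpha.

Let Oact_borel : measurable (Oact P T r c : set (borel R d)).
Proof. exact: (patch_borel hT). Qed.

Let OmD_borel : measurable (OmD P c : set (borel R d)).
Proof. by apply: open_borel; exact: OmD_open. Qed.

Lemma sq_measurable_Oact :
  measurable_fun (Oact P T r c : set (borel R d)) (sq : borel R d -> R).
Proof.
apply: continuous_measurable_borel => //; apply: dotv_continuous_within;
  by case: hv => -[].
Qed.

Lemma bulk_density_borel :
  measurable_fun [set: borel R d] (bulk_density : borel R d -> R).
Proof.
apply: indic_mul_borel => //; apply: measurable_funS sq_measurable_Oact => //.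
exact: (OmD_sub_Oact hT r0).
Qed.

Let bulk0 y : 0 <= bulk_density y. Proof. by rewrite mulr_ge0. Qed.

Let sdens0 y : 0 <= sdens y. Proof. exact: (strip_density_ge0 _ _ _ _ _ alpha0). Qed.

Let msdens : measurable_fun [set: borel R d] (sdens : borel R d -> R).
Proof. exact: (strip_density_borel hT pE). Qed.

Definition total_density (y : V) : R := 2 / rho * bulk_density y + sdens y.

Lemma total_density_ge0 y : 0 <= total_density y.
Proof. by rewrite addr_ge0 // mulr_ge0 // divr_ge0 // ltW. Qed.

Lemma total_density_borel :
  measurable_fun [set: borel R d] (total_density : borel R d -> R).
Proof.
apply: measurable_funD => //; apply: measurable_funM => //.
exact: bulk_density_borel.
Qed.

(** If the segment leaves [Otilde], then v = 0 at its first outer point and the variation up to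
    there bounds |v(x)|^2. Otherwise its second half lies in the bulk, since L r < rho/2, and
    averaging over that half gives the factor 2/rho. *)
Lemma line_bound j b x : band_piece P r c c1 j b x ->
  ((sq x)%:E <= \int[lebesgue_measure]_(t in `[0%R, rho])
     (total_density (x + t *: bdir j b))%:E)%E.
Proof.
move=> Ax; set w := bdir j b.
have mline (f : V -> R) (D : set R) :
    measurable_fun [set: borel R d] (f : borel R d -> R) ->
    measurable_fun D (fun t : R => (f (x + t *: w))%:E).
  move=> mf; apply/measurable_EFinP; apply: measurable_funTS.
  by apply: (measurableT_comp (f := (f : borel R d -> R))); last exact: line_measurable.
set I2 : \bar R := (\int[lebesgue_measure]_(t in `[0%R, rho]) (sdens (x + t *: w))%:E)%E.
set I1 : \bar R := (\int[lebesgue_measure]_(t in `[0%R, rho]) (bulk_density (x + t *: w))%:E)%E.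
have I10 : (0 <= I1)%E by apply: integral_ge0 => t _; rewrite lee_fin.
have I20 : (0 <= I2)%E by apply: integral_ge0 => t _; rewrite lee_fin.
have -> : (\int[lebesgue_measure]_(t in `[0%R, rho]) (total_density (x + t *: w))%:E =
    (2 / rho)%:E * I1 + I2)%E.
  under eq_integral do rewrite EFinD EFinM.
  have c20 : 0 <= 2 / rho by rewrite divr_ge0 // ltW.
  rewrite ge0_integralD //.
  - rewrite ge0_integralZl_EFin //; first by move=> t _; rewrite lee_fin.
    by apply: mline; exact: bulk_density_borel.
  - by move=> t _; rewrite -EFinM lee_fin mulr_ge0.
  - by apply: measurable_funeM; apply: mline; exact: bulk_density_borel.
  - by move=> t _; rewrite lee_fin.
  - exact: mline.
have strip_in t : 0 <= t <= rho -> Otilde P (x + t *: w) -> closed_strip P T r c (x + t *: w).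
  move=> tr Ot; have nb := band_piece_near hP r0 hc rrho cone Ax tr Ot.
  by split => //; apply: (strip_sub_Oact hT).
have Ox : Otilde P x by apply: (solid_sub_Otilde hc); case: Ax => -[].
have [[t0 [t0r nOt0]]|noexit] := pselect (exists t, 0 <= t <= rho /\ ~ Otilde P (x + t *: w)).
  have clC : closed (~` Otilde P) by apply: open_closedC; exact: Otilde_open.
  have nCx : ~ (~` Otilde P) x by move=> /(_ Ox).
  (* The segment is run backwards from an outer point to [x], so the last outer parameter yields the
     first exit [s] seen from [x]. *)
  have [th [/andP[th0 th1] Cth hth]] := last_exit clC nOt0 nCx.
  pose s := (1 - th) * t0.
  have lineE u : x + t0 *: w + u *: (x - (x + t0 *: w)) = x + ((1 - u) * t0) *: w.
    by apply/rowP => i; rewrite !mxE; ring.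
  have /andP[t00 t0rho] := t0r.
  have t0n : 0 < t0.
    rewrite lt_neqAle t00 andbT; apply/eqP => E; apply: nOt0.
    by rewrite -E scale0r addr0.
  have s0 : 0 < s by rewrite mulr_gt0 // subr_gt0.
  have srho : s <= rho.
    by apply: le_trans t0rho; rewrite ler_piMl // gerBl.
  have before t : 0 <= t < s -> closed_strip P T r c (x + t *: w).
    move=> /andP[tt0 ts]; apply: strip_in; first by rewrite tt0 (le_trans (ltW ts)).
    have tE : t = (1 - (1 - t / t0)) * t0 by rewrite subKr divfK // gt_eqF.
    rewrite tE -lineE; apply: contrapT; apply: hth.
    rewrite gerBl divr_ge0 // andbT ltrBrDl -ltrBrDr ltr_pdivrMr //.
  have at_s : closed_strip P T r c (x + s *: w).
    apply: (@closed_halfopen _ [set t | closed_strip P T r c (x + t *: w)]) => //.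
    apply: (@closed_comp _ _ (fun t : R => x + t *: w)); last exact: closed_strip_closed.
    by move=> t _; exact: line_continuous.
  have vs0 : v (x + s *: w) = 0.
    apply: (closed_strip_outer hT hv at_s); rewrite -lineE; exact: Cth.
  have seg : (`|dotv (v (x + s *: w)) (v (x + s *: w)) - dotv (v x) (v x)|%:E <= I2)%E.
    apply: (segment_estimate hT pE alpha0); first by rewrite (ltW s0).
    move=> t /andP[tt0]; rewrite le_eqVlt => /orP[/eqP ->//|ts].
    by apply: before; rewrite tt0.
  have dv0 : dotv (0 : V) 0 = 0 by rewrite /dotv big1 // => i _; rewrite mxE mul0r.
  rewrite vs0 dv0 sub0r normrN ger0_norm in seg; last exact: sq0.
  apply: le_trans seg _; apply: leeDr; apply: mule_ge0 => //.
  by rewrite lee_fin divr_ge0 // ltW.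
have allO t : 0 <= t <= rho -> Otilde P (x + t *: w).
  by move=> tr; apply: contrapT => nO; apply: noexit; exists t.
have [I2y|I2n] := eqVneq I2 +oo%E.
  by rewrite I2y addey ?leey // gt_eqF // (lt_le_trans (ltNyr 0)) // mule_ge0 // lee_fin divr_ge0 // ltW.
have I2fin : I2 \is a fin_num by rewrite ge0_fin_numE // ltey.
(* [a] is a lower bound for |v|^2 at every point of the second half; it may be negative, a case
   treated separately. *)
pose a := sq x - fine I2.
have key s : rho / 2 <= s <= rho -> a <= bulk_density (x + s *: w).
  move=> /andP[s1 s2].
  have s00 : 0 <= s by apply: le_trans s1; rewrite divr_ge0 // ltW.
  have seg : (`|dotv (v (x + s *: w)) (v (x + s *: w)) - dotv (v x) (v x)|%:E <= I2)%E.
    apply: (segment_estimate hT pE alpha0); first by rewrite s00.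
    move=> t /andP[tt0 ts]; have tr : 0 <= t <= rho by rewrite tt0 (le_trans ts).
    by apply: strip_in => //; exact: allO.
  rewrite -(fineK I2fin) lee_fin distrC in seg.
  have inOm : OmD P c (x + s *: w).
    rewrite OmDE; split; first by apply: allO; rewrite s00.
    apply: (band_piece_exit L0 rrho cone Ax); rewrite s2 andbT.
    exact: lt_le_trans Lr s1.
  rewrite /bulk_density indicE mem_set // mul1r /a.
  have := le_trans (ler_norm _) seg; rewrite -/(sq x) -/(sq (x + s *: w)); lra.
suff h : (a%:E <= (2 / rho)%:E * I1)%E.
  have -> : sq x = a + fine I2 by rewrite /a subrK.
  by rewrite EFinD fineK //; apply: leeD.
have [a0|a0] := ltP a 0.
  apply: (@le_trans _ _ 0%E); first by rewrite lee_fin ltW.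
  by apply: mule_ge0 => //; rewrite lee_fin divr_ge0 // ltW.
have h2 : ((a * (rho / 2))%:E <= I1)%E.
  apply: (@le_trans _ _ (\int[lebesgue_measure]_(t in `[(rho / 2)%R, rho]) a%:E)%E).
    rewrite integral_cst //= lebesgue_measure_itv /= lte_fin ifT; last first.
      by rewrite ltr_pdivrMr // ltr_pMr // ltr1n.
    by rewrite -EFinB -EFinM lee_fin; apply: ler_wpM2l => //; lra.
  apply: (@le_trans _ _ (\int[lebesgue_measure]_(t in `[(rho / 2)%R, rho]) (bulk_density (x + t *: w))%:E)%E).
    apply: ge0_le_integral => //.
    by apply: mline; exact: bulk_density_borel.
  apply: ge0_subset_integral => //.
  - by apply: mline; exact: bulk_density_borel.
  - by move=> t _; rewrite lee_fin.
  - move=> t /=; rewrite !in_itv /= => /andP[t1 ->]; rewrite andbT.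
    by apply: le_trans t1; rewrite divr_ge0 // ltW.
have -> : a%:E = ((2 / rho)%:E * (a * (rho / 2))%:E)%E.
  by rewrite -EFinM; congr (_%:E); field; rewrite gt_eqF.
by apply: lee_wpmul2l => //; rewrite lee_fin divr_ge0 // ltW.
Qed.

End BandIntegral.

Section IntegralTools.
Context {R : realType} {n : nat}.
Local Notation V := 'rV[R]_n.
Local Open Scope ereal_scope.

Lemma line_integral_measurable (H : V -> R) (e : V) (rho : R) :
  measurable_fun [set: borel R n] (H : borel R n -> R) -> (forall x, (0 <= H x)%R) ->
  measurable_fun [set: borel R n] ((fun x : V => \int[lebesgue_measure]_(s in `[0%R, rho])
     (H (x + s *: e)%R)%:E) : borel R n -> \bar R).
Proof.
move=> mH H0.
pose I : set R := `[0%R, rho]%classic.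
pose f (p : borel R n * measurableTypeR R) : \bar R :=
  (\1_I p.2 * H (p.1 + p.2 *: e))%:E.
have mI : measurable_fun [set: measurableTypeR R] (\1_I : R -> R).
  by apply: measurable_indic; exact: measurable_itv.
have ml : measurable_fun [set: borel R n * measurableTypeR R]
    ((fun p => p.1 + p.2 *: e)%R : _ -> borel R n).
  apply: coord_measurable_borel => i.
  rewrite (_ : (fun t => _) = (fun t : borel R n * measurableTypeR R =>
     (t.1 : V) 0%R i + t.2 * e 0%R i)%R); last first.
    by apply/funext => t; rewrite !mxE.
  apply: measurable_funD; last by apply: measurable_funM.
  apply: (measurableT_comp (f := (fun x : V => x 0%R i) : borel R n -> R)) => //.
  by apply: polyfun_borel; exact: polyfun_coord.
have mf : measurable_fun setT f.
  apply/measurable_EFinP; apply: measurable_funM; first exact: (measurableT_comp mI).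
  exact: (measurableT_comp mH).
have f0 p : 0 <= f p by rewrite lee_fin mulr_ge0.
have := @measurable_fun_fubini_tonelli_F _ _ (borel R n) (measurableTypeR R) R
  lebesgue_measure f mf f0.
congr (measurable_fun _ _); apply/funext => x; rewrite /fubini_F [RHS]integral_mkcond.
apply: eq_integral => s _; rewrite /f /= patchE indicE.
by case: ifPn => h; rewrite ?mul1r ?mul0r.
Qed.

Lemma compact_integral_lty (K : set V) (f : V -> R) : compact K ->
  {within K, continuous f} -> (forall x, K x -> (0 <= f x)%R) ->
  \int[lebb]_(x in K) (f x)%:E < +oo.
Proof.
move=> cK cf f0.
have clK : closed K by apply: compact_closed => //; exact: norm_hausdorff.
have mK : measurable (K : set (borel R n)) by exact: closed_borel.
have [M [_ hM]] := compact_bounded (continuous_compact cf cK).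
have {}hM x : K x -> (f x <= `|M| + 1)%R.
  move=> Kx; apply: le_trans (ler_norm _) _.
  apply: (hM (`|M| + 1)%R); last by exists x.
  by apply: le_lt_trans (ler_norm M) _; rewrite ltrDl.
have [B [_ hB]] := compact_bounded cK.
have {}hB x : K x -> (`|x| <= `|B| + 1)%R.
  move=> Kx; apply: (hB (`|B| + 1)%R) => //.
  by apply: le_lt_trans (ler_norm B) _; rewrite ltrDl.
apply: (@le_lt_trans _ _ (\int[lebb]_(x in K) (`|M| + 1)%:E)).
  apply: ge0_le_integral => //.
  by apply/measurable_EFinP; exact: continuous_measurable_borel.
rewrite integral_cst //; apply: lte_mul_pinfty => //.
by apply: (@leb_bounded_lty _ _ _ (`|B| + 1)%R).
Qed.

Lemma lebb_integral_cover (I : finType) (A : I -> set V) (B : set V) (f : V -> R) :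
  (forall i, measurable (A i : set (borel R n))) -> measurable (B : set (borel R n)) ->
  B `<=` \bigcup_(i in [set: I]) A i -> (forall x, (0 <= f x)%R) ->
  measurable_fun (B : set (borel R n)) (f : borel R n -> R) ->
  (forall i, measurable_fun (A i : set (borel R n)) (f : borel R n -> R)) ->
  \int[lebb]_(x in B) (f x)%:E <= \sum_i \int[lebb]_(x in A i) (f x)%:E.
Proof.
move=> mA mB BA f0 mfB mfA.
have E (D : set V) : \int[lebb]_(x in D) (f x)%:E = \int[lebb]_x (\1_D x * f x)%:E.
  rewrite integral_mkcond; apply: eq_integral => x _; rewrite patchE indicE.
  by case: ifPn => h; rewrite ?mul1r ?mul0r.
rewrite E (eq_bigr (fun i => \int[lebb]_x (\1_(A i) x * f x)%:E)); last by move=> i _; exact: E.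
rewrite -ge0_integral_sum //.
- apply: ge0_le_integral => //.
  + by move=> x _; rewrite lee_fin mulr_ge0.
  + by apply/measurable_EFinP; exact: indic_mul_borel.
  + apply: emeasurable_sum => i; apply/measurable_EFinP; exact: indic_mul_borel.
  + move=> x _; rewrite sumEFin lee_fin indicE; case: (boolP (x \in B)) => xB; last first.
      by rewrite mul0r; apply: sumr_ge0 => i _; rewrite mulr_ge0.
    have [i _ Ai] := BA x (set_mem xB).
    rewrite mul1r (bigD1 i) //= indicE mem_set // mul1r lerDl.
    by apply: sumr_ge0 => j _; rewrite mulr_ge0.
- by move=> i; apply/measurable_EFinP; exact: indic_mul_borel.
- by move=> i x _; rewrite lee_fin mulr_ge0.
Qed.

End IntegralTools.

Section StripBound.
Context {R : realType} {d : nat} (P : problem R d) (T : mesh R d).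
Local Notation V := 'rV[R]_d.
Local Notation e_ j := (delta_mx 0 j : V).
Variables (k : nat) (r : R) (c : V) (v : V -> V).
Variables (p : 'I_(nel T) -> V -> V) (dp : 'I_(nel T) -> 'I_d -> 'I_d -> V -> R).
Hypotheses (hP : continuous_problem P) (hT : simplicial_mesh T (Otilde P)) (d0 : (0 < d)%N)
  (r0 : 0 <= r) (hc : admissible P c) (hv : Vh P T k r c v).
Hypothesis pE : fe_repr P r c v p dp.
Variables (rho L c1 alpha : R).
Hypotheses (rho0 : 0 < rho) (L0 : 0 < L) (rrho : r < rho) (Lr : L * r < rho / 2)
  (alpha0 : 0 < alpha).
Hypothesis cone : exit_cone P rho L c1.

Local Notation Oa := (Oact P T r c).
Local Notation sq := (fun y : V => dotv (v y) (v y)).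
Local Notation dens := (total_density P r c v p dp rho alpha).

Let Oact_borel : measurable (Oa : set (borel R d)).
Proof. exact: (patch_borel hT). Qed.

Let msq (A : set V) : measurable (A : set (borel R d)) -> A `<=` Oa ->
  measurable_fun (A : set (borel R d)) (sq : borel R d -> R).
Proof. by move=> mA AO; apply: measurable_funS (sq_measurable_Oact hT hv) => //. Qed.

Lemma band_sub_Oact : band P r c `<=` Oa.
Proof.
by move=> x bx; apply: (strip_sub_Oact hT); rewrite strip_split //; right.
Qed.

(** Each line meets the piece in parameters at most L r apart, so integrating [line_bound] over the
    piece costs a factor 2 L r. *)
Lemma band_piece_integral j b :
  (\int[lebb]_(x in band_piece P r c c1 j b) (sq x)%:E <=
   (2 * (L * r))%:E * \int[lebb]_x (dens x)%:E)%E.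
Proof.
have H0 := total_density_ge0 P r c v p dp rho0 alpha0.
have mH := total_density_borel hP hT r0 hv pE rho alpha.
have mA : measurable (band_piece P r c c1 j b : set (borel R d)).
  by apply: closed_borel; exact: band_piece_closed.
have AO : band_piece P r c c1 j b `<=` Oa by move=> x [/band_sub_Oact].
apply: le_trans (@line_integral_le _ _ _ dens (bdir j b) rho (L * r) mA mH H0 _ _).
- apply: ge0_le_integral => //.
  + by move=> x _; rewrite lee_fin dotv_ge0.
  + by apply/measurable_EFinP; exact: msq.
  + by apply: measurable_funTS; exact: line_integral_measurable.
  + by move=> x Ax; exact: (line_bound hP hT r0 hc hv pE rho0 L0 rrho Lr alpha0 cone).
- by rewrite mulr_ge0 // ltW.
- by move=> y s s' hs hs'; exact: (band_piece_width L0 rrho cone).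
Qed.

End StripBound.

Section StripBoundReal.
Context {R : realType} {d : nat} (P : problem R d) (T : mesh R d).
Local Notation V := 'rV[R]_d.
Local Notation e_ j := (delta_mx 0 j : V).
Variables (k : nat) (r : R) (c : V) (v : V -> V).
Variables (p : 'I_(nel T) -> V -> V) (dp : 'I_(nel T) -> 'I_d -> 'I_d -> V -> R).
Hypotheses (hP : continuous_problem P) (hT : simplicial_mesh T (Otilde P)) (d0 : (0 < d)%N)
  (r0 : 0 <= r) (hc : admissible P c) (hv : Vh P T k r c v).
Hypothesis pE : fe_repr P r c v p dp.

Local Notation Oa := (Oact P T r c).
Local Notation sq := (fun y : V => dotv (v y) (v y)).

Let Oact_borel : measurable (Oa : set (borel R d)).
Proof. exact: (patch_borel hT). Qed.

Let OmD_borel : measurable (OmD P c : set (borel R d)).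
Proof. by apply: open_borel; exact: OmD_open. Qed.

Let strip_borel : measurable (strip P r (OmD P c) : set (borel R d)).
Proof.
apply: measurableI; first by apply: open_borel; exact: Otilde_open.
by apply: closed_borel; exact: dist_le_closed.
Qed.

Let msq (A : set V) : measurable (A : set (borel R d)) -> A `<=` Oa ->
  measurable_fun (A : set (borel R d)) (sq : borel R d -> R).
Proof. by move=> mA AO; apply: measurable_funS (sq_measurable_Oact hT hv) => //. Qed.

Let OmO : OmD P c `<=` Oa. Proof. exact: (OmD_sub_Oact hT r0). Qed.

Let stripO : strip P r (OmD P c) `<=` Oa. Proof. exact: (strip_sub_Oact hT). Qed.

Lemma sq_integral_lty (A : set V) : measurable (A : set (borel R d)) -> A `<=` Oa ->
  (\int[lebb]_(x in A) (sq x)%:E < +oo)%E.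
Proof.
move=> mA AO; apply: (@le_lt_trans _ _ (\int[lebb]_(x in Oa) (sq x)%:E)%E).
  apply: ge0_subset_integral => //.
  - by apply/measurable_EFinP; exact: msq.
  - by move=> x _; rewrite lee_fin dotv_ge0.
apply: compact_integral_lty; first exact: (patch_compact hT).
  by apply: dotv_continuous_within; case: hv => -[].
by move=> x _; exact: dotv_ge0.
Qed.

Lemma sq_integral_fin (A : set V) : measurable (A : set (borel R d)) -> A `<=` Oa ->
  (\int[lebb]_(x in A) (sq x)%:E)%E \is a fin_num.
Proof.
move=> mA AO; rewrite ge0_fin_numE ?sq_integral_lty //.
by apply: integral_ge0 => x _; rewrite lee_fin dotv_ge0.
Qed.

Lemma sqnormE (A : set V) : measurable (A : set (borel R d)) -> A `<=` Oa ->
  (sqnorm A v)%:E = (\int[lebb]_(x in A) (sq x)%:E)%E.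
Proof.
move=> mA AO; rewrite /sqnorm /vint /Rintegral integral_lebb //.
- by rewrite fineK // sq_integral_fin.
- by apply/measurable_EFinP; exact: msq.
- by move=> x _; rewrite lee_fin dotv_ge0.
Qed.

Lemma frob_ge0 (A : 'M[R]_d) : 0 <= frob A A.
Proof. by apply: sumr_ge0 => i _; apply: sumr_ge0 => j _; rewrite -expr2 sqr_ge0. Qed.

Let msqgrad e : measurable_fun [set: borel R d] (sqgrad_piece dp e : borel R d -> R).
Proof. by apply: polyfun_borel; exact: sqgrad_piece_polyfun pE e. Qed.

Lemma frob_grad_core e x : act P r c e -> core e x ->
  frob (grad v x) (grad v x) = sqgrad_piece dp e x.
Proof.
move=> ae cx; have [_ _ Dp vE] := pE e.
rewrite /frob /sqgrad_piece; apply: eq_bigr => i _; apply: eq_bigr => j _.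
by rewrite (grad_core hT (vE ae) Dp cx) expr2.
Qed.

(** [sqgrad] takes [fine] of an extended integral, so finiteness has to be shown; it follows from
    polynomial bounds on the compact elements. *)
Lemma sqgradE : (sqgrad Oa v)%:E =
  (\int[lebb]_x (piecewise (act P r c) (sqgrad_piece dp) x)%:E)%E.
Proof.
rewrite -(patch_integral hT d0 (Phi := fun x => frob (grad v x) (grad v x))) //; last first.
- exact: frob_grad_core.
- by move=> x; exact: frob_ge0.
- by move=> e x; exact: sqgrad_piece_ge0.
rewrite /sqgrad /vint /Rintegral fineK // ge0_fin_numE; last first.
  by apply: integral_ge0 => x _; rewrite lee_fin frob_ge0.
rewrite (patch_integral hT d0 (phi := sqgrad_piece dp)) //; last first.
- exact: frob_grad_core.
- by move=> x; exact: frob_ge0.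
- by move=> e x; exact: sqgrad_piece_ge0.
rewrite /piecewise; under eq_integral do rewrite -sumEFin -big_filter.
rewrite ge0_integral_sum //; last 2 first.
- move=> e; apply/measurable_EFinP; apply: indic_mul_borel.
    exact: (elem_borel (mesh_indep hT)).
  exact: measurable_funTS.
- by move=> e x _; rewrite lee_fin mulr_ge0 // sqgrad_piece_ge0.
apply: lte_sum_pinfty => e _.
have -> : (\int[lebb]_x (\1_(elem e) x * sqgrad_piece dp e x)%:E =
    \int[lebb]_(x in elem e) (sqgrad_piece dp e x)%:E)%E.
  rewrite [RHS]integral_mkcond; apply: eq_integral => x _; rewrite patchE indicE.
  by case: ifPn => h; rewrite ?mul1r ?mul0r.
apply: compact_integral_lty.
- have -> : elem e = patch_of [set e].
    by apply/seteqP; split => [x ex|x [_ -> ex]] //; exists e.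
  exact: (patch_compact hT).
- by apply: continuous_subspaceT; apply: polyfun_continuous; exact: sqgrad_piece_polyfun pE e.
- by move=> x _; exact: sqgrad_piece_ge0.
Qed.

Lemma sqgrad_ge0 (A : set V) (u : V -> V) : 0 <= sqgrad A u.
Proof. by apply: Rintegral_ge0 => x _; exact: frob_ge0. Qed.

Lemma sqnorm_ge0 (A : set V) (u : V -> V) : 0 <= sqnorm A u.
Proof. by apply: Rintegral_ge0 => x _; exact: dotv_ge0. Qed.

Lemma strip_density_integral (alpha : R) : 0 < alpha ->
  (\int[lebb]_x (strip_density P r c p dp alpha x)%:E <=
   (alpha * sqnorm (strip P r (OmD P c)) v + alpha^-1 * sqgrad Oa v)%:E)%E.
Proof.
move=> alpha0.
pose D1 := piecewise (act P r c) (fun e z => \1_(closed_strip P T r c) z * dotv (p e z) (p e z)).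
pose D2 := piecewise (act P r c) (sqgrad_piece dp).
have ai0 : 0 <= alpha^-1 by rewrite invr_ge0 ltW.
have mD1e e : measurable_fun [set: borel R d]
    ((fun z => \1_(closed_strip P T r c) z * dotv (p e z) (p e z)) : borel R d -> R).
  apply: indic_mul_borel; first exact: closed_strip_borel.
  by apply: measurable_funTS; apply: polyfun_borel; exact: dotv_piece_polyfun pE e.
have mD1 : measurable_fun [set: borel R d] (D1 : borel R d -> R) by exact: (piecewise_borel hT).
have mD2 : measurable_fun [set: borel R d] (D2 : borel R d -> R) by exact: (piecewise_borel hT).
have D10 y : 0 <= D1 y by apply: piecewise_ge0 => e x; rewrite mulr_ge0 // dotv_ge0.
have D20 y : 0 <= D2 y by apply: piecewise_ge0 => e x; exact: sqgrad_piece_ge0.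
(* The closed strip exceeds [strip] only by points outside [Otilde], where v = 0. *)
have E1 : (\int[lebb]_x (D1 x)%:E = (sqnorm (strip P r (OmD P c)) v)%:E)%E.
  rewrite sqnormE //.
  rewrite -(patch_integral hT d0
      (Phi := fun x => \1_(strip P r (OmD P c)) x * sq x)) //; last first.
  - move=> e x ae cx; have ex := core_elem (mesh_indep hT) cx.
    have Ox : Oa x by exists e.
    have [_ _ _ /(_ ae x ex) vE] := pE e; rewrite -vE.
    have [nx|nx] := pselect (near_bulk P r c x); last first.
      rewrite !indicE !memNset ?mul0r //; first by move=> [_ /nx].
      by move=> [_ /nx].
    have [Otx|nOtx] := pselect (Otilde P x).
      by rewrite !indicE !mem_set //; split.
    have -> : v x = 0 by apply: (closed_strip_outer hT hv).
    by rewrite /dotv big1 ?mulr0 // => i _; rewrite mxE mul0r.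
  - by move=> x; rewrite mulr_ge0 // dotv_ge0.
  - by move=> e x; rewrite mulr_ge0 // dotv_ge0.
  rewrite integral_lebb //; last 2 first.
  - apply/measurable_EFinP; apply: measurable_funTS; apply: indic_mul_borel => //.
    exact: msq.
  - by move=> x _; rewrite lee_fin mulr_ge0 // dotv_ge0.
  rewrite integral_mkcond [RHS]integral_mkcond; apply: eq_integral => x _.
  rewrite !patchE indicE; case: (boolP (x \in strip P r (OmD P c))) => xs; last first.
    by rewrite mul0r; case: ifP.
  by rewrite ifT ?mul1r // inE; apply: stripO; exact: set_mem.
have -> : (alpha * sqnorm (strip P r (OmD P c)) v + alpha^-1 * sqgrad Oa v)%:E =
    (\int[lebb]_x (alpha * D1 x + alpha^-1 * D2 x)%:E)%E.
  under eq_integral do rewrite EFinD !EFinM.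
  have Z (a : R) (D : V -> R) : 0 <= a -> (forall x, 0 <= D x) ->
      measurable_fun [set: borel R d] (D : borel R d -> R) ->
      (\int[lebb]_x (a%:E * (D x)%:E) = a%:E * \int[lebb]_x (D x)%:E)%E.
    move=> a0 D0 mD; apply: ge0_integralZl_EFin => //; last exact/measurable_EFinP.
    by move=> x _; rewrite lee_fin.
  have a0 := ltW alpha0.
  rewrite ge0_integralD //; last first.
  - by apply: measurable_funeM; exact/measurable_EFinP.
  - by move=> x _; rewrite -EFinM lee_fin mulr_ge0.
  - by apply: measurable_funeM; exact/measurable_EFinP.
  - by move=> x _; rewrite -EFinM lee_fin mulr_ge0.
  by rewrite !Z // E1 -sqgradE.
apply: ge0_le_integral => //.
- by move=> x _; rewrite lee_fin (strip_density_ge0 _ _ _ _ _ alpha0).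
- by apply/measurable_EFinP; exact: (strip_density_borel hT pE).
- by apply/measurable_EFinP; apply: measurable_funD; apply: measurable_funM.
move=> x _; rewrite lee_fin /strip_density /D1 /D2 /piecewise !mulr_sumr -big_split /=.
apply: ler_sum => e _.
rewrite /young_piece !mulrDr; apply: lerD.
  by rewrite le_eqVlt; apply/orP; left; apply/eqP; ring.
have g0 := sqgrad_piece_ge0 dp e x.
rewrite [leRHS]mulrCA; apply: ler_wpM2l => //.
by rewrite ler_piMl ?mulr_ge0 // indicE; case: (_ \in _).
Qed.

End StripBoundReal.

(** * The strip estimate *)

Section StripEstimate.
Context {R : realType} {d : nat} (P : problem R d).
Local Notation V := 'rV[R]_d.
Hypotheses (hP : continuous_problem P) (d0 : (0 < d)%N).

Lemma strip_estimate_cone (T : mesh R d) (k : nat) (r : R) (c : V) (v : V -> V)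
    (rho L c1 alpha : R) :
  simplicial_mesh T (Otilde P) -> 0 <= r -> admissible P c -> Vh P T k r c v ->
  0 < rho -> 0 < L -> r < rho -> L * r < rho / 2 -> 0 < alpha ->
  exit_cone P rho L c1 ->
  sqnorm (strip P r (OmD P c)) v <= sqnorm (OmD P c) v +
    4 * d%:R * L * r * (2 / rho * sqnorm (OmD P c) v +
      alpha * sqnorm (strip P r (OmD P c)) v + alpha^-1 * sqgrad (Oact P T r c) v).
Proof.
move=> hT r0 hc hv rho0 L0 rrho Lr alpha0 cone.
have [p [dp pE]] := fe_pieces hv.
pose sq (y : V) : R := dotv (v y) (v y).
have sq0 y : 0 <= sq y by exact: dotv_ge0.
have mO : measurable (OmD P c : set (borel R d)) by apply: open_borel; exact: OmD_open.
have mB : measurable (band P r c : set (borel R d)).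
  by apply: closed_borel; exact: band_closed.
have OO := OmD_sub_Oact hT r0 (c := c).
have BO := band_sub_Oact hT r0 hc.
have mS : measurable (strip P r (OmD P c) : set (borel R d)).
  by rewrite (strip_split r0 hc); exact: measurableU.
have SO := strip_sub_Oact hT (r := r) (c := c).
have msq (A : set V) : measurable (A : set (borel R d)) -> A `<=` Oact P T r c ->
    measurable_fun (A : set (borel R d)) (sq : borel R d -> R).
  by move=> mA AO; apply: measurable_funS (sq_measurable_Oact hT hv) => //; exact: (patch_borel hT).
have kap0 : 0 <= 2 * (L * r) by rewrite mulr_ge0 // mulr_ge0 // ltW.
pose dens := total_density P r c v p dp rho alpha.
have hdens : (\int[lebb]_x (dens x)%:E <= (2 / rho * sqnorm (OmD P c) v +
    (alpha * sqnorm (strip P r (OmD P c)) v + alpha^-1 * sqgrad (Oact P T r c) v))%:E)%E.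
  have mb := bulk_density_borel hP hT r0 hv.
  have ms := strip_density_borel hT pE alpha.
  have c20 : 0 <= 2 / rho by rewrite divr_ge0 // ltW.
  have b0 y : 0 <= bulk_density P c v y by rewrite mulr_ge0 // sq0.
  have s0 y := strip_density_ge0 P r c p dp alpha0 y.
  rewrite /dens /total_density; under eq_integral do rewrite EFinD EFinM.
  rewrite ge0_integralD //; last first.
  - exact/measurable_EFinP.
  - by move=> x _; rewrite lee_fin.
  - by apply: measurable_funeM; exact/measurable_EFinP.
  - by move=> x _; rewrite -EFinM lee_fin mulr_ge0.
  rewrite EFinD; apply: leeD; last by apply: (@strip_density_integral _ _ P T k).
  have -> : (\int[lebb]_x ((2 / rho)%:E * (bulk_density P c v x)%:E) =
      (2 / rho)%:E * \int[lebb]_x (bulk_density P c v x)%:E)%E.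
    apply: ge0_integralZl_EFin => //; last exact/measurable_EFinP.
    by move=> x _; rewrite lee_fin.
  rewrite [leRHS]EFinM (sqnormE hT hv mO OO); apply: lee_wpmul2l => //.
  rewrite [leRHS]integral_mkcond le_eqVlt; apply/orP; left; apply/eqP.
  apply: eq_integral => x _; rewrite patchE /bulk_density indicE.
  by case: ifPn => h; rewrite ?mul1r ?mul0r.
rewrite -lee_fin EFinD (sqnormE hT hv mS SO) (sqnormE hT hv mO OO).
rewrite {1}(strip_split r0 hc) ge0_integral_setU //; last 3 first.
- apply/measurable_EFinP; apply: msq; first exact: measurableU.
  by rewrite -(strip_split r0 hc); exact: SO.
- by move=> x _; rewrite lee_fin dotv_ge0.
- by apply/disj_set2P; rewrite -subset0 => x [Ox Bx]; exact: (OmD_band_disjoint Ox Bx).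
apply: leeD => //.
pose A (q : 'I_d * bool) := band_piece P r c c1 q.1 q.2.
have mA q : measurable (A q : set (borel R d)).
  by apply: closed_borel; exact: band_piece_closed.
apply: le_trans (lebb_integral_cover mA mB _ sq0 _ _) _.
- exact: (band_cover rrho cone).
- exact: msq.
- by move=> q; apply: msq => // x [/BO].
apply: (@le_trans _ _ (\sum_(q : 'I_d * bool) (2 * (L * r) * (2 / rho * sqnorm (OmD P c) v +
    (alpha * sqnorm (strip P r (OmD P c)) v + alpha^-1 * sqgrad (Oact P T r c) v)))%:E)%E).
  apply: lee_sum => q _; rewrite EFinM.
  apply: le_trans (band_piece_integral hP hT r0 hc hv pE rho0 L0 rrho Lr alpha0 cone q.1 q.2) _.
  by apply: lee_wpmul2l.
(* There are 2d pieces, one per signed coordinate direction, each costing 2 L r: hence 4 d L r. *)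
rewrite sumEFin lee_fin sumr_const card_prod card_ord card_bool.
rewrite -[X in X <= _]mulr_natl natrM.
rewrite le_eqVlt; apply/orP; left; apply/eqP; ring.
Qed.

(** [alpha] is fixed first, large enough for the gradient coefficient to be at most eta dt; then dt
    is taken small enough to absorb the strip norm produced by [alpha]. *)
Lemma strip_estimate (w0 eta : R) : 0 <= w0 -> 0 < eta ->
  exists dt0 C1 : R, [/\ 0 < dt0, 0 <= C1 &
  forall dt (T : mesh R d) (k : nat) (c : V) (v : V -> V),
    0 <= dt -> dt <= dt0 -> simplicial_mesh T (Otilde P) -> admissible P c ->
    Vh P T k (w0 * dt) c v ->
    sqnorm (strip P (w0 * dt) (OmD P c)) v <=
      (1 + C1 * dt) * sqnorm (OmD P c) v + eta * dt * sqgrad (Oact P T (w0 * dt) c) v].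
Proof.
move=> w00 eta0.
have [rho [L [c1 [rho0 L0 c10 cone]]]] := solid_cone (phi0_derive hP) (phi0_continuous hP)
  (phi0_partial_continuous hP) (Otilde_open hP) (solid_compact hP) (gradG0 hP).
pose K0 := 4 * d%:R * L * w0.
have K00 : 0 <= K0 by rewrite !mulr_ge0 // ltW.
(* This gives 2 K0 / alpha <= eta, the 2 coming from the absorption below. The bound [a] ensures K0
   dt alpha <= 1/2, and [b] ensures (L + 1) r <= rho/4. *)
pose alpha := 2 * K0 / eta + 1.
have alpha0 : 0 < alpha by rewrite ltr_pwDr // divr_ge0 ?mulr_ge0 // ltW.
pose a := (2 * (K0 + 1) * alpha)^-1.
pose b := rho / (4 * (L + 1) * (w0 + 1)).
have a0 : 0 < a by rewrite invr_gt0 !mulr_gt0 // ltr_pwDr.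
have L1 : 0 < L + 1 by rewrite addr_gt0.
have w1 : 0 < w0 + 1 by rewrite ltr_pwDr.
have b0 : 0 < b by rewrite divr_gt0 // !mulr_gt0.
exists (Num.min a b), (2 * K0 * (2 / rho + alpha)); split.
- by rewrite lt_min a0.
- by apply: mulr_ge0; [rewrite mulr_ge0 | rewrite addr_ge0 ?divr_ge0 // ltW].
move=> dt T k c v dt0; rewrite le_min => /andP[dta dtb] hT hc hv.
have r0 : 0 <= w0 * dt by rewrite mulr_ge0.
have hb : (L + 1) * ((w0 + 1) * b) = rho / 4.
  by rewrite /b; field; rewrite !gt_eqF.
have hwb : w0 * dt <= (w0 + 1) * b.
  by apply: ler_pM => //; rewrite lerDl.
have h1 : (L + 1) * (w0 * dt) <= rho / 4.
  by rewrite -hb; apply: ler_wpM2l => //; exact: ltW.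
have Lr0 : 0 <= L * (w0 * dt) by rewrite mulr_ge0 // ltW.
have rrho : w0 * dt < rho by move: h1; rewrite mulrDl mul1r; lra.
have Lr : L * (w0 * dt) < rho / 2 by move: h1; rewrite mulrDl mul1r; lra.
have := strip_estimate_cone hT r0 hc hv rho0 L0 rrho Lr alpha0 cone.
have No0 := sqnorm_ge0 (OmD P c) v.
have Ns0 := sqnorm_ge0 (strip P (w0 * dt) (OmD P c)) v.
have G0 := sqgrad_ge0 (Oact P T (w0 * dt) c) v.
set No := sqnorm (OmD P c) v in No0 *.
set Ns := sqnorm (strip _ _ _) v in Ns0 *.
set G := sqgrad _ v in G0 *.
have -> : 4 * d%:R * L * (w0 * dt) = K0 * dt by rewrite /K0; ring.
move=> h.
have kad : K0 * dt * alpha <= 2^-1.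
  apply: (@le_trans _ _ ((K0 + 1) * a * alpha)).
    apply: ler_wpM2r; first exact: ltW.
    by apply: ler_pM => //; rewrite lerDl.
  by rewrite le_eqVlt /a; apply/orP; left; apply/eqP; field; rewrite !gt_eqF // ltr_pwDr.
have K1 : No <= Ns.
  have hO : sqnorm (OmD P c) v <= sqnorm (strip P (w0 * dt) (OmD P c)) v.
    have mO : measurable (OmD P c : set (borel R d)) by apply: open_borel; exact: OmD_open.
    have mS : measurable (strip P (w0 * dt) (OmD P c) : set (borel R d)).
      apply: measurableI; first by apply: open_borel; exact: Otilde_open.
      by apply: closed_borel; exact: dist_le_closed.
    have SO := strip_sub_Oact hT (r := w0 * dt) (c := c).
    have OO := OmD_sub_Oact hT r0 (c := c).
    rewrite -lee_fin (sqnormE hT hv mO OO) (sqnormE hT hv mS SO).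
    apply: ge0_subset_integral => //.
    - apply/measurable_EFinP; apply: measurable_funS (sq_measurable_Oact hT hv) => //.
      exact: (patch_borel hT).
    - by move=> x _; rewrite lee_fin dotv_ge0.
    - by rewrite (strip_split r0 hc); left.
  exact: hO.
have ai : 2 * K0 * alpha^-1 <= eta.
  rewrite ler_pdivrMr // /alpha mulrDr mulr1.
  have -> : eta * (2 * K0 / eta) = 2 * K0 by field; rewrite gt_eqF.
  by rewrite lerDl ltW.
(* Only the excess [Ns - No] is absorbed: absorbing all of [Ns] would double [No], whose coefficient
   must stay 1 + O(dt). *)
have e1 : K0 * dt * (alpha * Ns) <= 2^-1 * (Ns - No) + K0 * dt * alpha * No.
  have := ler_wpM2r (ltac:(by rewrite subr_ge0) : 0 <= Ns - No) kad; nra.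
have e2 : 2 * (K0 * dt * (alpha^-1 * G)) <= eta * dt * G.
  have -> : 2 * (K0 * dt * (alpha^-1 * G)) = (2 * K0 * alpha^-1) * (dt * G) by ring.
  by rewrite -(mulrA eta); apply: ler_wpM2r => //; rewrite mulr_ge0.
have -> : (1 + 2 * K0 * (2 / rho + alpha) * dt) * No =
    No + 2 * (K0 * dt * (2 / rho * No)) + 2 * (K0 * dt * alpha * No) by ring.
have : Ns <= No + (K0 * dt * (2 / rho * No) + K0 * dt * (alpha * Ns) + K0 * dt * (alpha^-1 * G)).
  by move: h; rewrite !mulrDr.
move: e1 e2; lra.
Qed.

End StripEstimate.

(** * Lower bound for the interface area *)

Section CubeCover.
Context {R : realType}.
Local Open Scope ereal_scope.

(** Induction on the dimension: for fixed last coordinate t, the boxes whose last side contains t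
    cover the slice; integrate over t. Points are sequences, to avoid casts between dimensions, and
    [D] switches off boxes not in use. *)
Lemma cube_cover_volume m (D : nat -> bool) (a b : nat -> nat -> R) (p : nat -> R) (s : R) :
  (0 <= s)%R -> (forall k i, (a k i <= b k i)%R) ->
  (forall x : nat -> R, (forall i, (i < m)%N -> (p i <= x i <= p i + s)%R) ->
    exists k, D k /\ forall i, (i < m)%N -> (a k i <= x i <= b k i)%R) ->
  (s ^+ m)%:E <= \sum_(k <oo) (if D k then (\prod_(i < m) (b k i - a k i)%R)%:E else 0).
Proof.
move=> s0 ab; elim: m D => [|m ih] D cov.
  have [k [Dk _]] := cov p (fun i (h : (i < 0)%N) => False_ind _ (notF h)).
  have t0 n : 0 <= if D n then (\prod_(i < 0) (b n i - a n i)%R)%:E else 0.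
    by case: ifP => // _; rewrite big_ord0 lee_fin.
  apply: le_trans (nneseries_lim_ge k.+1 (fun n _ _ => t0 n)).
  rewrite big_nat_recr //= Dk big_ord0 expr0 leeDr //.
  by apply: sume_ge0 => n _; exact: t0.
pose w k : R := if D k then (\prod_(i < m) (b k i - a k i))%R else 0%R.
have w0 k : (0 <= w k)%R.
  by rewrite /w; case: ifP => // _; apply: prodr_ge0 => i _; rewrite subr_ge0.
pose g k (t : R) : \bar R := (w k * \1_(`[a k m, b k m]%classic) t)%:E.
have g0 k t : 0 <= g k t by rewrite lee_fin mulr_ge0.
have mg k (I : set R) : measurable_fun I (g k).
  apply: (@measurable_funS _ _ _ _ setT) => //; apply/measurable_EFinP.
  by apply: measurable_funM => //; exact: measurable_indic.
have slice (t : R) : (p m <= t <= p m + s)%R -> (s ^+ m)%:E <= \sum_(k <oo) g k t.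
  move=> ht; apply: le_trans (ih (fun k => D k && (a k m <= t <= b k m)%R) _) _.
    move=> x hx; pose x' i := if i == m then t else x i.
    have [i im|k [Dk hk]] := cov x'.
      rewrite /x'; case: eqP => [->//|/eqP ne]; apply: hx.
      by rewrite ltn_neqAle ne -ltnS.
    exists k; split.
      by rewrite Dk /=; have := hk m (ltnSn m); rewrite /x' eqxx.
    move=> i im; have := hk i (leqW im); rewrite /x'; case: eqP => // e.
    by move: im; rewrite e ltnn.
  apply: lee_nneseries => [k _ _|k _].
    case: ifP => // _; rewrite lee_fin; apply: prodr_ge0 => i _.
    by rewrite subr_ge0.
  rewrite /g /w indicE; case: (D k) => /=; last by rewrite mul0r.
  case: ifP => h; last by rewrite lee_fin mulr_ge0 // prodr_ge0 // => i _; rewrite subr_ge0.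
  by rewrite mem_set ?mulr1 //= in_itv.
have lenI (u v : R) : (u <= v)%R -> lebesgue_measure `[u, v]%classic = (v - u)%:E.
  by move=> uv; rewrite lebesgue_measure_itv /= lte_fin; case: ltgtP uv => //= -> _; rewrite subrr.
have mI : measurable (`[p m, (p m + s)%R]%classic : set R) by exact: measurable_itv.
apply: (@le_trans _ _ (\int[lebesgue_measure]_(t in `[p m, (p m + s)%R]) (s ^+ m)%:E)).
  rewrite integral_cst //= lenI; last by rewrite lerDl.
  by rewrite addrAC subrr add0r exprSr EFinM.
apply: (@le_trans _ _ (\int[lebesgue_measure]_(t in `[p m, (p m + s)%R]) \sum_(k <oo) g k t)).
  apply: ge0_le_integral => //.
  - by move=> t _; rewrite lee_fin exprn_ge0.
  - apply: (ge0_emeasurable_sum (P := xpredT)); [by move=> k t _ _; exact: g0 | by move=> k _; exact: mg].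
rewrite integral_nneseries //; last by move=> k; exact: mg.
apply: lee_nneseries => [k _ _|k _]; first by apply: integral_ge0 => t _; exact: g0.
apply: (@le_trans _ _ (\int[lebesgue_measure]_t g k t)).
  by apply: ge0_subset_integral => //; exact: mg.
rewrite /g; under eq_integral do rewrite EFinM.
rewrite ge0_integralZl_EFin //; last first.
  by apply/measurable_EFinP; exact: measurable_indic.
have -> : \int[lebesgue_measure]_t (\1_(`[a k m, b k m]%classic : set R) t)%:E = (b k m - a k m)%:E.
  by rewrite integral_indic ?setIT; [exact: lenI | exact: measurableT | exact: measurable_itv].
rewrite /w.
by case: (D k); rewrite -EFinM lee_fin ?mul0r // big_ord_recr.
Qed.

(** Each covering set is enlarged to a box with error e/2^(k+1); empty sets receive a dummy box that
    the flag switches off. *)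
Lemma cube_leb_outer m (A : set 'rV[R]_m.+1) (p : nat -> R) (s : R) : (0 <= s)%R ->
  (forall x : 'rV[R]_m.+1, (forall i : 'I_m.+1, (p i <= x 0%R i <= p i + s)%R) -> A x) ->
  (s ^+ m.+1)%:E <= leb_outer A.
Proof.
move=> s0 sA; apply: cover_outer_ge => F AF.
have gF k := box_gauge_ge0 (F k).
have [[k Fk]|Ffin] := pselect (exists k, box_gauge (F k) = +oo).
  by rewrite (nneseries_pinfty (fun n _ => gF n) _ Fk) // leey.
have Ff k : box_gauge (F k) \is a fin_num.
  rewrite ge0_fin_numE // ltey; apply/negP => /eqP h; apply: Ffin; by exists k.
apply/lee_addgt0Pr => e e0; apply: le_trans (epsilon_trick _ _ (ltW e0)) => //.
have ex k : exists ab : (nat -> R) * (nat -> R), (forall i, ab.1 i <= ab.2 i)%R /\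
    (F k !=set0 -> (forall x, F k x -> forall i : 'I_m.+1, (ab.1 i <= x 0%R i <= ab.2 i)%R) /\
    (\prod_(i < m.+1) (ab.2 i - ab.1 i)%R)%:E <= box_gauge (F k) + (e / (2 ^ k.+1)%:R)%:E).
  have [F0|/set0P F0] := eqVneq (F k) set0.
    by exists (fun=> 0%R, fun=> 0%R); split => // -[x]; rewrite F0.
  have : box_gauge (F k) < box_gauge (F k) + (e / (2 ^ k.+1)%:R)%:E.
    by rewrite lteDl // lte_fin divr_gt0 // ltr0n expn_gt0.
  rewrite {1}/box_gauge; case: asboolP => [h|_]; first by case: F0 => x; rewrite h.
  move=> /ereal_inf_lt[_ [[u v] [/= uv Fuv] <-] lt].
  exists (fun i => u 0%R (inord i), fun i => v 0%R (inord i)); split => //= _; split.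
    by move=> x /Fuv h i; rewrite inord_val; exact: h.
  by apply: le_trans (ltW lt); rewrite lee_fin le_eqVlt; apply/orP; left; apply/eqP;
    apply: eq_bigr => i _; rewrite inord_val.
have [ab hab] := choice ex.
apply: le_trans (@cube_cover_volume m.+1 (fun k => `[< F k !=set0 >])
  (fun k => (ab k).1) (fun k => (ab k).2) p s s0 (fun k => (hab k).1) _) _.
  move=> x hx; have : A (\row_i x i) by apply: sA => i; rewrite mxE; apply: hx.
  move=> /AF[k _ Fk]; exists k; have Fk0 : F k !=set0 by exists (\row_i x i).
  split; first exact/asboolP.
  move=> i im; have := ((hab k).2 Fk0).1 _ Fk (Ordinal im).
  by rewrite mxE.
apply: lee_nneseries => [k _ _|k _].
  case: ifP => // _; rewrite lee_fin; apply: prodr_ge0 => i _.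
  by rewrite subr_ge0; exact: (hab k).1.
case: asboolP => [h|_]; first exact: ((hab k).2 h).2.
by rewrite adde_ge0 // lee_fin divr_ge0 // ltW.
Qed.

(** Without it Hausdorff measure would vanish. The centred cube of side 1/(m+1) lies in the ball of
    radius 1/2, because the Euclidean norm is at most m + 1 times the sup norm. *)
Lemma hcst_gt0 m : 0 < @hcst R m.+1.
Proof.
pose q : R := (m.+1%:R^-1)%R.
have q0 : (0 < q)%R by rewrite invr_gt0.
apply: lt_le_trans (@cube_leb_outer m _ (fun=> (- (q / 2))%R) q (ltW q0) _).
  by rewrite lte_fin exprn_gt0.
move=> x hx /=; apply: le_trans (enorm_le_norm x) _.
have h : (`|x| <= q / 2)%R.
  apply: norm_le_coord => [|i]; first by rewrite divr_ge0 // ltW.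
  have := hx i; rewrite ler_norml; lra.
apply: le_trans (ler_wpM2l _ h) _ => //.
by rewrite mulrA divff ?pnatr_eq0 // mul1r.
Qed.

Lemma hcst_lty m : @hcst R m < +oo.
Proof.
apply: (@leb_bounded_lty _ _ _ 2^-1) => // x /=; exact/le_trans/norm_le_enorm.
Qed.

(** A covering set of diameter delta projects into a cube of side 2 delta, so these cubes cover the
    given one and the sum of (2 delta)^(m+1) is at least s^(m+1). The scale r = 1 suffices for a
    lower bound. *)
Lemma haus_projection_gt0 m (G : set 'rV[R]_m.+2) (p : nat -> R) (s : R) : (0 < s)%R ->
  (forall x : nat -> R, (forall i, (i < m.+1)%N -> (p i <= x i <= p i + s)%R) ->
    exists2 y, G y & forall i, (i < m.+1)%N -> y 0%R (inord i) = x i) ->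
  0 < haus_outer m.+1 G.
Proof.
move=> s0 hG; pose c := (fine (@hcst R m.+1) * (s / 2) ^+ m.+1)%R.
have hE : (fine (@hcst R m.+1))%:E = @hcst R m.+1.
  by rewrite fineK // ge0_fin_numE ?hcst_lty // ltW // hcst_gt0.
have f0 : (0 < fine (@hcst R m.+1))%R by rewrite -lte_fin hE hcst_gt0.
apply: (@lt_le_trans _ _ c%:E).
  by rewrite lte_fin mulr_gt0 // exprn_gt0 // divr_gt0.
apply: le_trans (haus_outer_ub _ _ (ltr01 : (0 < 1 :> R)%R)).
apply: cover_outer_ge => F GF.
have gF k := @haus_gauge_ge0 R m.+1 m.+2 1%R (F k).
have [[k Fk]|Ffin] := pselect (exists k, haus_gauge m.+1 1%R (F k) = +oo).
  by rewrite (nneseries_pinfty (fun n _ => gF n) _ Fk) // leey.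
pose dl k : R := if `[< F k !=set0 >] then fine (diam (F k)) else 0%R.
have dlE k : F k !=set0 -> diam (F k) = (dl k)%:E.
  move=> F0; rewrite /dl asboolT // fineK // ge0_fin_numE ?diam_ge0 // ltey.
  apply/negP => /eqP h; apply: Ffin; exists k; rewrite /haus_gauge h.
  by case: asboolP => // F0'; case: F0 => x; rewrite F0'.
have dl0 k : (0 <= dl k)%R.
  by rewrite /dl; case: asboolP => // /diam_ge0 h; exact: fine_ge0.
have gE k : F k !=set0 -> haus_gauge m.+1 1%R (F k) = (fine (@hcst R m.+1) * dl k ^+ m.+1)%:E.
  move=> F0; have h : haus_gauge m.+1 1%R (F k) != +oo by apply/negP => /eqP h; apply: Ffin; exists k.
  move: h; rewrite /haus_gauge; case: asboolP => [F0'|_]; first by case: F0 => x; rewrite F0'.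
  by rewrite dlE //; case: ifP => // _ _; rewrite EFinM hE EFin_expe.
have ex k : exists x, F k !=set0 -> F k x.
  by have [[x Fx]|h] := pselect (F k !=set0); [exists x | exists 0%R].
have [x hx] := choice ex.
have cv := @cube_cover_volume m.+1 (fun k => `[< F k !=set0 >])
  (fun k i => x k 0 (inord i) - dl k)%R (fun k i => x k 0 (inord i) + dl k)%R p s (ltW s0).
pose K := (fine (@hcst R m.+1) / 2 ^+ m.+1)%R.
have K0 : (0 <= K)%R by rewrite divr_ge0 ?exprn_ge0 // ltW.
have -> : c%:E = K%:E * (s ^+ m.+1)%:E.
  by rewrite -EFinM /c /K expr_div_n; congr EFin; ring.
apply: le_trans (lee_wpmul2l _ (cv _ _)) _; first by rewrite lee_fin.
- by move=> k i; have := dl0 k; lra.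
- move=> y hy; have [z Gz zy] := hG y hy; have [k _ Fz] := GF z Gz.
  have F0 : F k !=set0 by exists z.
  exists k; split; first exact/asboolP.
  move=> i im; have := diam_ge Fz (hx k F0); rewrite dlE // lee_fin => h.
  have := le_trans (coord_le_enorm (z - x k) (inord i)) h.
  by rewrite !mxE zy // ler_norml; lra.
rewrite -nneseriesZl //; last first.
  by move=> k _; case: ifP => // _; rewrite lee_fin; apply: prodr_ge0 => i _; have := dl0 k; lra.
apply: lee_nneseries => [k _ _|k _].
  by rewrite mule_ge0 ?lee_fin //; case: ifP => // _; rewrite lee_fin; apply: prodr_ge0 => i _; have := dl0 k; lra.
case: asboolP => [F0|_]; last by rewrite mule0.
rewrite gE // -EFinM lee_fin le_eqVlt; apply/orP; left; apply/eqP.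
rewrite (eq_bigr (fun=> 2 * dl k)%R); last by move=> i _; ring.
rewrite prodr_const card_ord exprMn /K; field.
by rewrite expf_neq0.
Qed.

End CubeCover.

Lemma cover_outer_finite {R : realType} {T : pointedType} (g : set T -> \bar R)
    (I : finType) (F : I -> set T) (X : set T) :
  g set0 = 0%E -> (forall A, (0 <= g A)%E) -> X `<=` \bigcup_(i in [set: I]) F i ->
  (cover_outer g X <= \sum_i g (F i))%E.
Proof.
move=> g0 g_ge0 XF.
pose F' (k : nat) : set T := if insub k is Some i then F (enum_val (i : 'I_#|I|)) else set0.
apply: le_trans (@cover_outer_cover _ _ g X F' _) _.
  move=> x /XF[i _ Fi]; exists (enum_rank i) => //.
  by rewrite /F' valK enum_rankK.
rewrite (nneseries_split 0%N #|I|) // [X in (_ + X)%E]eseries0 => [|k]; last first.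
  by rewrite add0n /F' => h _; rewrite insubF //; apply: negbTE; rewrite -leqNgt.
rewrite adde0 add0n big_mkord.
have -> : (\sum_i g (F i) = \sum_(k < #|I|) g (F (enum_val k)))%E.
  by rewrite -(big_enum_val (fun i => g (F i))).
by apply: lee_sum => i _; rewrite /F' valK.
Qed.

(** The hypothesis says that the set is a Lipschitz graph over the hyperplane orthogonal to axis j.
    A grid of M^m cells there cuts it into parts of diameter at most D/M, so the gauge sum is at
    most hcst D^m for every scale. *)
Lemma haus_graph_lty {R : realType} m (A : set 'rV[R]_m.+1) (p : 'rV[R]_m.+1) (rho K : R)
    (j : 'I_m.+1) : 0 < rho -> 0 < K ->
  (forall x, A x -> `|x - p| <= rho) ->
  (forall a b del, A a -> A b -> 0 <= del ->
     (forall i, i != j -> `|a 0 i - b 0 i| <= del) -> enorm (a - b) <= K * del) ->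
  (haus_outer m A < +oo)%E.
Proof.
move=> rho0 K0 Ap Agr.
have hE : ((fine (@hcst R m))%:E = @hcst R m)%E.
  by rewrite fineK // ge0_fin_numE ?hcst_lty // hcst_ge0.
have h0 : 0 <= fine (@hcst R m) by rewrite fine_ge0 // hcst_ge0.
apply: (@le_lt_trans _ _ ((fine (@hcst R m) * (2 * rho * K) ^+ m)%:E)%E); last exact: ltry.
apply: ge_ereal_sup => _ [r /= r0 <-].
pose D := 2 * rho * K.
have D0 : 0 < D by rewrite !mulr_gt0.
pose M := (Num.truncn (D / r)).+1.
have M0 : 0 < M%:R :> R by rewrite ltr0n.
have DM : D / M%:R <= r.
  rewrite ler_pdivrMr // mulrC -ler_pdivrMr //; apply: ltW; exact: truncnS_gt.
pose lo (k : nat) i := p 0 i - rho + 2 * rho * (k%:R / M%:R).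
pose F (f : {ffun 'I_m -> 'I_M}) : set 'rV[R]_m.+1 :=
  A `&` [set x | forall i : 'I_m, lo (f i) (lift j i) <= x 0 (lift j i) <= lo (f i).+1 (lift j i)].
have gF f : (haus_gauge m r (F f) <= (fine (@hcst R m) * (D / M%:R) ^+ m)%:E)%E.
  rewrite /haus_gauge; case: asboolP => [_|/eqP/set0P F0].
    by rewrite lee_fin mulr_ge0 // exprn_ge0 // divr_ge0 // ltW.
  have dF : (diam (F f) <= (D / M%:R)%:E)%E.
    apply: ge_ereal_sup => _ [a [Aa fa] [b [Ab fb] <-]]; rewrite lee_fin.
    have -> : D / M%:R = K * (2 * rho / M%:R) by rewrite /D; ring.
    apply: Agr => // [|i ij]; first by rewrite divr_ge0 // ltW // mulr_gt0.
    have [k -> _] := unlift_some (ltac:(by rewrite eq_sym) : j != i).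
    have loS : lo (f k).+1 (lift j k) = lo (f k) (lift j k) + 2 * rho / M%:R.
      by rewrite /lo -natr1; ring.
    have := fa k; have := fb k; rewrite loS.
    by rewrite ler_norml; lra.
  have dr : (diam (F f) <= r%:E)%E by apply: le_trans dF _; rewrite lee_fin.
  rewrite dr; have d0 := diam_ge0 F0.
  have dE : diam (F f) = (fine (diam (F f)))%:E.
    by rewrite fineK // ge0_fin_numE //; apply: le_lt_trans dr (ltry _).
  move: dF d0; rewrite dE !lee_fin => dF d0.
  rewrite -hE -EFin_expe -EFinM lee_fin; apply: ler_wpM2l => //.
  by apply: lerXn2r => //; rewrite nnegrE divr_ge0 // ltW.
apply: le_trans (@cover_outer_finite _ _ _ _ F A (@haus_gauge0 R m m.+1 r) (@haus_gauge_ge0 R m m.+1 r) _) _.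
  move=> x Ax.
  have ex (i : 'I_m) : exists k : 'I_M, lo k (lift j i) <= x 0 (lift j i) <= lo k.+1 (lift j i).
    have := le_trans (coord_le_norm (x - p) (lift j i)) (Ap x Ax).
    rewrite !mxE ler_norml => /andP[h1 h2].
    pose y := (x 0 (lift j i) - p 0 (lift j i) + rho) / (2 * rho) * M%:R.
    have r2 : 0 < 2 * rho by rewrite mulr_gt0.
    have y0 : 0 <= y by rewrite mulr_ge0 // ?divr_ge0 ?(ltW r2) //; lra.
    have yM : y <= M%:R.
      by rewrite /y ler_piMl // ?(ltW M0) // ler_pdivrMr //; lra.
    have xE : x 0 (lift j i) = p 0 (lift j i) - rho + 2 * rho * (y / M%:R).
      by rewrite /y; field; rewrite !gt_eqF.
    have key (k : 'I_M) : k%:R <= y <= k.+1%:R -> lo k (lift j i) <= x 0 (lift j i) <= lo k.+1 (lift j i).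
      move=> /andP[k1 k2]; rewrite xE /lo !lerD2l !(ler_pM2l r2) !ler_pM2r ?invr_gt0 //.
      by rewrite k1 k2.
    (* The cell index is the integer part of y, except at the upper end y = M, which belongs to the
       last cell. *)
    have [yMM|yMM] := ltP y M.-1%:R.
      have tl : (Num.truncn y < M)%N.
        by rewrite -(ltr_nat R); apply: le_lt_trans (lt_le_trans yMM _); rewrite ?truncn_le // ler_nat leq_pred.
      exists (Ordinal tl); apply: key => /=; rewrite truncn_le y0 /=.
      exact/ltW/truncnS_gt.
    by exists ord_max; apply: key; rewrite /= yMM.
  have [f hf] := choice ex.
  exists [ffun i => f i] => //; split => // i; rewrite ffunE; exact: hf.
apply: le_trans (lee_sum _ (fun f _ => gF f)) _.
rewrite sumEFin lee_fin sumr_const card_ffun !card_ord -[X in X <= _]mulr_natl natrX mulrCA.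
apply: ler_wpM2l => //; rewrite -exprMn le_eqVlt; apply/orP; left; apply/eqP; congr (_ ^+ _).
by rewrite /D; field; rewrite gt_eqF.
Qed.

Section LevelSetArea.
Context {R : realType} {m : nat} (psi : 'rV[R]_m.+1 -> R) (dpsi : 'I_m.+1 -> 'rV[R]_m.+1 -> R).
Local Notation V := 'rV[R]_m.+1.
Local Notation e_ j := (delta_mx 0 j : V).
Variable (O : set V).
Hypotheses (Dpsi : forall j x, is_derive x (e_ j) psi (dpsi j x))
  (cpsi : continuous psi) (cdpsi : forall j, continuous (dpsi j)) (oO : open O).
Let S : set V := [set x | O x /\ 0 <= psi x].
Let G : set V := [set x | O x /\ psi x = 0].
Hypotheses (cS : compact S) (gradG : forall x, G x -> exists j, dpsi j x != 0).

(** Near an interface point one partial derivative has size at least 3c. For [a], [b] on the level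
    set, changing only coordinate j of [a] alters [psi] by at least 3c |t|, and the other
    coordinates must compensate at slope at most C. So |t| is O(del), and finitely many balls cover
    the compact level set. *)
Lemma haus_level_lty : (haus_outer m G < +oo)%E.
Proof.
have [rho [c [C [rho0 c0 C0 H]]]] := level_uniform cpsi cdpsi oO cS gradG.
have loc p : G p -> (haus_outer m (G `&` [set x | (`|x - p| <= rho)%R]) < +oo)%E.
  move=> Gp; have [[j hj] near] := H p Gp.
  have K0 : 0 < m.+1%:R * (1 + C * m.+1%:R / (3 * c)).
    by rewrite mulr_gt0 // addr_gt0 // divr_gt0 // mulr_gt0.
  apply: (@haus_graph_lty _ _ _ p rho _ j rho0 K0); first by move=> x [].
  move=> a b del [[Oa a0] /= ap] [[Ob b0] /= bp] del0 ab.
  pose t := b 0 j - a 0 j.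
  (* [a'] has coordinate j of [b] and the others of [a], separating the change along axis j from the
     rest. *)
  pose a' := a + t *: e_ j.
  have a'E i : a' 0 i = if i == j then b 0 j else a 0 i.
    by rewrite !mxE eqxx /=; case: eqP => [->|_]; rewrite ?mulr1 ?mulr0 ?addr0 // /t addrC subrK.
  have cp x i : `|x - p| <= rho -> `|x 0 i - p 0 i| <= rho.
    by move=> h; have := le_trans (coord_le_norm (x - p) i) h; rewrite !mxE.
  have a'p : `|a' - p| <= rho.
    apply: norm_le_coord => [|i]; first exact: ltW.
    by rewrite mxE a'E mxE; case: eqP => [->|_]; exact: cp.
  have [th th01 e1] := mvt_line Dpsi a j t.
  have tj : 3 * c * `|t| <= C * (m.+1%:R * del).
    have far : `|a + (th * t) *: e_ j - p| <= 4 * rho.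
      have tr : `|t| <= 2 * rho.
        by have := cp a j ap; have := cp b j bp; rewrite /t !ler_norml; lra.
      rewrite addrAC; apply: le_trans (ler_normD _ _) _.
      have : `|(th * t) *: e_ j| <= 2 * rho.
        apply: norm_le_coord => [|i]; first by rewrite mulr_ge0 // ltW.
        rewrite !mxE eqxx /= normrM; apply: le_trans (_ : `|t| <= _) => //.
        apply: (@le_trans _ _ `|th * t|); last first.
          by rewrite normrM ler_piMl // ger0_norm; case/andP: th01.
        by rewrite ler_piMr //; case: (i == j); rewrite ?normr1 ?normr0.
      by move: ap; lra.
    have dj : 3 * c <= `|dpsi j (a + (th * t) *: e_ j)|.
      have := ((near _ far).2 j).1; have := lerB_dist (dpsi j p) (dpsi j (a + (th * t) *: e_ j)).
      by rewrite distrC; move: hj; lra.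
    have lip : `|psi b - psi a'| <= C * \sum_i `|b 0 i - a' 0 i|.
      apply: (partial_lipschitz Dpsi (p := p) (r := rho)) => // z hz i.
      by apply: ((near z _).2 i).2; move: hz; lra.
    have E : `|psi b - psi a'| = `|t| * `|dpsi j (a + (th * t) *: e_ j)|.
      by rewrite b0 distrC -a0 /a' e1 normrM.
    apply: (@le_trans _ _ (`|t| * `|dpsi j (a + (th * t) *: e_ j)|)).
      by rewrite mulrC; apply: ler_wpM2l.
    rewrite -E; apply: le_trans lip _; apply: ler_wpM2l; first exact: ltW.
    apply: (@le_trans _ _ (\sum_(i < m.+1) del)).
      apply: ler_sum => i _; rewrite a'E; case: eqP => [->|/eqP ij].
        by rewrite subrr normr0.
      by rewrite distrC; exact: ab.
    by rewrite sumr_const card_ord mulr_natl.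
  apply: le_trans (enorm_le_norm _) _; rewrite -mulrA; apply: ler_wpM2l => //.
  have c3 : 0 < 3 * c by rewrite mulr_gt0.
  have X0 : 0 <= C * m.+1%:R / (3 * c) * del.
    by rewrite mulr_ge0 // divr_ge0 ?mulr_ge0 // ltW.
  rewrite mulrDl mul1r; apply: norm_le_coord => [|i]; first by rewrite addr_ge0.
  rewrite !mxE; have [->|ij] := eqVneq i j; last by apply: le_trans (ab i ij) _; rewrite lerDl.
  rewrite distrC -/t; apply: (@le_trans _ _ (C * m.+1%:R / (3 * c) * del)); last by rewrite lerDr.
  rewrite mulrAC ler_pdivlMr // mulrC; apply: le_trans tj _.
  by rewrite mulrA.
have cG := level_compact cpsi cS.
have := cG; rewrite compact_cover => /(_ _ G (fun p : V => ball p rho)) [].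
- by move=> p _; exact: ball_open.
- by move=> p Gp; exists p => //; exact: ballxx.
move=> D DG GD.
pose s : seq V := finmap.enum_fset D.
have sub : G `<=` \bigcup_(p in [set` s]) (G `&` [set x | (`|x - p| <= rho)%R]).
  move=> x Gx; have [p Dp xp] := GD x Gx; exists p => //; split => //=.
  by rewrite distrC; apply: ltW; move: xp; rewrite -ball_normE.
apply: le_lt_trans (le_haus_outer m sub) _.
have fin (s' : seq V) : (forall p, p \in s' -> G p) ->
    (haus_om m m.+1 (\bigcup_(p in [set` s']) (G `&` [set x | (`|x - p| <= rho)%R])) < +oo)%E.
  elim: s' => [|p s' ih] sG.
    by rewrite bigcup0 ?outer_measure0 //= => i; rewrite in_nil.
  have us : \bigcup_(q in [set` p :: s']) (G `&` [set x | (`|x - q| <= rho)%R]) `<=`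
      (G `&` [set x | (`|x - p| <= rho)%R]) `|`
      \bigcup_(q in [set` s']) (G `&` [set x | (`|x - q| <= rho)%R]).
    move=> x [q /=]; rewrite inE => /orP[/eqP -> h|qs h]; first by left.
    by right; exists q.
  apply: le_lt_trans (le_outer_measure (haus_om m m.+1) _ _ us) _.
  apply: le_lt_trans (outer_measureU2 _ _ _) _.
  apply: lte_add_pinfty; first by apply: loc; apply: sG; rewrite mem_head.
  by apply: ih => q qs; apply: sG; rewrite inE qs orbT.
apply: fin => p pD.
exact: (set_mem (DG p pD)).
Qed.

End LevelSetArea.

Section InterfaceArea.
Context {R : realType}.

(** In contrast to [solid_crossing], the crossing point is kept on the line, so that its projection
    along that line is known. *)
Lemma solid_exit {d} (P : problem R d) (y z : 'rV[R]_d) : continuous_problem P ->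
  solid P y -> ~ solid P z ->
  exists th : R, Gam P 0 (y + th *: (z - y)).
Proof.
move=> hP Sy Sz.
have cS : closed (solid P).
  by apply: compact_closed; [exact: norm_hausdorff | exact: solid_compact].
have [th [/andP[th0 th1] [Ow pw] hout]] := last_exit cS Sy Sz.
exists th; split => //; apply/eqP; rewrite eq_le pw andbT leNgt; apply/negP => pos.
pose l (t : R) := y + t *: (z - y).
have cl : {for th, continuous l} by exact: line_continuous.
have nO : \forall t \near th, Otilde P (l t).
  by apply: (cl (Otilde P)); move: (Otilde_open hP); rewrite openE; apply.
have np : \forall t \near th, 0 < phi P 0 (l t).
  have : {for th, continuous (phi P 0 \o l)}.
    by apply: continuous_comp => //; exact: (phi0_continuous hP).
  by move=> c; exact: (c _ (lt_nbhsr pos)).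
have [e /= e0 he] := filterI nO np.
pose t := Num.min 1 (th + e / 2).
have tth : th < t by rewrite lt_min th1 ltrDl divr_gt0.
have te : `|th - t| < e.
  rewrite distrC gtr0_norm ?subr_gt0 // ltrBlDl; apply: (@le_lt_trans _ _ (th + e / 2)); first by rewrite /t ge_min lexx orbT.
  by rewrite ltrD2l; lra.
have [Ot pt] := he t te.
by apply: (hout t); [rewrite tth ge_min lexx | split => //; exact: ltW].
Qed.

(** A cube around a point of the open set [Sig P 0] is swept along the last axis: each line leaves
    the bounded domain, hence crosses the interface, whose projection thus contains a cube. *)
Lemma haus_Gam0_gt0 m (P : problem R m.+2) : continuous_problem P ->
  (0 < haus_outer m.+1 (Gam P 0))%E.
Proof.
move=> hP; have [[[oO _] _ _ /(_ 0 (Iclosed0 hP))[[x0 [Ox0 px0]] _ _ _ _]] _ _] := hP.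
have oS : open [set x | Otilde P x /\ 0 < phi P 0 x].
  apply: openI => //; apply: (@open_comp _ _ (phi P 0) [set t | 0 < t]); last exact: open_gt.
  by move=> x _; exact: (phi0_continuous hP).
have : nbhs x0 [set x | Otilde P x /\ 0 < phi P 0 x].
  by move: oS; rewrite openE; apply.
move=> /nbhs_ballP[e /= e0 be].
have e2 : 0 < e / 2 by rewrite divr_gt0.
have [M M0 hM] := bounded_Otilde hP.
apply: (@haus_projection_gt0 _ m _ (fun i => x0 0 (inord i)) _ e2) => x hx.
pose y : 'rV[R]_m.+2 := \row_i (if (i < m.+1)%N then x i else x0 0 i).
have Sy : solid P y.
  have : ball x0 e y.
    rewrite -ball_normE /=; apply: (@le_lt_trans _ _ (e / 2)); last by lra.
    apply: norm_le_coord => [|i]; first exact: ltW.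
    rewrite !mxE; case: ltnP => im; last by rewrite subrr normr0 ltW.
    by have := hx i im; rewrite inord_val ler_norml; lra.
  by move=> /be[Oy py]; split => //; exact: ltW.
(* Points of the domain have coordinates at most M in size, so this shift certainly leaves it. *)
pose z := y + (M + M + 1) *: (delta_mx 0 ord_max : 'rV[R]_m.+2).
have Sz : ~ solid P z.
  move=> [Oz _]; have [Oy _] := Sy.
  have := le_trans (coord_le_norm z ord_max) (hM z Oz).
  have := le_trans (coord_le_norm y ord_max) (hM y Oy).
  have -> : z 0 ord_max = y 0 ord_max + (M + M + 1).
    by rewrite [LHS]mxE; congr (_ + _); rewrite !mxE !eqxx mulr1.
  by move: (y 0 ord_max) => t; rewrite !ler_norml; lra.
have [th Gw] := solid_exit hP Sy Sz.
exists (y + th *: (z - y)) => // i im.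
have iv : (inord i : 'I_m.+2) = i :> nat by rewrite inordK // leqW.
rewrite /z [_ + _ - y]addrAC subrr add0r !mxE eqxx iv im /=.
by rewrite (_ : (inord i == ord_max) = false) ?mulr0 ?addr0 // -val_eqE /= iv ltn_eqF.
Qed.

Lemma surf_Gam0 {d} (P : problem R d) : (1 < d)%N -> continuous_problem P ->
  (0 < haus_outer d.-1 (Gam P 0) < +oo)%E.
Proof.
case: d P => [|[|m]] P // _ hP; rewrite haus_Gam0_gt0 //=.
exact: (haus_level_lty (phi0_derive hP) (phi0_continuous hP)
  (phi0_partial_continuous hP) (Otilde_open hP) (solid_compact hP) (gradG0 hP)).
Qed.

Lemma area_gt0 {d} (P : problem R d) : (1 < d)%N -> continuous_problem P -> 0 < area P.
Proof.
by move=> d1 hP; apply: fine_gt0; exact: surf_Gam0.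
Qed.

Lemma surf_GamD_lty {d} (P : problem R d) (c : 'rV[R]_d) : (1 < d)%N -> continuous_problem P ->
  (surf d (GamD P c) < +oo)%E.
Proof.
move=> d1 hP; have /andP[_] := surf_Gam0 d1 hP.
by rewrite -(haus_outer_translate _ c).
Qed.

End InterfaceArea.

(** * Integrability on the interface and the force pairing *)

Lemma continuous_within_integrable {R : realType} {n : nat}
    (mu : {outer_measure set 'rV[R]_n -> \bar R}) (K : set 'rV[R]_n) (f : 'rV[R]_n -> R) :
  (forall i t, mu.-caratheodory [set x : 'rV[R]_n | x 0 i <= t]) ->
  compact K -> (mu K < +oo)%E -> {within K, continuous f} ->
  ((mu : set (caratheodory_type mu) -> \bar R) :
    {measure set (caratheodory_type mu) -> \bar R}).-integrable K (EFin \o f).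
Proof.
move=> half cK Kfin cf.
have mK : measurable (K : set (borel R n)).
  by apply: closed_borel; apply: compact_closed => //; exact: norm_hausdorff.
apply: (measurable_bounded_integrable (caratheodory_borel half mK) Kfin).
  by apply: caratheodory_fun_borel => //; exact: continuous_measurable_borel.
have /compact_bounded[M [_ hM]] := continuous_compact cf cK.
exists (M + 1); split; first exact: num_real.
move=> t Mt x Kx; apply: le_trans (hM (M + 1) _ _ _) (ltW Mt).
  by rewrite ltrDl.
by exists x.
Qed.

Lemma haus_integrable_off_null {R : realType} {m n : nat} (A N : set 'rV[R]_n)
    (f : 'rV[R]_n -> R) : measurable (A : set (borel R n)) -> measurable (N : set (borel R n)) ->
  haus m n N = 0%E -> N `<=` A -> (haus m n).-integrable (A `\` N) (EFin \o f) ->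
  (haus m n).-integrable A (EFin \o f).
Proof.
move=> mA mN N0 NA fi; have hA := haus_borel m mA; have hN := haus_borel m mN.
have hAN : measurable ((A `\` N) : set (caratheodory_type (haus_om m n))) by exact: measurableD.
apply/(negligible_integrable hN hA _ N0) => //.
have -> : A = (A `\` N) `|` N by rewrite setUC setDUK.
apply/measurable_funU => //; split; first exact: measurable_int fi.
move=> _ Y mY; apply: (@measure_is_complete_caratheodory R _ (haus_om m n)).
by exists N; split => // x [].
Qed.

Section InterfacePairing.
Context {R : realType} {d : nat} (P : problem R d) (T : mesh R d).
Local Notation V := 'rV[R]_d.
Local Notation e_ j := (delta_mx 0 j : V).
Variables (k : nat) (r : R) (c : V).
Hypotheses (hP : continuous_problem P) (d1 : (1 < d)%N)
  (hT : simplicial_mesh T (Otilde P)) (r0 : 0 <= r) (hc : admissible P c).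

Lemma GamD_preimage x : GamD P c x <-> Gam P 0 (x - c).
Proof. by rewrite /GamD translate_preimage. Qed.

Lemma GamD_closed : closed (GamD P c).
Proof.
rewrite /GamD translate_preimage; apply: preimage_closed.
  by move=> x _; exact: subr_continuous.
apply: compact_closed; first exact: norm_hausdorff.
exact: (level_compact (phi0_continuous hP) (solid_compact hP)).
Qed.

(** Interface points are limits of bulk points: step along the axis of a nonzero partial derivative,
    in the direction lowering the level set function. This places the interface in the active patch,
    where [u] is continuous. *)
Lemma GamD_near_bulk : GamD P c `<=` near_bulk P r c.
Proof.
move=> x Gx; have Gp := (GamD_preimage x).1 Gx; set p := x - c in Gp.
have Ox : Otilde P x by apply: hc; right.
have [rho [c1 [C [rho0 c10 C0 H]]]] := level_uniform (phi0_continuous hP)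
  (phi0_partial_continuous hP) (Otilde_open hP) (solid_compact hP) (gradG0 hP).
have [[j hj] near] := H p Gp.
apply/dist_leP => s rs; have s0 : 0 < s by apply: le_lt_trans r0 rs.
have : nbhs x (Otilde P) by move: (Otilde_open hP); rewrite openE; apply.
move=> /nbhs_ballP[e /= e0 be].
(* The three bounds keep the step where the slope is controlled, inside [Otilde], and shorter than s
   in the Euclidean norm. *)
pose t := Num.min rho (Num.min (e / 2) (s / (d%:R + 1))).
have d1' : 0 < d%:R + 1 :> R by rewrite ltr_pwDr.
have t0 : 0 < t by rewrite !lt_min rho0 !divr_gt0.
have trho : t <= rho by rewrite /t ge_min lexx.
have te : t <= e / 2 by rewrite /t !ge_min lexx orbT.
have ts : t <= s / (d%:R + 1) by rewrite /t !ge_min lexx !orbT.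
pose D := partial j (phi P 0) p.
pose u := - Num.sg D * t.
have D0 : D != 0 by rewrite -normr_gt0; apply: lt_le_trans hj; rewrite mulr_gt0.
have ut : `|u| = t by rewrite /u normrM normrN normr_sg D0 mul1r gtr0_norm.
have ue (a : R) : `|(a * u) *: e_ j| <= `|a| * t.
  apply: norm_le_coord => [|i]; first by rewrite mulr_ge0 // ltW.
  rewrite !mxE eqxx /= normrM [`|a * u|]normrM ut ler_piMr ?mulr_ge0 ?(ltW t0) //.
  by case: (i == j); rewrite ?normr1 ?normr0.
have ue1 : `|u *: e_ j| <= t by have := ue 1; rewrite mul1r normr1 mul1r.
exists (x + u *: e_ j).
  rewrite OmDE translate_preimage; split.
    apply: be; rewrite -ball_normE /= opprD addrA subrr add0r normrN.
    by apply: le_lt_trans ue1 _; apply: le_lt_trans te _; lra.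
  move=> /= [_]; apply/negP; rewrite -ltNge addrAC -/p.
  have [th th01] := mvt_line (phi0_derive hP) p j u.
  have [_ p0] := Gp; rewrite p0 subr0 => ->.
  have thu : `|p + (th * u) *: e_ j - p| <= 4 * rho.
    rewrite addrAC subrr add0r; apply: le_trans (ue th) _.
    apply: (@le_trans _ _ t); last by lra.
    by rewrite ler_piMl ?(ltW t0) // ger0_norm; case/andP: th01.
  have := ((near _ thu).2 j).1; set D' := partial j _ _ => hD'.
  have : 0 < Num.sg D * D'.
    move: hj hD'; rewrite -/D.
    by case: (ltgtP D 0) D0 => // hD _; rewrite ?(gtr0_sg hD) ?(ltr0_sg hD) ?(gtr0_norm hD) ?(ltr0_norm hD) ler_norml; lra.
  by rewrite /u mulNr mulNr oppr_lt0 mulrAC => h; exact: mulr_gt0.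
rewrite opprD addrA subrr add0r; apply: le_lt_trans (enorm_le_norm _) _.
rewrite normrN; apply: (@le_lt_trans _ _ (d%:R * (s / (d%:R + 1)))).
  by apply: ler_wpM2l => //; apply: le_trans ue1 ts.
by rewrite mulrCA gtr_pMr // ltr_pdivrMr // mul1r ltrDl.
Qed.

Lemma GamD_sub_Oact : GamD P c `<=` Oact P T r c.
Proof.
move=> x Gx; apply: (strip_sub_Oact hT); split; last exact: GamD_near_bulk.
by apply: hc; right.
Qed.

(** By definition an uncut element meets the interface in surface measure 0, and there are finitely
    many. The multiplier is unconstrained on this part. *)
Lemma GamD_uncut_null : surf d (GamD P c `\` Ocut P T c) = 0%E.
Proof.
pose F (e : 'I_(nel T)) := if `[< cut_elem P c e >] then set0 else elem e `&` GamD P c.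
have F0 e : surf d (F e) = 0%E.
  rewrite /F; case: asboolP => [_|h]; first exact: measure0.
  by apply/eqP; rewrite eq_le measure_ge0 andbT leNgt; apply/negP.
have sub : GamD P c `\` Ocut P T c `<=` \bigcup_(e in [set` enum 'I_(nel T)]) F e.
  move=> x [Gx nx]; have [e ex] : exists e : 'I_(nel T), elem e x.
    by apply: (Otilde_elem hT); apply: hc; right.
  exists e; first by rewrite /= mem_enum.
  rewrite /F; case: asboolP => [ce|_] //.
  by apply: nx; exists e.
apply/eqP; rewrite eq_le measure_ge0 andbT.
apply: le_trans (le_haus_outer d.-1 sub) _; rewrite bigcup_seq.
elim/big_ind: _ => [|A B A0 B0|e _]; first by rewrite haus_outer0.
  by apply: le_trans (outer_measureU2 (haus_om d.-1 d) A B) _; rewrite -[leRHS]adde0; exact: leeD.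
by have -> : haus_outer d.-1 (F e) = 0%E by exact: F0.
Qed.

Lemma sint_GamD_integrable (lam v : V -> V) : Nh P T k c lam ->
  {within GamD P c, continuous v} ->
  (surf d).-integrable (GamD P c) (EFin \o (fun x => dotv (lam x) (v x))).
Proof.
move=> [clam _] cv.
have mG := closed_borel GamD_closed; have mC : measurable (Ocut P T c : set (borel R d)).
  exact: (patch_borel hT).
apply: (haus_integrable_off_null mG (measurableD mG mC)).
- exact: GamD_uncut_null.
- by move=> x [].
rewrite setDD; apply: (@continuous_within_integrable _ _ (haus_om d.-1 d)).
- exact: haus_halfspace.
- apply: (@subclosed_compact _ _ (Ocut P T c)); [|exact: (patch_compact hT)|by move=> x []].
  apply: closedI; [exact: GamD_closed | exact: (patch_closed hT)].
- by apply: le_lt_trans (surf_GamD_lty c d1 hP); apply: le_haus_outer => x [].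
- by apply: dotv_continuous_within; [apply: continuous_subspaceW clam | apply: continuous_subspaceW cv] => x [].
Qed.

(** Identifies the discrete force tested with [xi] as a part of b(lam, u), so that it cancels in the
    energy balance. Splitting the integral is legitimate only because both parts are integrable. *)
Lemma bh_sub_const (lam u : V -> V) (xi : V) : Nh P T k c lam -> Vh P T k r c u ->
  bh P c lam u = bh P c lam (fun x => u x - xi) +
    dotv (\row_i sint (GamD P c) (component lam i)) xi.
Proof.
move=> hl [[cu _] _].
have cuG : {within GamD P c, continuous u}.
  by apply: continuous_subspaceW cu; exact: GamD_sub_Oact.
have mG := haus_borel d.-1 (closed_borel GamD_closed).
have cc (z : V) : {within GamD P c, continuous (fun=> z)} by move=> x; exact: cst_continuous.
have i1 : (surf d).-integrable (GamD P c) (EFin \o (fun x => dotv (lam x) (u x - xi))).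
  apply: sint_GamD_integrable => //; move=> x; apply: continuousB; [exact: cuG|exact: cc].
have i2 := sint_GamD_integrable hl (cc xi).
transitivity (bh P c lam (fun x => u x - xi) + sint (GamD P c) (fun x => dotv (lam x) xi)).
  rewrite /bh /sint -RintegralD //; apply: eq_Rintegral => x _.
  by rewrite /dotv -big_split /=; apply: eq_bigr => i _; rewrite !mxE; ring.
congr (_ + _).
have li (i : 'I_d) : (surf d).-integrable (GamD P c) (EFin \o component lam i).
  have := sint_GamD_integrable hl (cc (delta_mx 0 i)).
  apply: eq_integrable => // x _ /=; congr EFin.
  rewrite /dotv (bigD1 i) //= big1 => [|j ji]; rewrite !mxE ?eqxx ?mulr1 ?addr0 //.
  by rewrite (negbTE ji) mulr0.
have : forall s : seq 'I_d,
    (surf d).-integrable (GamD P c) (EFin \o (fun x => \sum_(i <- s) lam x 0 i * xi 0 i)) /\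
    sint (GamD P c) (fun x => \sum_(i <- s) lam x 0 i * xi 0 i) =
    \sum_(i <- s) sint (GamD P c) (component lam i) * xi 0 i.
  elim=> [|i s [ih1 ih2]].
    split; first by under eq_fun do rewrite big_nil; exact: integrable0.
    by rewrite big_nil /sint /Rintegral integral0_eq // => x _; rewrite big_nil.
  have li' : (surf d).-integrable (GamD P c) (EFin \o (fun x => xi 0 i * component lam i x)).
    exact: (integrableZl mG (xi 0 i) (li i)).
  have E : (fun x => \sum_(j <- i :: s) lam x 0 j * xi 0 j) =
      (fun x => xi 0 i * component lam i x + \sum_(j <- s) lam x 0 j * xi 0 j).
    by apply/funext => x; rewrite big_cons mulrC.
  rewrite E; split; first exact: (integrableD mG li' ih1).
  by rewrite /sint RintegralD // RintegralZl // big_cons -ih2 mulrC.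
move=> /(_ (index_enum 'I_d))[_ ->].
by rewrite /dotv; apply: eq_bigr => i _; rewrite mxE.
Qed.

End InterfacePairing.

(** * Discrete Gronwall, one time step, and conclusion *)

(** The growth factor (1 + C tau)/(1 - 2 tau) is at most 1/(1 - tau (C + 2)) = 1 + tau (C + 2)/(1 -
    tau (C + 2)), which is below the exponential; this fixes the form of the exponent. *)
Lemma discrete_gronwall {R : realType} (W : nat -> R) (C b tau : R) (N : nat) :
  0 <= C -> 0 <= b -> 0 <= tau -> tau * (C + 2) < 1 -> 0 <= W 0%N ->
  (forall n, (n < N)%N -> (1 - 2 * tau) * W n.+1 <= (1 + C * tau) * W n + tau * b) ->
  forall m, (m <= N)%N ->
  W m <= expR (m%:R * tau * ((C + 2) / (1 - tau * (C + 2)))) * (W 0%N + m%:R * tau * b).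
Proof.
move=> C0 b0 t0 tC W00 hW.
have Ct0 : 0 <= tau * C by rewrite mulr_ge0.
have q0 : 0 < 1 - 2 * tau by move: tC; rewrite mulrDr; lra.
have r0 : 0 < 1 - tau * (C + 2) by lra.
pose a := (1 + C * tau) / (1 - 2 * tau).
have a1 : 1 <= a by rewrite /a ler_pdivlMr //; lra.
have ainv : (1 - 2 * tau)^-1 <= a by rewrite /a ler_peMl ?invr_ge0 ?(ltW q0) //; lra.
have ae : a <= expR (tau * ((C + 2) / (1 - tau * (C + 2)))).
  apply: le_trans (expR_ge1Dx _).
  have -> : 1 + tau * ((C + 2) / (1 - tau * (C + 2))) = (1 - tau * (C + 2))^-1.
    by field; rewrite gt_eqF.
  rewrite /a ler_pdivrMr // [leRHS]mulrC ler_pdivlMr //.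
  have : 0 <= C * (C + 2) * tau ^+ 2 by rewrite !mulr_ge0 // ?exprn_ge0 //; lra.
  lra.
have a0 : 0 <= a by lra.
have key m : (m <= N)%N -> W m <= a ^+ m * (W 0%N + m%:R * tau * b).
  elim: m => [|m ih] mN; first by rewrite expr0 !mul0r addr0 mul1r.
  have h : W m.+1 <= a * W m + (1 - 2 * tau)^-1 * (tau * b).
    have := hW m mN; rewrite -ler_pdivlMl // => /le_trans; apply.
    by rewrite mulrDr mulrA /a [_^-1 * (1 + _)]mulrC.
  apply: le_trans h _; have := ler_wpM2l a0 (ih (ltnW mN)); rewrite mulrA -exprS => h.
  have h2 : (1 - 2 * tau)^-1 * (tau * b) <= a ^+ m.+1 * (tau * b).
    apply: ler_wpM2r; first by rewrite mulr_ge0.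
    apply: le_trans ainv _; rewrite exprS ler_peMr //; exact: exprn_ege1.
  have -> : a ^+ m.+1 * (W 0%N + m.+1%:R * tau * b) =
      a ^+ m.+1 * (W 0%N + m%:R * tau * b) + a ^+ m.+1 * (tau * b).
    by rewrite -natr1; ring.
  exact: lerD.
move=> m mN; apply: le_trans (key m mN) _.
apply: ler_wpM2r; first by rewrite addr_ge0 // !mulr_ge0.
rewrite -mulrA expRM_natl.
by apply: lerXn2r => //; rewrite nnegrE // expR_ge0.
Qed.

Section EnergyStep.
Context {R : realType} {d : nat} (P : problem R d) (T : mesh R d).
Local Notation V := 'rV[R]_d.

Lemma dotv_young (x y : V) : 2 * dotv x y <= dotv x x + dotv y y.
Proof.
rewrite /dotv mulr_sumr -big_split /=; apply: ler_sum => i _.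
by have := sqr_ge0 (x 0 i - y 0 i); rewrite sqrrB !expr2; lra.
Qed.

Lemma dotv_increment (x y : V) : dotv x x - dotv y y <= 2 * dotv (x - y) x.
Proof.
rewrite /dotv mulr_sumr -sumrB; apply: ler_sum => i _; rewrite !mxE.
by have := sqr_ge0 (x 0 i - y 0 i); rewrite sqrrB !expr2; lra.
Qed.

Lemma dotv0l (x : V) : dotv 0 x = 0.
Proof. by rewrite /dotv big1 // => i _; rewrite mxE mul0r. Qed.

Lemma dotvDl (x y z : V) : dotv (x + y) z = dotv x z + dotv y z.
Proof. by rewrite /dotv -big_split; apply: eq_bigr => i _; rewrite mxE mulrDl. Qed.

Lemma fe_space0 k (A : set 'I_(nel T)) : fe_space k A (fun=> (0 : V)).
Proof.
split; first by move=> x; exact: cst_continuous.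
move=> e _; exists (fun=> 0) => // i; exists (fun=> 0) => x.
by rewrite /component mxE big1 // => a _; rewrite mul0r.
Qed.

Lemma bh0l c (v : V -> V) : bh P c (fun=> 0) v = 0.
Proof.
rewrite /bh /sint /Rintegral integral0_eq // => x _; by rewrite dotv0l.
Qed.

Lemma jh0r h c (lam : V -> V) : jh P T h c lam (fun=> 0) = 0.
Proof.
rewrite /jh /vint /Rintegral integral0_eq ?mulr0 // => x _; congr EFin.
have g0 : grad (fun=> (0 : V)) x = 0.
  apply/matrixP => i j; rewrite !mxE /partial (_ : component _ i = cst 0) ?derive_cst //.
  by apply/funext => y; rewrite /component mxE.
rewrite /dotv big1 // => i _; rewrite [X in _ * X]mxE big1 ?mulr0 // => j _.
by rewrite g0 [X in _ * X]mxE mulr0.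
Qed.

Lemma jh_ge0 h c (lam : V -> V) : 0 <= jh P T h c lam lam.
Proof. by rewrite mulr_ge0 ?sqr_ge0 //; apply: Rintegral_ge0 => x _; exact: dotv_ge0. Qed.

Lemma ih_ge0 k h r c (v : V -> V) : 0 <= ih P T k h r c v v.
Proof.
rewrite mulr_ge0 ?invr_ge0 ?sqr_ge0 //; do 2 (apply: sumr_ge0 => ? _).
by apply: Rintegral_ge0 => x _; exact: dotv_ge0.
Qed.

Lemma continuous_within_leb_integrable (K A : set V) (f : V -> R) : compact K ->
  A `<=` K -> measurable (A : set (borel R d)) ->
  {within K, continuous f} -> (leb d).-integrable A (EFin \o f).
Proof.
move=> cK AK mA cf.
have mK : measurable (K : set (borel R d)).
  by apply: closed_borel; apply: compact_closed => //; exact: norm_hausdorff.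
apply: (integrableS (leb_borel mK) (leb_borel mA) AK).
have Kfin : (leb d K < +oo)%E.
  have /compact_bounded[M [_ hM]] := cK.
  apply: (@leb_bounded_lty _ _ _ (`|M| + 1)) => [|x Kx]; first by rewrite addr_ge0.
  by apply: hM => //; rewrite ltr_pwDr // ler_norm.
by apply: (@continuous_within_integrable _ _ (leb_om d)) => //; exact: leb_halfspace.
Qed.

Lemma sqnorm_increment (K A : set V) (u u' : V -> V) : compact K ->
  A `<=` K -> measurable (A : set (borel R d)) ->
  {within K, continuous u} -> {within K, continuous u'} ->
  sqnorm A u - sqnorm A u' <= 2 * vint A (fun x => dotv (u x - u' x) (u x)).
Proof.
move=> cK AK mA cu cu'; have hA := leb_borel mA.
have cd : {within K, continuous (fun x => u x - u' x)}.
  by move=> x; apply: continuousB; [exact: cu | exact: cu'].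
have i1 := continuous_within_leb_integrable cK AK mA (dotv_continuous_within cu cu).
have i2 := continuous_within_leb_integrable cK AK mA (dotv_continuous_within cu' cu').
have i3 := continuous_within_leb_integrable cK AK mA (dotv_continuous_within cd cu).
rewrite /sqnorm /vint -RintegralB // -RintegralZl //.
apply: le_Rintegral => //.
- exact: (integrableB hA i1 i2).
- exact: (integrableZl hA 2 i3).
- by move=> x _; exact: dotv_increment.
Qed.

Lemma sqnorm_le (A B K : set V) (u : V -> V) : compact K -> A `<=` B -> B `<=` K ->
  measurable (A : set (borel R d)) -> measurable (B : set (borel R d)) ->
  {within K, continuous u} -> sqnorm A u <= sqnorm B u.
Proof.
move=> cK AB BK mA mB cu.
have iB := continuous_within_leb_integrable cK BK mB (dotv_continuous_within cu cu).
have iA := integrableS (leb_borel mB) (leb_borel mA) AB iB.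
rewrite /sqnorm /vint /Rintegral fine_le //.
- exact: (integrable_fin_num (leb_borel mA) iA).
- exact: (integrable_fin_num (leb_borel mB) iB).
apply: ge0_subset_integral => //.
- exact: leb_borel.
- exact: leb_borel.
- exact: measurable_int iB.
- by move=> x _; rewrite lee_fin dotv_ge0.
Qed.

Lemma tnorm_sq_ge h r c (v : V -> V) : sqgrad (Oact P T r c) v <= tnorm_sq P T h r c v.
Proof. by rewrite /tnorm_sq lerDl; apply: Rintegral_ge0 => x _; exact: dotv_ge0. Qed.

Lemma winf_ge0 : continuous_problem P -> 0 <= winf P.
Proof.
move=> hP; apply: fine_ge0.
have : (0 <= Linfnorm (surf d) (Gam P 0) (fun x => dotv (sol_xi P 0) (nrm P 0 x)))%E.
  exact: Lnorm_ge0.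
move=> /le_trans; apply; apply: ereal_sup_ubound; exists 0 => //.
exact: Iclosed0.
Qed.

Hypotheses (hP : continuous_problem P) (d1 : (1 < d)%N)
  (hT : simplicial_mesh T (Otilde P)).

(** The factor 1 - 2 dt comes from Young's inequality: both g.xi and xi.chi cost dt |xi|^2. The
    coefficient 1/cgp is the ghost-penalty equivalence, with K bounded by the penalty parameter. *)
Lemma energy_step k h r (c c' : V) (u u' lam : V -> V) (xi xi' : V)
    (ggp gl dt : R) (K : nat) (cgp : R) :
  0 <= r -> 0 < dt -> 0 < cgp -> 0 <= gl -> K%:R <= ggp ->
  admissible P c -> admissible P c' ->
  OmD P c `<=` strip P r (OmD P c') ->
  Vh P T k r c u -> Vh P T k r c' u' -> Nh P T k c lam ->
  ghost_equivalence P T k K cgp h r c ->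
  (forall (v mu : V -> V) (z1 z2 : V), Vh P T k r c v -> Nh P T k c mu ->
    dt^-1 * vint (OmD P c) (fun x => dotv (u x - u' x) (v x)) +
    ah P c u v + bh P c lam v + bh P c mu (fun x => u x - xi) +
    ggp * ih P T k h r c u v - gl * jh P T h c lam mu +
    dt^-1 * dotv (xi - xi') z1 + dt^-1 * dotv (c - c') z2 =
    dotv (\row_i sint (GamD P c) (component lam i) + grav P) z1 + dotv xi z2) ->
  (1 - 2 * dt) * (sqnorm (OmD P c) u + enorm xi ^+ 2 + enorm c ^+ 2) +
    2 * dt * (cgp^-1 * sqgrad (Oact P T r c) u + gl * jh P T h c lam lam) <=
  sqnorm (strip P r (OmD P c')) u' + enorm xi' ^+ 2 + enorm c' ^+ 2 +
    dt * enorm (grav P) ^+ 2.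
Proof.
move=> r0 dt0 cgp0 gl0 Kg hc hc' Om hu hu' hl hgh E.
have N0 : Nh P T k c (fun=> (0 : V)) by exact: fe_space0.
have E0 := E u _ xi c hu N0.
have E1 := E u lam xi c hu hl.
rewrite bh0l jh0r in E0.
have B := bh_sub_const hP d1 hT r0 hc xi hl hu.
rewrite (dotvDl _ (grav P)) in E0 E1.
have Iu : sqnorm (OmD P c) u - sqnorm (OmD P c) u' <=
    2 * vint (OmD P c) (fun x => dotv (u x - u' x) (u x)).
  (* Both functions are continuous on the intersection of the two active patches, which contains the
     new bulk since that lies in the old strip. *)
  apply: (@sqnorm_increment (Oact P T r c `&` Oact P T r c')).
  - apply: (@subclosed_compact _ _ (Oact P T r c)); [|exact: (patch_compact hT)|by move=> x []].
    by apply: closedI; exact: (patch_closed hT).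
  - by move=> x Ox; split; [exact: OmD_sub_Oact | exact: strip_sub_Oact (Om x Ox)].
  - by apply: open_borel; exact: OmD_open.
  - by apply: continuous_subspaceW hu.1.1 => x [].
  - by apply: continuous_subspaceW hu'.1.1 => x [].
have mS : measurable (strip P r (OmD P c') : set (borel R d)).
  apply: measurableI; first by apply: open_borel; exact: Otilde_open.
  by apply: closed_borel; exact: dist_le_closed.
have Is : sqnorm (OmD P c) u' <= sqnorm (strip P r (OmD P c')) u'.
  apply: (@sqnorm_le _ _ (Oact P T r c')) => //.
  - exact: (patch_compact hT).
  - exact: strip_sub_Oact.
  - by apply: open_borel; exact: OmD_open.
  - exact: hu'.1.1.
have G := (hgh u hu).1.
have Gc : cgp^-1 * sqgrad (Oact P T r c) u <= ah P c u u + ggp * ih P T k h r c u u.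
  rewrite ler_pdivrMl //; apply: le_trans G _; apply: ler_wpM2l; first exact: ltW.
  by rewrite lerD2l; apply: ler_wpM2r => //; exact: ih_ge0.
have X := dotv_increment xi xi'.
have C := dotv_increment c c'.
have Yg := dotv_young (grav P) xi.
have Yc := dotv_young xi c.
have J0 := mulr_ge0 gl0 (jh_ge0 h c lam).
have S0 := sqnorm_ge0 (OmD P c) u.
have Xi0 := dotv_ge0 xi.
have C0 := dotv_ge0 c.
rewrite !enorm_sqr.
have F : vint (OmD P c) (fun x => dotv (u x - u' x) (u x)) + dotv (xi - xi') xi +
    dotv (c - c') c + dt * (ah P c u u + ggp * ih P T k h r c u u) +
    dt * (gl * jh P T h c lam lam) = dt * (dotv (grav P) xi + dotv xi c).
  have E2 : dt^-1 * (vint (OmD P c) (fun x => dotv (u x - u' x) (u x)) +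
      dotv (xi - xi') xi + dotv (c - c') c) =
      dotv (grav P) xi + dotv xi c - (ah P c u u + ggp * ih P T k h r c u u) -
      gl * jh P T h c lam lam by lra.
  have := congr1 (fun z => dt * z) E2; rewrite /= mulVKf ?gt_eqF // => ->.
  by ring.
have := ler_wpM2l (ltW dt0) Gc.
have := ler_wpM2l (ltW dt0) Yg; have := ler_wpM2l (ltW dt0) Yc.
move: F Iu Is X C; rewrite !mulrDr; nra.
Qed.

End EnergyStep.

(** Of the dissipation 2 dt ca G1, one half joins the accumulated sum and the other, as eta <= ca,
    becomes the weight dt eta G1 that pays for the strip in the next step. *)
Lemma weighted_energy_step {R : realType} (C dt eta ca N0 Ns X E1 G0 G1 J1 S b : R) :
  0 <= C -> 0 <= dt -> 0 <= eta -> eta <= ca ->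
  0 <= X -> 0 <= G0 -> 0 <= G1 -> 0 <= J1 -> 0 <= S ->
  Ns <= (1 + C * dt) * N0 + eta * dt * G0 ->
  (1 - 2 * dt) * E1 + 2 * dt * (ca * G1 + J1) <= Ns + X + dt * b ->
  (1 - 2 * dt) * (E1 + dt * eta * G1 + dt * (S + (ca * G1 + J1))) <=
  (1 + C * dt) * (N0 + X + dt * eta * G0 + dt * S) + dt * b.
Proof.
move=> C0 dt0 eta0 eca X0 G00 G10 J0 S0 hs he.
have ca0 : 0 <= ca by exact: le_trans eca.
have Cdt : 0 <= C * dt by rewrite mulr_ge0.
have e0 : 0 <= dt * eta * G0 + dt * S by rewrite addr_ge0 // mulr_ge0 // mulr_ge0.
have e1 : 0 <= dt * eta * G1 + dt * (S + (ca * G1 + J1)).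
  by rewrite addr_ge0 // mulr_ge0 // ?mulr_ge0 // !addr_ge0 // mulr_ge0.
have e2 := mulr_ge0 Cdt X0.
have e3 := mulr_ge0 Cdt e0.
have e4 := mulr_ge0 dt0 e1.
have e5 := ler_wpM2l dt0 (ler_wpM2r G10 eca).
have e6 := mulr_ge0 dt0 J0.
lra.
Qed.

Theorem theorem4p8 (R : realType) (d k : nat) (P : problem R d)
    (cdel cdelh cV cE csr cqu cK : R) (M : nat) (gl cgp : R)
    (hd : d = 2%N \/ d = 3%N) (hk : (2 <= k)%N)
    (hP : continuous_problem P)
    (hcdel : 1 < cdel) (hcdelh : 1 < cdelh) (hcV : 1 < cV) (hcVdel : cV < cdel)
    (hcE : 0 < cE) (hcsr : 0 < csr) (hcqu : 0 < cqu) (hcK : 0 < cK)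
    (hgl : 0 < gl) (hcgp : 0 < cgp) :
  exists gs0 : R, 0 < gs0 /\ forall gs : R, gs0 <= gs ->
  exists dt0 ca cb cc : R, [/\ 0 < dt0, 0 < ca, 0 < cb & 0 < cc] /\
  forall N : nat, (0 < N)%N ->
  let dt := tend P / N%:R in
  let del := cdel * dt * winf P in
  let delh := cdelh * winf P * dt in
  dt <= dt0 ->
  forall E : set 'rV[R]_d -> ('rV[R]_d -> 'rV[R]_d) -> 'rV[R]_d -> 'rV[R]_d,
  extension_assumption P k del cE E ->
  velocity_assumption P N del cV E ->
  forall (T : mesh R d) (h : R) (K : nat),
  simplicial_mesh T (Otilde P) -> mesh_size T h ->
  shape_regular T csr -> quasi_uniform T cqu h ->
  K%:R <= cK * (1 + delh / h) ->
  forall (u lam : nat -> 'rV[R]_d -> 'rV[R]_d) (xi chi : nat -> 'rV[R]_d),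
  discrete_solution P T k N h delh (gs * K%:R) gl u lam xi chi ->
  (forall n, (n < N)%N ->
    OmD P (chi n.+1) `<=` strip P delh (OmD P (chi n))) ->
  (forall n, (n <= N)%N ->
    strip P delh (OmD P (chi n)) `<=` strip P del (Om P (n%:R * dt))) ->
  (forall n, (n <= N)%N -> mesh_assumption P T K M delh (chi n)) ->
  (forall n, (n <= N)%N -> ghost_equivalence P T k K cgp h delh (chi n)) ->
  forall m, (1 <= m <= N)%N ->
  let tm := m%:R * dt in
  sqnorm (OmD P (chi m)) (u m) + enorm (xi m) ^+ 2 + enorm (chi m) ^+ 2 +
  dt * (\sum_(1 <= n < m.+1)
    (ca * sqgrad (Oact P T delh (chi n)) (u n) +
     gl * jh P T h (chi n) (lam n) (lam n))) <=
  expR (tm * (cb / (1 - dt * cb))) *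
  (sqnorm (OmD P (chi 0%N)) (u 0%N) + enorm (xi 0%N) ^+ 2 +
   cgp * dt / 2 * tnorm_sq P T h delh (chi 0%N) (u 0%N) +
   tm * (cc / area P) * enorm (grav P) ^+ 2).
Proof.
have d1 : (1 < d)%N by case: hd => ->.
have d0 : (0 < d)%N by exact: ltnW.
pose w0 := cdelh * winf P.
have w00 : 0 <= w0 by rewrite mulr_ge0 ?winf_ge0 //; lra.
pose eta := Num.min cgp^-1 (cgp / 2).
have eta0 : 0 < eta by rewrite lt_min invr_gt0 hcgp divr_gt0.
have eta1 : eta <= cgp^-1 by rewrite /eta ge_min lexx.
have eta2 : eta <= cgp / 2 by rewrite /eta ge_min lexx orbT.
have [dts [C [dts0 C0 strip_le]]] := strip_estimate hP d0 w00 eta0.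
have A0 := area_gt0 d1 hP.
exists 1; split; first exact: ltr01.
move=> gs gs1.
have C2 : 0 < C + 2 by lra.
(* The second bound on dt gives dt (C + 2) <= 1/2, so the denominator in the exponent is positive. C
   + 2 adds the growth from the strip to that from Young's inequality. *)
exists (Num.min dts (2 * (C + 2))^-1), cgp^-1, (C + 2), (area P); split.
  by split; rewrite ?lt_min ?dts0 ?invr_gt0 ?mulr_gt0.
move=> N N0 dt del delh dtle E _ _ T h K hT _ _ _ _ u lam xi chi
  [chi0 hu0 hadm hstep] hOm _ _ hgh m /andP[_ mN]; cbv zeta; set tm := m%:R * dt.
move: dtle; rewrite le_min => /andP[dt1 dt2].
have dt0 : 0 < dt by rewrite divr_gt0 ?(tend_gt0 hP) // ltr0n.
have dtC : dt * (C + 2) < 1.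
  apply: (@le_lt_trans _ _ ((2 * (C + 2))^-1 * (C + 2))); first exact: ler_wpM2r (ltW C2) _ _ dt2.
  by rewrite invfM -mulrA mulVf ?gt_eqF // mulr1 invf_lt1 // ltr1n.
have r0 : 0 <= delh by rewrite mulr_ge0 // ltW.
have hV n : (n <= N)%N -> Vh P T k delh (chi n) (u n).
  by case: n => [|n] nN //; case: (hstep n nN).
pose G n := sqgrad (Oact P T delh (chi n)) (u n).
pose J n := jh P T h (chi n) (lam n) (lam n).
pose En n := sqnorm (OmD P (chi n)) (u n) + enorm (xi n) ^+ 2 + enorm (chi n) ^+ 2.
(* The energy for Gronwall: current norms, the gradient reserve for the next strip, and the
   dissipation so far. *)
pose W n := En n + dt * eta * G n + dt * \sum_(1 <= i < n.+1) (cgp^-1 * G i + gl * J i).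
have G0 n : 0 <= G n by exact: sqgrad_ge0.
have E0 n : 0 <= En n by rewrite !addr_ge0 ?sqr_ge0 ?sqnorm_ge0.
have S0 n : 0 <= \sum_(1 <= i < n.+1) (cgp^-1 * G i + gl * J i).
  by apply: sumr_ge0 => i _; rewrite addr_ge0 // mulr_ge0 ?jh_ge0 ?invr_ge0 ?(ltW hcgp) ?(ltW hgl).
have cc1 : area P / area P = 1 by rewrite divff // gt_eqF.
have step n : (n < N)%N ->
    (1 - 2 * dt) * W n.+1 <= (1 + C * dt) * W n + dt * enorm (grav P) ^+ 2.
  move=> nN; have [hu hl heq] := hstep n nN.
  have gsK : K%:R <= gs * K%:R by rewrite ler_peMl.
  have := energy_step hP d1 hT r0 dt0 hcgp (ltW hgl) gsK (hadm _ nN) (hadm _ (ltnW nN))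
    (hOm n nN) hu (hV n (ltnW nN)) hl (hgh _ nN) heq.
  have := strip_le dt T k (chi n) (u n) (ltW dt0) dt1 hT (hadm _ (ltnW nN)) (hV n (ltnW nN)).
  rewrite -/w0 -/(G n) -/(G n.+1) -/(J n.+1) -/(En n.+1) /W => hs he.
  rewrite big_nat_recr //=; set S := \sum_(1 <= i < n.+1) _.
  pose X := enorm (xi n) ^+ 2 + enorm (chi n) ^+ 2.
  have -> : En n = sqnorm (OmD P (chi n)) (u n) + X by rewrite /En addrA.
  rewrite -(addrA (sqnorm (strip _ _ _) _) (enorm (xi n) ^+ 2)) -/X in he.
  have X0 : 0 <= X by rewrite addr_ge0 ?sqr_ge0.
  have J0 : 0 <= gl * J n.+1 by rewrite mulr_ge0 ?jh_ge0 // ltW.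
  exact: (weighted_energy_step C0 (ltW dt0) (ltW eta0) eta1 X0 (G0 n) (G0 n.+1) J0 (S0 n) hs he).
have G0' n : 0 <= dt * eta * G n by rewrite mulr_ge0 // mulr_ge0 // ltW.
have W0 : 0 <= W 0%N.
  by rewrite /W big_nil mulr0 addr0 addr_ge0.
have := discrete_gronwall C0 (sqr_ge0 (enorm (grav P))) (ltW dt0) dtC W0 step mN.
rewrite cc1 mulr1 -/tm => hW.
have Wm : En m + dt * \sum_(1 <= i < m.+1) (cgp^-1 * G i + gl * J i) <= W m.
  by rewrite /W lerD2r lerDl.
apply: le_trans Wm (le_trans hW _); apply: ler_wpM2l; first exact: expR_ge0.
rewrite lerD2r /W big_nil mulr0 addr0 /En chi0.
rewrite (_ : enorm 0 ^+ 2 = 0) ?addr0; last by rewrite enorm_sqr dotv0l.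
(* The initial reserve dt eta |grad u^0|^2 is bounded through eta <= cgp/2, and the gradient by the
   triple norm. *)
rewrite -chi0 lerD2l; apply: (@le_trans _ _ (cgp * dt / 2 * G 0%N)).
  apply: ler_wpM2r => //; have -> : cgp * dt / 2 = dt * (cgp / 2) by ring.
  exact: ler_wpM2l (ltW dt0) _ _ eta2.
apply: ler_wpM2l; first by rewrite divr_ge0 // mulr_ge0 // ltW.
exact: tnorm_sq_ge.
Qed.
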